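(* Let $\mathcal M$ be a monoidal model category, and let $A$ be a monoid in $\mathcal M$. If the category ${}_A\mathcal M$ of left $A$-modules is a closed model category with fibrations and weak equivalences created in $\mathcal M$, then: (a) The right derived functor ${}^A[\![-,-]\!]$ of ${}^A[-,-]\colon {}_A\mathcal M^{\mathrm{op}}\times{}_A\mathcal M\to\mathcal M$ exists and enriches $\mathrm{Ho}({}_A\mathcal M)$ over $\mathrm{Ho}\mathcal M$. (b) The right derived functor $[\![-,-]\!]$ of the cotensor functor $[-,-]\colon \mathcal M^{\mathrm{op}}\times {}_A\mathcal M\to {}_A\mathcal M$ exists and provides cotensors for $\mathrm{Ho}({}_A\mathcal M)$ over $\mathrm{Ho}\mathcal M$. (c) The left derived functor $\widehat\wedge$ of the tensor functor $\wedge\colon {}_A\mathcal M\times \mathcal M \to {}_A\mathcal M$ exists and provides tensors for $\mathrm{Ho}({}_A\mathcal M)$ over $\mathrm{Ho}\mathcal M$.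
   Context: Monoidal model category: a closed model category $\mathcal M$ with a closed symmetric monoidal structure (product $\wedge$, unit $I$, internal function object $[-,-]$) such that: (Enr) if $g\colon K\to L$ is a cofibration and $h\colon X\to Y$ is a fibration, then the induced map $[L,X]\to[K,X]\times_{[K,Y]}[L,Y]$ is a fibration, and it is a weak equivalence if $g$ or $h$ is; (Unit) there exist a cofibrant object $I_c$ and a weak equivalence $\omega\colon I_c\to I$ such that $Z\cong[I,Z]\xrightarrow{\omega^*}[I_c,Z]$ is a weak equivalence for every fibrant $Z$. The left derived functor $\widehat\wedge$ of $\wedge$ and the right derived functor $[\![-,-]\!]$ of $[-,-]$ make $\mathrm{Ho}\mathcal M$ closed symmetric monoidal. Modules: a left $A$-module is an object $M$ of $\mathcal M$ with an associative and unital action $A\wedge M\to M$. For left $A$-modules $L,M$, the object ${}^A[L,M]$ of $\mathcal M$ is the equalizer of the two maps $[L,M]\rightrightarrows[A\wedge L,M]$, one induced by the action on $L$, the other the composite $[L,M]\to[A\wedge L,A\wedge M]\to[A\wedge L,M]$ using the action on $M$; this enriches ${}_A\mathcal M$ over $\mathcal M$. For $X$ in $\mathcal M$, the objects $M\wedge X$ and $[X,M]$ inherit left $A$-actions from $M$ and are the tensor and cotensor of $M$ with $X$. The model structure on ${}_A\mathcal M$ has fibrations and weak equivalences created in $\mathcal M$ if a map of ${}_A\mathcal M$ is a fibration (weak equivalence) exactly when its underlying map in $\mathcal M$ is. Derived functors: products of closed model categories have coordinatewise model structures; the opposite of a model category has fibrations and cofibrations interchanged. For a functor $\Phi\colon\mathcal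 C\to\mathcal H$ on a closed model category with localization $\gamma\colon\mathcal C\to\mathrm{Ho}\mathcal C$, the left derived functor is a functor $L\Phi\colon\mathrm{Ho}\mathcal C\to\mathcal H$ with a natural transformation $L\Phi\circ\gamma\to\Phi$ that is final among natural transformations $F\circ\gamma\to\Phi$; right derived functors are dual. For a functor into a model category $\mathcal D$, the derived functor means that of its composite with $\mathcal D\to\mathrm{Ho}\mathcal D$. Enrichment: an enrichment over a closed symmetric monoidal category $\mathcal V$ of a category $\mathcal C$ is an isomorphism (or equivalence) of $\mathcal C$ with the underlying category of a $\mathcal V$-enriched category with the stated mapping objects. In a $\mathcal V$-enriched category with mapping objects $\mathcal C[-,-]$, a tensor $C\otimes X$ and a cotensor $\langle X,C\rangle$ (for $X$ in $\mathcal V$, $C$ in $\mathcal C$) are objects of $\mathcal C$ with enriched natural isomorphisms $\mathcal C[C\otimes X,-]\cong[X,\mathcal C[C,-]]$ and $\mathcal C[-,\langle X,C\rangle]\cong[X,\mathcal C[-,C]]$, where $[-,-]$ is the internal function object of $\mathcal V$. *)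

(* Defs.v *)
From Corelib Require Import ssreflect.
From Stdlib Require Import FunctionalExtensionality PropExtensionality.
From Stdlib Require Import ProofIrrelevance IndefiniteDescription.

Set Implicit Arguments.
Unset Strict Implicit.
Unset Printing Implicit Defensive.

Declare Scope cat_scope.
Delimit Scope cat_scope with cat.
Open Scope cat_scope.

(** * Categories, functors, natural transformations *)

Record Category := {
  Ob :> Type;
  Hom : Ob -> Ob -> Type;
  idm : forall x, Hom x x;
  comp : forall x y z, Hom y z -> Hom x y -> Hom x z;
  comp_assoc : forall x y z w (h : Hom z w) (g : Hom y z) (f : Hom x y),
    comp h (comp g f) = comp (comp h g) f;
  comp_idl : forall x y (f : Hom x y), comp (idm y) f = f;
  comp_idr : forall x y (f : Hom x y), comp f (idm x) = f }.

Arguments Hom {c} x y.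
Arguments idm {c} x.
Arguments comp {c x y z} g f.

Notation "g ∘ f" := (comp g f) (at level 40, left associativity) : cat_scope.

Lemma post (C : Category) (x y z w : C) (b : Hom y z) (a : Hom x y)
    (r : Hom x z) : b ∘ a = r -> forall k : Hom z w, k ∘ b ∘ a = k ∘ r.
Proof. by move=> <- k; rewrite comp_assoc. Qed.

Lemma post3 (C : Category) (x y z w v : C) (c : Hom z w) (b : Hom y z)
    (a : Hom x y) (r : Hom x w) :
  c ∘ b ∘ a = r -> forall k : Hom w v, k ∘ c ∘ b ∘ a = k ∘ r.
Proof. by move=> <- k; rewrite !comp_assoc. Qed.

Definition is_iso (C : Category) (x y : C) (f : Hom x y) : Prop :=
  exists g : Hom y x, g ∘ f = idm x /\ f ∘ g = idm y.

Definition op (C : Category) : Category.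
Proof.
refine {| Ob := Ob C; Hom := fun x y => @Hom C y x; idm := fun x => @idm C x;
          comp := fun x y z g f => @comp C z y x f g |}.
- by move=> *; rewrite comp_assoc.
- by move=> *; rewrite comp_idr.
- by move=> *; rewrite comp_idl.
Defined.

Definition prodC (C D : Category) : Category.
Proof.
refine {| Ob := (Ob C * Ob D)%type;
          Hom := fun p q => (Hom (fst p) (fst q) * Hom (snd p) (snd q))%type;
          idm := fun p => (idm (fst p), idm (snd p));
          comp := fun p q r g f => (fst g ∘ fst f, snd g ∘ snd f) |}.
- by move=> *; rewrite /= !comp_assoc.
- by move=> p q [f g]; rewrite /= !comp_idl.
- by move=> p q [f g]; rewrite /= !comp_idr.
Defined.

Record Functor (C D : Category) := {
  fobj :> C -> D;
  fmap : forall x y : C, Hom x y -> Hom (fobj x) (fobj y);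
  fmap_id : forall x, fmap (idm x) = idm (fobj x);
  fmap_comp : forall x y z (g : Hom y z) (f : Hom x y),
    fmap (g ∘ f) = fmap g ∘ fmap f }.

Arguments fmap {C D} _ {x y} _.

Record NatTrans (C D : Category) (F G : Functor C D) := {
  nt :> forall x : C, Hom (F x) (G x);
  nt_nat : forall (x y : C) (f : Hom x y), nt y ∘ fmap F f = fmap G f ∘ nt x }.

Definition compF (C D E : Category) (G : Functor D E) (F : Functor C D) :
  Functor C E.
Proof.
refine {| fobj := fun x => G (F x); fmap := fun x y f => fmap G (fmap F f) |}.
- by move=> x; rewrite !fmap_id.
- by move=> *; rewrite !fmap_comp.
Defined.

Definition opF (C D : Category) (F : Functor C D) : Functor (op C) (op D).
Proof.
refine {| fobj := (F : op C -> op D); fmap := fun x y f => @fmap _ _ F y x f |}.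
- by move=> x; apply: (fmap_id F).
- by move=> *; apply: (fmap_comp F).
Defined.

Definition prodF (C D C' D' : Category) (F : Functor C C') (G : Functor D D') :
  Functor (prodC C D) (prodC C' D').
Proof.
refine {| fobj := fun p : prodC C D => ((F (fst p), G (snd p)) : prodC C' D');
          fmap := fun (p q : prodC C D) f => (fmap F (fst f), fmap G (snd f)) |}.
- by move=> *; rewrite /= !fmap_id.
- by move=> *; rewrite /= !fmap_comp.
Defined.

(** Functors of two variables. *)
Section Bifunctors.
Context {C D E : Category} (T : Functor (prodC C D) E).

Definition bob (x : C) (y : D) : E := T (x, y).

Definition bmap {x x' : C} {y y' : D} (f : Hom x x') (g : Hom y y') :
  Hom (bob x y) (bob x' y') := @fmap _ _ T (x, y) (x', y') (f, g).

Lemma bmap_id x y : bmap (idm x) (idm y) = idm (bob x y).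
Proof. exact: (@fmap_id _ _ T (x, y)). Qed.

Lemma bmap_comp x x' x'' y y' y'' (f' : Hom x' x'') (f : Hom x x')
    (g' : Hom y' y'') (g : Hom y y') :
  bmap (f' ∘ f) (g' ∘ g) = bmap f' g' ∘ bmap f g.
Proof. exact: (@fmap_comp _ _ T (x, y) (x', y') (x'', y'') (f', g') (f, g)). Qed.

Lemma bmap_l x x' x'' y (f' : Hom x' x'') (f : Hom x x') :
  bmap (f' ∘ f) (idm y) = bmap f' (idm y) ∘ bmap f (idm y).
Proof. by rewrite -bmap_comp comp_idl. Qed.

Lemma bmap_r x y y' y'' (g' : Hom y' y'') (g : Hom y y') :
  bmap (idm x) (g' ∘ g) = bmap (idm x) g' ∘ bmap (idm x) g.
Proof. by rewrite -bmap_comp comp_idl. Qed.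

Lemma bmap_lr x x' y y' (f : Hom x x') (g : Hom y y') :
  bmap f g = bmap f (idm y') ∘ bmap (idm x) g.
Proof. by rewrite -bmap_comp comp_idl comp_idr. Qed.

Lemma bmap_rl x x' y y' (f : Hom x x') (g : Hom y y') :
  bmap f g = bmap (idm x') g ∘ bmap f (idm y).
Proof. by rewrite -bmap_comp comp_idl comp_idr. Qed.
End Bifunctors.

(** * Localization *)

Definition MorphismClass (C : Category) := forall x y : C, Hom x y -> Prop.

Definition opW (C : Category) (W : MorphismClass C) : MorphismClass (op C) :=
  fun x y f => W y x f.

Definition prodW (C D : Category) (W : MorphismClass C) (W' : MorphismClass D) :
  MorphismClass (prodC C D) := fun p q f => W _ _ (fst f) /\ W' _ _ (snd f).

Section Localization.
Context (C : Category) (W : MorphismClass C).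

(** Formal composites of morphisms of [C] and of formal inverses of morphisms
    in [W], and the least congruence making them into a category in which the
    formal inverses are inverses. *)
Inductive word : C -> C -> Type :=
| wmor x y : Hom x y -> word x y
| winv x y (w : Hom x y) : W w -> word y x
| wcomp x y z : word y z -> word x y -> word x z.

Inductive weq : forall x y, word x y -> word x y -> Prop :=
| weq_refl x y (a : word x y) : weq a a
| weq_sym x y (a b : word x y) : weq a b -> weq b a
| weq_trans x y (a b c : word x y) : weq a b -> weq b c -> weq a c
| weq_comp x y z (a a' : word y z) (b b' : word x y) :
    weq a a' -> weq b b' -> weq (wcomp a b) (wcomp a' b')
| weq_assoc x y z t (a : word z t) (b : word y z) (c : word x y) :
    weq (wcomp a (wcomp b c)) (wcomp (wcomp a b) c)
| weq_idl x y (a : word x y) : weq (wcomp (wmor (idm y)) a) a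
| weq_idr x y (a : word x y) : weq (wcomp a (wmor (idm x))) a
| weq_mor x y z (g : Hom y z) (f : Hom x y) :
    weq (wcomp (wmor g) (wmor f)) (wmor (g ∘ f))
| weq_invl x y (w : Hom x y) (h : W w) :
    weq (wcomp (winv h) (wmor w)) (wmor (idm x))
| weq_invr x y (w : Hom x y) (h : W w) :
    weq (wcomp (wmor w) (winv h)) (wmor (idm y)).

Definition locHom (x y : C) : Type :=
  {P : word x y -> Prop | exists a, P = weq a}.

Definition wclass x y (a : word x y) : locHom x y :=
  exist _ (weq a) (ex_intro _ a eq_refl).

Definition wrep x y (p : locHom x y) : word x y :=
  proj1_sig (constructive_indefinite_description _ (proj2_sig p)).

Lemma wclass_rep x y (p : locHom x y) : wclass (wrep p) = p.
Proof.
rewrite /wrep; case: constructive_indefinite_description => a /= h.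
case: p h => P hP /= h.
by apply: eq_sig_hprop => [*|]; [exact: proof_irrelevance | rewrite /= h].
Qed.

Lemma wclass_eq x y (a b : word x y) : weq a b -> wclass a = wclass b.
Proof.
move=> h; apply: eq_sig_hprop => [*|/=]; first exact: proof_irrelevance.
apply: functional_extensionality => c; apply: propositional_extensionality.
split=> k; first exact: weq_trans (weq_sym h) k.
exact: weq_trans h k.
Qed.

Lemma wclass_inj x y (a b : word x y) : wclass a = wclass b -> weq a b.
Proof. by move=> [->]; apply: weq_refl. Qed.

Lemma wrep_class x y (a : word x y) : weq (wrep (wclass a)) a.
Proof. by apply: wclass_inj; rewrite wclass_rep. Qed.

Definition Loc : Category.
Proof.
refine {| Ob := Ob C; Hom := locHom; idm := fun x => wclass (wmor (idm x));
          comp := fun x y z g f => wclass (wcomp (wrep g) (wrep f)) |}.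
- move=> x y z t h g f; apply: wclass_eq.
  apply: weq_trans (weq_comp (weq_refl _) (wrep_class _)) _.
  apply: weq_trans (weq_assoc _ _ _) _.
  exact: weq_comp (weq_sym (wrep_class _)) (weq_refl _).
- move=> x y f; rewrite -[RHS]wclass_rep; apply: wclass_eq.
  exact: weq_trans (weq_comp (wrep_class _) (weq_refl _)) (weq_idl _).
- move=> x y f; rewrite -[RHS]wclass_rep; apply: wclass_eq.
  exact: weq_trans (weq_comp (weq_refl _) (wrep_class _)) (weq_idr _).
Defined.

Definition loc : Functor C Loc.
Proof.
refine {| fobj := fun x : C => (x : Loc);
          fmap := fun (x y : C) (f : Hom x y) => wclass (wmor f) |}.
- by [].
- move=> x y z g f; apply: wclass_eq; apply: weq_trans (weq_sym (weq_mor g f)) _.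
  exact: weq_sym (weq_comp (wrep_class _) (wrep_class _)).
Defined.

Lemma wclass_comp x y z (a : word y z) (b : word x y) :
  wclass (wcomp a b) = @comp Loc _ _ _ (wclass a) (wclass b).
Proof. exact: wclass_eq (weq_sym (weq_comp (wrep_class _) (wrep_class _))). Qed.

Lemma loc_inverts x y (w : Hom x y) : W w -> is_iso (fmap loc w).
Proof.
move=> h; exists (wclass (winv h)).
split.
- exact: eq_trans (eq_sym (wclass_comp _ _)) (wclass_eq (weq_invl h)).
- exact: eq_trans (eq_sym (wclass_comp _ _)) (wclass_eq (weq_invr h)).
Qed.

Section Lift.
Context (D : Category) (F : Functor C D)
  (hF : forall x y (w : Hom x y), W w -> is_iso (fmap F w)).

Fixpoint weval x y (a : word x y) : Hom (F x) (F y) :=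
  match a with
  | wmor f => fmap F f
  | winv h => proj1_sig (constructive_indefinite_description _ (hF h))
  | wcomp a b => weval a ∘ weval b
  end.

Lemma weval_eq x y (a b : word x y) : weq a b -> weval a = weval b.
Proof.
elim=> //= {x y a b}.
- by move=> x y a b c _ -> _ ->.
- by move=> x y z a a' b b' _ -> _ ->.
- by move=> *; rewrite comp_assoc.
- by move=> *; rewrite fmap_id comp_idl.
- by move=> *; rewrite fmap_id comp_idr.
- by move=> *; rewrite fmap_comp.
- move=> x y w h; case: constructive_indefinite_description => g /= [-> _].
  by rewrite fmap_id.
- move=> x y w h; case: constructive_indefinite_description => g /= [_ ->].
  by rewrite fmap_id.
Qed.

Definition loc_lift : Functor Loc D.
Proof.
refine {| fobj := (F : Loc -> D); fmap := fun x y p => weval (wrep p) |}.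
- by move=> x; rewrite (weval_eq (wrep_class _)) /= fmap_id.
- by move=> x y z g f; rewrite (weval_eq (wrep_class _)).
Defined.
End Lift.

End Localization.

Lemma functor_eq (C D : Category) (o : C -> D)
    (m m' : forall x y : C, Hom x y -> Hom (o x) (o y)) i i' c c' :
  (forall x y (f : Hom x y), m x y f = m' x y f) ->
  Build_Functor (fmap := m) i c = Build_Functor (fmap := m') i' c'.
Proof.
move=> h; have e : m = m'.
  apply: functional_extensionality_dep => x.
  apply: functional_extensionality_dep => y.
  exact: functional_extensionality.
move: i i' c c'; rewrite e => i i' c c'.
by rewrite (proof_irrelevance _ i i') (proof_irrelevance _ c c').
Qed.

Theorem loc_universal (C : Category) (W : MorphismClass C) (D : Category)
    (F : Functor C D) :
  (forall x y (w : Hom x y), W x y w -> is_iso (fmap F w)) ->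
  exists! G : Functor (Loc W) D, compF G (loc W) = F.
Proof.
move=> hF; exists (loc_lift hF); split.
  case: F hF => o m i c hF; apply: functor_eq => x y f /=.
  by rewrite (weval_eq hF (wrep_class _)).
move=> G e; subst F; case: G hF => o m i c hF; apply: functor_eq => x y p /=.
set G := Build_Functor i c in hF *.
rewrite -[in RHS](wclass_rep p); elim: (wrep p) => //= {x y p}.
- move=> x y w h; case: constructive_indefinite_description => g /= [gw _].
  have wi : m _ _ (wclass (wmor W w)) ∘ m _ _ (wclass (winv h)) = idm (o y).
    by rewrite -i -c -wclass_comp; congr (m _ _ _); apply: wclass_eq; apply: weq_invr.
  by rewrite -[LHS](comp_idr (c := D)) -wi comp_assoc gw comp_idl.
- by move=> x y z a -> b ->; rewrite wclass_comp c.
Qed.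

(** The canonical comparison functors from the localization of a product to
    the product of the localizations, the first factor being possibly opposite.
    Both are isomorphisms when the classes contain the identities. *)
Section Comparison.
Context (C D : Category) (W : MorphismClass C) (W' : MorphismClass D).

Definition loc_prod : Functor (Loc (prodW W W')) (prodC (Loc W) (Loc W')).
Proof.
refine (@loc_lift _ _ _ (prodF (loc W) (loc W')) _).
move=> p q [f g] [/= /loc_inverts[f' [h1 h2]] /loc_inverts[g' [h3 h4]]].
by exists (f', g'); split; congr pair.
Defined.

Definition loc_op_prod :
  Functor (Loc (prodW (opW W) W')) (prodC (op (Loc W)) (Loc W')).
Proof.
refine (@loc_lift _ _ _ (prodF (opF (loc W)) (loc W')) _).
move=> p q [f g] [/= hf /loc_inverts[g' [h3 h4]]].
have [f' [h1 h2]] := loc_inverts (W := W) hf.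
by exists (f', g'); split; congr pair.
Defined.
End Comparison.

(** * Derived functors *)

Definition IsLeftDerived (C : Category) (W : MorphismClass C) (H : Category)
    (Phi : Functor C H) (L : Functor (Loc W) H)
    (e : NatTrans (compF L (loc W)) Phi) : Prop :=
  forall (F : Functor (Loc W) H) (b : NatTrans (compF F (loc W)) Phi),
  exists t : NatTrans F L,
    (forall x : C, e x ∘ t x = b x) /\
    (forall t' : NatTrans F L,
       (forall x : C, e x ∘ t' x = b x) -> forall x, t' x = t x).

Definition IsRightDerived (C : Category) (W : MorphismClass C) (H : Category)
    (Phi : Functor C H) (R : Functor (Loc W) H)
    (e : NatTrans Phi (compF R (loc W))) : Prop :=
  forall (F : Functor (Loc W) H) (b : NatTrans Phi (compF F (loc W))),
  exists t : NatTrans R F,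
    (forall x : C, t x ∘ e x = b x) /\
    (forall t' : NatTrans R F,
       (forall x : C, t' x ∘ e x = b x) -> forall x, t' x = t x).

Arguments IsLeftDerived {C W H Phi} L e.
Arguments IsRightDerived {C W H Phi} R e.

(** * Closed symmetric monoidal categories *)

Record SymMonoidal (C : Category) := {
  tens : Functor (prodC C C) C;
  unit : C;
  asc : forall x y z,
    Hom (bob tens (bob tens x y) z) (bob tens x (bob tens y z));
  lun : forall x, Hom (bob tens unit x) x;
  run : forall x, Hom (bob tens x unit) x;
  swp : forall x y, Hom (bob tens x y) (bob tens y x);
  (* inverses of [asc], [lun] and [run] *)
  ascV : forall x y z,
    Hom (bob tens x (bob tens y z)) (bob tens (bob tens x y) z);
  lunV : forall x, Hom x (bob tens unit x);
  runV : forall x, Hom x (bob tens x unit);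
  ascK : forall x y z, ascV x y z ∘ asc x y z = idm _;
  ascVK : forall x y z, asc x y z ∘ ascV x y z = idm _;
  lunK : forall x, lunV x ∘ lun x = idm _;
  lunVK : forall x, lun x ∘ lunV x = idm _;
  runK : forall x, runV x ∘ run x = idm _;
  runVK : forall x, run x ∘ runV x = idm _;
  asc_nat : forall x x' y y' z z' (f : Hom x x') (g : Hom y y') (h : Hom z z'),
    asc x' y' z' ∘ bmap tens (bmap tens f g) h =
    bmap tens f (bmap tens g h) ∘ asc x y z;
  lun_nat : forall x x' (f : Hom x x'),
    lun x' ∘ bmap tens (idm unit) f = f ∘ lun x;
  run_nat : forall x x' (f : Hom x x'),
    run x' ∘ bmap tens f (idm unit) = f ∘ run x;
  swp_nat : forall x x' y y' (f : Hom x x') (g : Hom y y'),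
    swp x' y' ∘ bmap tens f g = bmap tens g f ∘ swp x y;
  pentagon : forall w x y z,
    asc w x (bob tens y z) ∘ asc (bob tens w x) y z =
    bmap tens (idm w) (asc x y z) ∘ asc w (bob tens x y) z
      ∘ bmap tens (asc w x y) (idm z);
  triangle : forall x y,
    bmap tens (idm x) (lun y) ∘ asc x unit y = bmap tens (run x) (idm y);
  hexagon : forall x y z,
    asc y z x ∘ swp x (bob tens y z) ∘ asc x y z =
    bmap tens (idm y) (swp x z) ∘ asc y x z ∘ bmap tens (swp x y) (idm z);
  swpK : forall x y, swp y x ∘ swp x y = idm _ }.

Arguments asc {C} s x y z.
Arguments lun {C} s x.
Arguments run {C} s x.
Arguments swp {C} s x y.
Arguments ascV {C} s x y z.
Arguments lunV {C} s x.
Arguments runV {C} s x.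

Record Closed (C : Category) (S : SymMonoidal C) := {
  ihom : C -> C -> C;
  ev : forall x y, Hom (bob (tens S) (ihom x y) x) y;
  curry : forall z x y, Hom (bob (tens S) z x) y -> Hom z (ihom x y);
  ev_curry : forall z x y (f : Hom (bob (tens S) z x) y),
    ev x y ∘ bmap (tens S) (curry f) (idm x) = f;
  curry_ev : forall z x y (g : Hom z (ihom x y)),
    curry (ev x y ∘ bmap (tens S) g (idm x)) = g }.

Arguments ihom {C S} c x y.
Arguments ev {C S} c x y.
Arguments curry {C S} c {z x y} f.

Section MonoidalLemmas.
Context {C : Category} (S : SymMonoidal C).
Local Notation "x ⊗ y" := (bob (tens S) x y) (at level 38, left associativity).
Local Notation "f ⊠ g" := (bmap (tens S) f g) (at level 38, left associativity).

Lemma asc_inj x y z w (f g : Hom (x ⊗ (y ⊗ z)) w) :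
  f ∘ asc S x y z = g ∘ asc S x y z -> f = g.
Proof.
move=> h; rewrite -(comp_idr f) -(comp_idr g) -(ascVK S x y z) !comp_assoc.
by rewrite h.
Qed.

Lemma unit_faithful x y (f g : Hom x y) :
  idm (unit S) ⊠ f = idm (unit S) ⊠ g -> f = g.
Proof.
move=> h; rewrite -(comp_idr f) -(comp_idr g) -(lunVK S x) !comp_assoc.
by rewrite -!lun_nat h.
Qed.

Lemma lun_asc x y : lun S (x ⊗ y) ∘ asc S (unit S) x y = lun S x ⊠ idm y.
Proof.
apply: unit_faithful; apply: asc_inj.
rewrite -{1}(comp_idl (idm (unit S))) bmap_comp.
have e : bmap (tens S) (asc S (unit S) (unit S) x) (idm y) ∘
           bmap (tens S) (ascV S (unit S) (unit S) x) (idm y) = idm _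
  by rewrite -bmap_comp ascVK comp_idl bmap_id.
rewrite -[LHS]comp_idr -[RHS]comp_idr -e !comp_assoc; congr (_ ∘ _).
rewrite -!comp_assoc [X in _ ∘ X]comp_assoc -pentagon comp_assoc triangle.
rewrite -(bmap_id (tens S)) -asc_nat -triangle.
by rewrite comp_assoc -asc_nat -comp_assoc -bmap_comp comp_idl.
Qed.

Lemma ascV_nat x x' y y' z z' (f : Hom x x') (g : Hom y y') (h : Hom z z') :
  ascV S x' y' z' ∘ (f ⊠ (g ⊠ h)) = (f ⊠ g ⊠ h) ∘ ascV S x y z.
Proof.
apply: asc_inj; rewrite -!comp_assoc ascK comp_idr -asc_nat comp_assoc ascK.
by rewrite comp_idl.
Qed.

Lemma pentagonV w x y z :
  ascV S w (x ⊗ y) z ∘ (idm w ⊠ ascV S x y z) ∘ asc S w x (y ⊗ z) =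
  (asc S w x y ⊠ idm z) ∘ ascV S (w ⊗ x) y z.
Proof.
apply: asc_inj; rewrite (post (pentagon S w x y z)) -!comp_assoc ascK comp_idr.
rewrite [X in _ ∘ X]comp_assoc -bmap_r ascK bmap_id.
by rewrite comp_idl comp_assoc ascK comp_idl.
Qed.

Context (K : Closed S).

Lemma curry_inj z x y (f g : Hom z (ihom K x y)) :
  ev K x y ∘ (f ⊠ idm x) = ev K x y ∘ (g ⊠ idm x) -> f = g.
Proof. by move=> h; rewrite -(curry_ev f) -(curry_ev g) h. Qed.

Definition ihom_map x x' y y' (f : Hom x' x) (g : Hom y y') :
  Hom (ihom K x y) (ihom K x' y') :=
  curry K (g ∘ ev K x y ∘ (idm (ihom K x y) ⊠ f)).

Lemma ev_ihom_map x x' y y' (f : Hom x' x) (g : Hom y y') :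
  ev K x' y' ∘ (ihom_map f g ⊠ idm x') = g ∘ ev K x y ∘ (idm _ ⊠ f).
Proof. exact: ev_curry. Qed.

Lemma ihom_map_comp x x' x'' y y' y'' (f : Hom x' x) (f' : Hom x'' x')
    (g : Hom y y') (g' : Hom y' y'') :
  ihom_map (f ∘ f') (g' ∘ g) = ihom_map f' g' ∘ ihom_map f g.
Proof.
apply: curry_inj; rewrite bmap_l comp_assoc !ev_ihom_map.
rewrite -!comp_assoc -bmap_rl (bmap_lr _ (ihom_map f g)); congr (_ ∘ _).
by rewrite [RHS]comp_assoc ev_ihom_map bmap_r !comp_assoc.
Qed.

Definition ihomF : Functor (prodC (op C) C) C.
Proof.
refine {| fobj := fun p : prodC (op C) C => ihom K (fst p) (snd p);
          fmap := fun (p q : prodC (op C) C) (f : Hom p q) =>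
            ihom_map (fst f : @Hom C (fst q) (fst p)) (snd f) |}.
- move=> [x y]; apply: curry_inj; rewrite ev_ihom_map /= comp_idl.
  by [].
- by move=> *; apply: ihom_map_comp.
Defined.

End MonoidalLemmas.

Arguments ihom_map {C S} K {x x' y y'} f g.
Arguments ihomF {C S} K.

(** * Model categories *)

(** Chosen finite limits: terminal object, binary products and equalizers. *)
Record FiniteLimits (C : Category) := {
  term : C;
  to_term : forall x, Hom x term;
  to_term_uniq : forall x (f : Hom x term), f = to_term x;
  prd : C -> C -> C;
  prd_fst : forall x y, Hom (prd x y) x;
  prd_snd : forall x y, Hom (prd x y) y;
  prd_pair : forall z x y, Hom z x -> Hom z y -> Hom z (prd x y);
  prd_fstE : forall z x y (f : Hom z x) (g : Hom z y),
    prd_fst x y ∘ prd_pair f g = f;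
  prd_sndE : forall z x y (f : Hom z x) (g : Hom z y),
    prd_snd x y ∘ prd_pair f g = g;
  prd_uniq : forall z x y (h k : Hom z (prd x y)),
    prd_fst x y ∘ h = prd_fst x y ∘ k -> prd_snd x y ∘ h = prd_snd x y ∘ k ->
    h = k;
  eqz : forall x y (f g : Hom x y), C;
  eqz_inc : forall x y (f g : Hom x y), Hom (eqz f g) x;
  eqz_incE : forall x y (f g : Hom x y), f ∘ eqz_inc f g = g ∘ eqz_inc f g;
  eqz_lift : forall x y (f g : Hom x y) z (h : Hom z x),
    f ∘ h = g ∘ h -> Hom z (eqz f g);
  eqz_liftE : forall x y (f g : Hom x y) z (h : Hom z x) (e : f ∘ h = g ∘ h),
    eqz_inc f g ∘ eqz_lift e = h;
  eqz_mono : forall x y (f g : Hom x y) z (h k : Hom z (eqz f g)),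
    eqz_inc f g ∘ h = eqz_inc f g ∘ k -> h = k }.

Arguments term {C} _.
Arguments to_term {C} _ x.
Arguments eqz {C} _ {x y} f g.
Arguments eqz_inc {C} _ {x y} f g.
Arguments eqz_lift {C} _ {x y f g z h} e.

Definition IsRetract (C : Category) (x y x' y' : C) (f : Hom x y)
    (f' : Hom x' y') : Prop :=
  exists (i : Hom x x') (r : Hom x' x) (j : Hom y y') (s : Hom y' y),
    r ∘ i = idm x /\ s ∘ j = idm y /\ f' ∘ i = j ∘ f /\ f ∘ r = s ∘ f'.

Definition Lifts (C : Category) (a b x y : C) (i : Hom a b) (p : Hom x y) : Prop :=
  forall (u : Hom a x) (v : Hom b y), p ∘ u = v ∘ i ->
  exists h : Hom b x, h ∘ i = u /\ p ∘ h = v.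

Definition IsPullback (C : Category) (x y z P : C) (f : Hom x z) (g : Hom y z)
    (p : Hom P x) (q : Hom P y) : Prop :=
  f ∘ p = g ∘ q /\
  forall w (u : Hom w x) (v : Hom w y), f ∘ u = g ∘ v ->
  exists! h : Hom w P, p ∘ h = u /\ q ∘ h = v.

(** Quillen's closed model categories: only finite limits and colimits are
    required, and factorizations need not be functorial. *)
Record ModelStructure (C : Category) := {
  lims : FiniteLimits C;
  colims : FiniteLimits (op C);
  we : MorphismClass C;
  fib : MorphismClass C;
  cof : MorphismClass C;
  we_comp : forall x y z (g : Hom y z) (f : Hom x y),
    we f -> we g -> we (g ∘ f);
  we_cancel_l : forall x y z (g : Hom y z) (f : Hom x y),
    we g -> we (g ∘ f) -> we f;
  we_cancel_r : forall x y z (g : Hom y z) (f : Hom x y),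
    we f -> we (g ∘ f) -> we g;
  we_retract : forall x y x' y' (f : Hom x y) (f' : Hom x' y'),
    IsRetract f f' -> we f' -> we f;
  fib_retract : forall x y x' y' (f : Hom x y) (f' : Hom x' y'),
    IsRetract f f' -> fib f' -> fib f;
  cof_retract : forall x y x' y' (f : Hom x y) (f' : Hom x' y'),
    IsRetract f f' -> cof f' -> cof f;
  lift_cof : forall a b x y (i : Hom a b) (p : Hom x y),
    cof i -> fib p -> we p -> Lifts i p;
  lift_tcof : forall a b x y (i : Hom a b) (p : Hom x y),
    cof i -> we i -> fib p -> Lifts i p;
  factor_tfib : forall x y (f : Hom x y),
    exists z (i : Hom x z) (p : Hom z y), cof i /\ fib p /\ we p /\ p ∘ i = f;
  factor_tcof : forall x y (f : Hom x y),
    exists z (i : Hom x z) (p : Hom z y), cof i /\ we i /\ fib p /\ p ∘ i = f }.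

Arguments we {C} m [x y] _.
Arguments fib {C} m [x y] _.
Arguments cof {C} m [x y] _.

Definition fibrant (C : Category) (Q : ModelStructure C) (x : C) : Prop :=
  fib Q (to_term (lims Q) x).

Definition cofibrant (C : Category) (Q : ModelStructure C) (x : C) : Prop :=
  cof Q (to_term (colims Q) x : @Hom C (term (colims Q)) x).

Definition Ho (C : Category) (Q : ModelStructure C) : Category := Loc (we Q).

Definition gamma (C : Category) (Q : ModelStructure C) : Functor C (Ho Q) :=
  loc (we Q).

Record MonoidalModelCategory := {
  mcat :> Category;
  mmod : ModelStructure mcat;
  mten : SymMonoidal mcat;
  mclo : Closed mten;
  enr_fib : forall (k l x y P : mcat) (g : Hom k l) (h : Hom x y)
      (p : Hom P (ihom mclo k x)) (q : Hom P (ihom mclo l y))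
      (u : Hom (ihom mclo l x) P),
    cof mmod g -> fib mmod h ->
    IsPullback (ihom_map mclo (idm k) h) (ihom_map mclo g (idm y)) p q ->
    p ∘ u = ihom_map mclo g (idm x) -> q ∘ u = ihom_map mclo (idm l) h ->
    fib mmod u /\ (we mmod g \/ we mmod h -> we mmod u);
  unit_we : exists (Ic : mcat) (w : Hom Ic (unit mten)),
    cofibrant mmod Ic /\ we mmod w /\
    forall z : mcat, fibrant mmod z ->
      we mmod (ihom_map mclo w (idm z) ∘ curry mclo (run mten z)) }.

Arguments mmod m : assert.
Arguments mten m : assert.
Arguments mclo m : assert.

(** * Monoids and modules *)

Record Monoid (C : Category) (S : SymMonoidal C) := {
  mon :> C;
  mon_mul : Hom (bob (tens S) mon mon) mon;
  mon_one : Hom (unit S) mon;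
  mon_assoc :
    mon_mul ∘ bmap (tens S) (idm mon) mon_mul ∘ asc S mon mon mon =
    mon_mul ∘ bmap (tens S) mon_mul (idm mon);
  mon_onel : mon_mul ∘ bmap (tens S) mon_one (idm mon) = lun S mon;
  mon_oner : mon_mul ∘ bmap (tens S) (idm mon) mon_one = run S mon }.

Arguments mon_mul {C S} m.
Arguments mon_one {C S} m.

Record Module (C : Category) (S : SymMonoidal C) (A : Monoid S) := {
  mdl :> C;
  act : Hom (bob (tens S) A mdl) mdl;
  act_assoc :
    act ∘ bmap (tens S) (idm A) act ∘ asc S A A mdl =
    act ∘ bmap (tens S) (mon_mul A) (idm mdl);
  act_one : act ∘ bmap (tens S) (mon_one A) (idm mdl) = lun S mdl }.

Arguments act {C S A} m.

Record ModuleMap (C : Category) (S : SymMonoidal C) (A : Monoid S)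
    (M N : Module A) := {
  mmap :> Hom (mdl M) (mdl N);
  mmap_act : mmap ∘ act M = act N ∘ bmap (tens S) (idm (mon A)) mmap }.

Lemma mmap_eq (C : Category) (S : SymMonoidal C) (A : Monoid S)
    (M N : Module A) (f g : ModuleMap M N) :
  mmap f = mmap g -> f = g.
Proof.
case: f g => f hf [g hg] /= e; subst g.
by rewrite (proof_irrelevance _ hf hg).
Qed.

Definition Mod (C : Category) (S : SymMonoidal C) (A : Monoid S) : Category.
Proof.
unshelve refine {| Ob := Module A; Hom := @ModuleMap C S A;
          idm := fun M => {| mmap := idm (mdl M) |};
          comp := fun L M N g f => {| mmap := mmap g ∘ mmap f |} |}.
- by rewrite bmap_id comp_idl comp_idr.
- by rewrite bmap_r -comp_assoc mmap_act !comp_assoc mmap_act.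
- by move=> *; apply: mmap_eq; rewrite /= comp_assoc.
- by move=> *; apply: mmap_eq; rewrite /= comp_idl.
- by move=> *; apply: mmap_eq; rewrite /= comp_idr.
Defined.

Section Modules.
Context {C : Category} {S : SymMonoidal C} (K : Closed S) (A : Monoid S).
Local Notation "x ⊗ y" := (bob (tens S) x y) (at level 38, left associativity).
Local Notation "f ⊠ g" := (bmap (tens S) f g) (at level 38, left associativity).

Definition mod_tens (M : Module A) (X : C) : Module A.
Proof.
refine {| mdl := M ⊗ X; act := (act M ⊠ idm X) ∘ ascV S A M X |}.
- rewrite bmap_r !comp_assoc (post (ascV_nat S _ _ _)) !comp_assoc -bmap_l.
  rewrite -comp_assoc -comp_assoc (comp_assoc (ascV _ _ _ _)) pentagonV comp_assoc.
  rewrite -bmap_l act_assoc bmap_l -(bmap_id (tens S) M X).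
  by rewrite (post (ascV_nat S _ _ _)) comp_assoc.
- rewrite -(bmap_id (tens S) M X) (post (ascV_nat S _ _ _)) comp_assoc -bmap_l.
  rewrite act_one; apply: asc_inj.
  by rewrite -comp_assoc ascK comp_idr lun_asc.
Defined.

Definition mod_tens_map (M M' : Module A) (X X' : C) (f : ModuleMap M M')
  (u : Hom X X') : ModuleMap (mod_tens M X) (mod_tens M' X').
Proof.
refine (@Build_ModuleMap _ _ _ (mod_tens M X) (mod_tens M' X') (f ⊠ u) _).
rewrite /= (post (ascV_nat S _ _ _)) !comp_assoc -!bmap_comp mmap_act.
by rewrite comp_idl comp_idr.
Defined.

(** The functor [(M, X) |-> M ∧ X]. *)
Definition mod_tensF : Functor (prodC (Mod A) C) (Mod A).
Proof.
refine {| fobj := fun p : prodC (Mod A) C => (mod_tens (fst p) (snd p) : Mod A);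
          fmap := fun (p q : prodC (Mod A) C) (f : Hom p q) =>
            mod_tens_map (fst f) (snd f) |}.
- by move=> p; apply: mmap_eq; apply: bmap_id.
- move=> p q r g f; apply: mmap_eq.
  exact: (@bmap_comp _ _ _ (tens S) _ _ _ _ _ _ (mmap (fst g)) (mmap (fst f))
            (snd g) (snd f)).
Defined.

Definition ihom_act (X : C) (M : Module A) : Hom (A ⊗ ihom K X M) (ihom K X M) :=
  curry K (act M ∘ (idm (mon A) ⊠ ev K X M) ∘ asc S A (ihom K X M) X).

Lemma ev_ihom_act (X : C) (M : Module A) :
  ev K X M ∘ (ihom_act X M ⊠ idm X) =
  act M ∘ (idm (mon A) ⊠ ev K X M) ∘ asc S A (ihom K X M) X.
Proof. exact: ev_curry. Qed.

Definition mod_ihom (X : C) (M : Module A) : Module A.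
Proof.
refine {| mdl := ihom K X M; act := ihom_act X M |}.
- apply: curry_inj; rewrite !bmap_l !comp_assoc ev_ihom_act.
  rewrite !(post (asc_nat S _ _ _)) !comp_assoc (post (eq_sym (bmap_r _ _ _ _))).
  rewrite ev_ihom_act !bmap_r !comp_assoc.
  rewrite (post3 (eq_sym (pentagon S A A (ihom K X M) X))) !comp_assoc.
  rewrite (post (eq_sym (asc_nat S _ _ _))) !comp_assoc act_assoc.
  by rewrite !bmap_id (post (eq_sym (bmap_lr _ _ _))) (post (eq_sym (bmap_rl _ _ _))).
- apply: curry_inj; rewrite bmap_l comp_assoc ev_ihom_act.
  rewrite (post (asc_nat S _ _ _)) bmap_id comp_assoc.
  rewrite (post (eq_sym (bmap_rl _ _ _))) bmap_lr comp_assoc act_one.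
  by rewrite lun_nat -comp_assoc lun_asc.
Defined.

Definition mod_ihom_map (X X' : C) (M M' : Module A) (u : Hom X' X)
  (g : ModuleMap M M') : ModuleMap (mod_ihom X M) (mod_ihom X' M').
Proof.
refine (@Build_ModuleMap _ _ _ (mod_ihom X M) (mod_ihom X' M')
          (ihom_map K u g) _) => /=.
apply: curry_inj; rewrite !bmap_l !comp_assoc ev_ihom_act ev_ihom_map.
rewrite (post (asc_nat S _ _ _)) !comp_assoc (post (eq_sym (bmap_r _ _ _ _))).
rewrite ev_ihom_map !bmap_r !comp_assoc -mmap_act.
rewrite (post (eq_sym (bmap_rl _ _ _))) (bmap_lr _ (ihom_act _ _)) comp_assoc.
rewrite (post (ev_ihom_act _ _)) !comp_assoc.
by rewrite (post (eq_sym (asc_nat S _ _ _))) bmap_id !comp_assoc.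
Defined.

(** The functor [(X, M) |-> [X, M]]. *)
Definition mod_ihomF : Functor (prodC (op C) (Mod A)) (Mod A).
Proof.
refine {| fobj := fun p : prodC (op C) (Mod A) =>
            (mod_ihom (fst p) (snd p) : Mod A);
          fmap := fun (p q : prodC (op C) (Mod A)) (f : Hom p q) =>
            mod_ihom_map (fst f : @Hom C (fst q) (fst p)) (snd f) |}.
- by move=> [X M]; apply: mmap_eq; apply: (fmap_id (ihomF K) (X, mdl M)).
- move=> p q r g f; apply: mmap_eq.
  exact: (@ihom_map_comp _ _ K _ _ _ _ _ _ (fst f) (fst g)
            (mmap (snd f)) (mmap (snd g))).
Defined.

(** The map [[L, M] -> [A ∧ L, A ∧ M]] given by the functor [A ∧ -]. *)
Definition ihom_tens (L M : C) : Hom (ihom K L M) (ihom K (A ⊗ L) (A ⊗ M)) :=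
  curry K ((idm (mon A) ⊠ ev K L M) ∘ asc S A (ihom K L M) L ∘
           (swp S (ihom K L M) A ⊠ idm L) ∘ ascV S (ihom K L M) A L).

(** The two maps [[L, M] -> [A ∧ L, M]] whose equalizer is [^A[L, M]]. *)
Definition mod_hom_src (L M : Module A) : Hom (ihom K L M) (ihom K (A ⊗ L) M) :=
  ihom_map K (act L) (idm (mdl M)).

Definition mod_hom_tgt (L M : Module A) : Hom (ihom K L M) (ihom K (A ⊗ L) M) :=
  ihom_map K (idm (A ⊗ L)) (act M) ∘ ihom_tens L M.

Lemma ev_mod_hom_tgt (L M : Module A) :
  ev K (A ⊗ L) M ∘ (mod_hom_tgt L M ⊠ idm (A ⊗ L)) =
  act M ∘ (idm (mon A) ⊠ ev K L M) ∘ asc S A (ihom K L M) L ∘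
    (swp S (ihom K L M) A ⊠ idm L) ∘ ascV S (ihom K L M) A L.
Proof.
rewrite bmap_l comp_assoc ev_ihom_map bmap_id comp_idr -comp_assoc ev_curry.
by rewrite !comp_assoc.
Qed.

Lemma mod_hom_src_nat (L L' M M' : Module A) (f : ModuleMap L' L)
    (g : ModuleMap M M') :
  mod_hom_src L' M' ∘ ihom_map K f g =
  ihom_map K (idm (mon A) ⊠ f) g ∘ mod_hom_src L M.
Proof.
by rewrite /mod_hom_src -!ihom_map_comp comp_idl comp_idr mmap_act.
Qed.

Lemma mod_hom_tgt_nat (L L' M M' : Module A) (f : ModuleMap L' L)
    (g : ModuleMap M M') :
  mod_hom_tgt L' M' ∘ ihom_map K f g =
  ihom_map K (idm (mon A) ⊠ f) g ∘ mod_hom_tgt L M.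
Proof.
apply: curry_inj; rewrite (bmap_l _ _ (mod_hom_tgt L' M')).
rewrite (bmap_l _ _ (ihom_map _ _ _)) !comp_assoc ev_mod_hom_tgt ev_ihom_map.
rewrite (post (eq_sym (bmap_rl _ _ _))) (bmap_lr _ (mod_hom_tgt L M)) comp_assoc.
rewrite (post (ev_mod_hom_tgt _ _)) !comp_assoc.
rewrite -(bmap_id (tens S) A L') (post (ascV_nat S _ _ _)) comp_assoc.
rewrite (post (eq_sym (bmap_l _ _ _ _))) swp_nat bmap_l comp_assoc.
rewrite (post (asc_nat S _ _ _)) comp_assoc (post (eq_sym (bmap_r _ _ _ _))).
rewrite ev_ihom_map !bmap_r !comp_assoc -mmap_act.
rewrite (post (ascV_nat S _ _ _)) (post (eq_sym (asc_nat S _ _ _))) !comp_assoc.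
rewrite !bmap_id (post (eq_sym (bmap_lr _ _ _))).
by rewrite (post (eq_sym (bmap_rl _ _ _))).
Qed.

Context (E : FiniteLimits C).

Definition mod_hom (L M : Module A) : C :=
  eqz E (mod_hom_src L M) (mod_hom_tgt L M).

Lemma mod_hom_map_eq (L L' M M' : Module A) (f : ModuleMap L' L)
    (g : ModuleMap M M') :
  mod_hom_src L' M' ∘ (ihom_map K f g ∘ eqz_inc E _ _) =
  mod_hom_tgt L' M' ∘ (ihom_map K f g ∘ eqz_inc E (mod_hom_src L M) (mod_hom_tgt L M)).
Proof.
rewrite !comp_assoc mod_hom_src_nat mod_hom_tgt_nat.
by rewrite -[LHS]comp_assoc eqz_incE comp_assoc.
Qed.

Definition mod_hom_map (L L' M M' : Module A) (f : ModuleMap L' L)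
  (g : ModuleMap M M') : Hom (mod_hom L M) (mod_hom L' M') :=
  eqz_lift E (mod_hom_map_eq f g).

Lemma mod_hom_map_id (L M : Module A) :
  mod_hom_map (idm (L : Mod A)) (idm (M : Mod A)) = idm (mod_hom L M).
Proof.
apply: (@eqz_mono _ E); rewrite eqz_liftE comp_idr /=.
by rewrite [X in X ∘ _](fmap_id (ihomF K) (mdl L, mdl M)) comp_idl.
Qed.

Lemma mod_hom_map_comp (L L' L'' M M' M'' : Mod A) (f : Hom L' L)
    (f' : Hom L'' L') (g : Hom M M') (g' : Hom M' M'') :
  mod_hom_map (f ∘ f') (g' ∘ g) = mod_hom_map f' g' ∘ mod_hom_map f g.
Proof.
apply: (@eqz_mono _ E).
rewrite comp_assoc !eqz_liftE -comp_assoc eqz_liftE comp_assoc.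
by rewrite -ihom_map_comp.
Qed.

(** The functor [(L, M) |-> ^A[L, M]]. *)
Definition mod_homF : Functor (prodC (op (Mod A)) (Mod A)) C.
Proof.
refine {| fobj := fun p : prodC (op (Mod A)) (Mod A) => mod_hom (fst p) (snd p);
          fmap := fun (p q : prodC (op (Mod A)) (Mod A)) (f : Hom p q) =>
            mod_hom_map (fst f : @Hom (Mod A) (fst q) (fst p)) (snd f) |}.
- by move=> p; exact: (mod_hom_map_id (fst p) (snd p)).
- move=> p q r g f.
  exact: (@mod_hom_map_comp (fst p) (fst q) (fst r) (snd p) (snd q) (snd r)
            (fst f) (fst g) (snd f) (snd g)).
Defined.

End Modules.

(** * The derived closed symmetric monoidal structure *)

(** The closed symmetric monoidal structure on [Ho M] whose product is the left
    derived functor of [∧], with [deps : X ∧^ Y -> X ∧ Y], and whose internal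
    function object is the right derived functor of [[-, -]], with
    [deta : [X, Y] -> [[X, Y]]].  The unit and coherence isomorphisms and the
    evaluation are those induced from [M]: [deps] and [dunit] make
    [gamma] lax symmetric monoidal, compatibly with evaluation. *)
Record DerivedStructure (M : MonoidalModelCategory) := {
  dten : SymMonoidal (Ho (mmod M));
  dclo : Closed dten;
  deps : NatTrans
    (compF (compF (tens dten) (loc_prod (we (mmod M)) (we (mmod M))))
           (loc (prodW (we (mmod M)) (we (mmod M)))))
    (compF (gamma (mmod M)) (tens (mten M)));
  deps_derived : IsLeftDerived
    (compF (tens dten) (loc_prod (we (mmod M)) (we (mmod M)))) deps;
  dunit : Hom (unit dten) (gamma (mmod M) (unit (mten M)));
  dunit_iso : is_iso dunit;
  deta : NatTrans
    (compF (gamma (mmod M)) (ihomF (mclo M)))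
    (compF (compF (ihomF dclo) (loc_op_prod (we (mmod M)) (we (mmod M))))
           (loc (prodW (opW (we (mmod M))) (we (mmod M)))));
  deta_derived : IsRightDerived
    (compF (ihomF dclo) (loc_op_prod (we (mmod M)) (we (mmod M)))) deta;
  deps_asc : forall x y z : M,
    fmap (gamma (mmod M)) (asc (mten M) x y z) ∘ deps (bob (tens (mten M)) x y, z)
      ∘ bmap (tens dten) (deps (x, y)) (idm (gamma (mmod M) z)) =
    deps (x, bob (tens (mten M)) y z)
      ∘ bmap (tens dten) (idm (gamma (mmod M) x)) (deps (y, z))
      ∘ asc dten (gamma (mmod M) x) (gamma (mmod M) y) (gamma (mmod M) z);
  deps_lun : forall x : M,
    fmap (gamma (mmod M)) (lun (mten M) x) ∘ deps (unit (mten M), x)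
      ∘ bmap (tens dten) dunit (idm (gamma (mmod M) x)) =
    lun dten (gamma (mmod M) x);
  deps_run : forall x : M,
    fmap (gamma (mmod M)) (run (mten M) x) ∘ deps (x, unit (mten M))
      ∘ bmap (tens dten) (idm (gamma (mmod M) x)) dunit =
    run dten (gamma (mmod M) x);
  deps_swp : forall x y : M,
    fmap (gamma (mmod M)) (swp (mten M) x y) ∘ deps (x, y) =
    deps (y, x) ∘ swp dten (gamma (mmod M) x) (gamma (mmod M) y);
  deta_ev : forall x y : M,
    ev dclo (gamma (mmod M) x) (gamma (mmod M) y)
      ∘ bmap (tens dten) (deta (x, y)) (idm (gamma (mmod M) x)) =
    fmap (gamma (mmod M)) (ev (mclo M) x y) ∘ deps (ihom (mclo M) x y, x) }.

(** * Enriched categories *)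

(** [H x y] is the mapping object from [x] to [y]. *)
Record EnrichedCategory (V : Category) (S : SymMonoidal V) (O : Type)
    (H : O -> O -> V) := {
  ecomp : forall x y z, Hom (bob (tens S) (H y z) (H x y)) (H x z);
  eid : forall x, Hom (unit S) (H x x);
  ecomp_assoc : forall w x y z,
    ecomp w x z ∘ bmap (tens S) (ecomp x y z) (idm (H w x)) =
    ecomp w y z ∘ bmap (tens S) (idm (H y z)) (ecomp w x y)
      ∘ asc S (H y z) (H x y) (H w x);
  ecomp_idl : forall x y,
    ecomp x y y ∘ bmap (tens S) (eid y) (idm (H x y)) = lun S (H x y);
  ecomp_idr : forall x y,
    ecomp x x y ∘ bmap (tens S) (idm (H x y)) (eid x) = run S (H x y) }.

Arguments ecomp {V S O H} e x y z.
Arguments eid {V S O H} e x.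

(** Composition in the underlying category, in which a morphism from [x] to
    [y] is a map from the unit to [H x y]. *)
Definition ucomp (V : Category) (S : SymMonoidal V) (O : Type) (H : O -> O -> V)
    (E : EnrichedCategory S H) (x y z : O) (g : Hom (unit S) (H y z))
    (f : Hom (unit S) (H x y)) : Hom (unit S) (H x z) :=
  ecomp E x y z ∘ bmap (tens S) g f ∘ lunV S (unit S).

(** An enrichment of [C] with mapping objects given by the functor [H]: an
    enriched category on the objects of [C], an isomorphism [name] of [C] with
    its underlying category, and the requirement that the action of [H] on
    morphisms be composition in the enriched category. *)
Record Enrichment (V : Category) (S : SymMonoidal V) (C : Category)
    (H : Functor (prodC (op C) C) V) := {
  ecat :> EnrichedCategory S (fun x y : C => bob H (x : op C) y);
  name : forall x y : C, Hom x y -> Hom (unit S) (bob H (x : op C) y);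
  name_bij : forall (x y : C) (e : Hom (unit S) (bob H (x : op C) y)),
    exists! f : Hom x y, name f = e;
  name_id : forall x, name (idm x) = eid ecat x;
  name_comp : forall (x y z : C) (g : Hom y z) (f : Hom x y),
    name (g ∘ f) = ucomp ecat (name g) (name f);
  hom_post : forall (x y z : C) (g : Hom y z),
    bmap H (idm (x : op C)) g =
    ecomp ecat x y z ∘ bmap (tens S) (name g) (idm _) ∘ lunV S _;
  hom_pre : forall (x y z : C) (f : Hom x y),
    bmap H (f : @Hom (op C) y x) (idm z) =
    ecomp ecat x y z ∘ bmap (tens S) (idm _) (name f) ∘ runV S _ }.

Section TensorsCotensors.
Context {V : Category} {S : SymMonoidal V} (K : Closed S) {C : Category}
  {H : Functor (prodC (op C) C) V} (E : Enrichment S H).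
Local Notation "x ⊗ y" := (bob (tens S) x y) (at level 38, left associativity).
Local Notation "f ⊠ g" := (bmap (tens S) f g) (at level 38, left associativity).
Local Notation "'H[' x , y ]" := (bob H (x : op C) y).

(** The effect of the enriched functors [[X, H[c, -]]] and [[X, H[-, c]]] on
    mapping objects, in the adjoint form of an action on their values. *)
Definition ihom_post (X : V) (c d d' : C) :
  Hom (H[d, d'] ⊗ ihom K X H[c, d]) (ihom K X H[c, d']) :=
  curry K (ecomp E c d d' ∘ (idm H[d, d'] ⊠ ev K X H[c, d]) ∘
           asc S H[d, d'] (ihom K X H[c, d]) X).

Definition ihom_pre (X : V) (c d d' : C) :
  Hom (ihom K X H[d, c] ⊗ H[d', d]) (ihom K X H[d', c]) :=
  curry K (ecomp E d' d c ∘ (ev K X H[d, c] ⊠ idm H[d', d]) ∘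
           ascV S (ihom K X H[d, c]) X H[d', d] ∘
           (idm (ihom K X H[d, c]) ⊠ swp S H[d', d] X) ∘
           asc S (ihom K X H[d, c]) H[d', d] X).

(** [T (c, X)] is a tensor of [c] with [X]: there are isomorphisms
    [H[T (c, X), d] ≅ [X, H[c, d]]], enriched natural in [d], and natural in
    [c] and [X]. *)
Definition ProvidesTensors (T : Functor (prodC C V) C) : Prop :=
  exists th : forall (c : C) (X : V) (d : C),
      Hom H[bob T c X, d] (ihom K X H[c, d]),
    (forall c X d, is_iso (th c X d)) /\
    (forall c X d d',
       th c X d' ∘ ecomp E (bob T c X) d d' =
       ihom_post X c d d' ∘ (idm H[d, d'] ⊠ th c X d)) /\
    (forall (c c' d : C) (X X' : V) (f : Hom c' c) (u : Hom X' X),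
       th c' X' d ∘
         bmap H (bmap T f u : @Hom (op C) (bob T c X) (bob T c' X')) (idm d) =
       ihom_map K u (bmap H (f : @Hom (op C) c c') (idm d)) ∘ th c X d).

(** [T (X, c)] is a cotensor of [c] with [X]: there are isomorphisms
    [H[d, T (X, c)] ≅ [X, H[d, c]]], enriched natural in [d], and natural in
    [X] and [c]. *)
Definition ProvidesCotensors (T : Functor (prodC (op V) C) C) : Prop :=
  exists th : forall (X : V) (c d : C),
      Hom H[d, bob T (X : op V) c] (ihom K X H[d, c]),
    (forall X c d, is_iso (th X c d)) /\
    (forall X c d d',
       th X c d' ∘ ecomp E d' d (bob T (X : op V) c) =
       ihom_pre X c d d' ∘ (th X c d ⊠ idm H[d', d])) /\
    (forall (X X' : V) (c c' d : C) (u : Hom X' X) (f : Hom c c'),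
       th X' c' d ∘
         bmap H (idm (d : op C)) (bmap T (u : @Hom (op V) X X') f) =
       ihom_map K u (bmap H (idm (d : op C)) f) ∘ th X c d).

End TensorsCotensors.

(* Main.v *)
From Corelib Require Import ssreflect.
From Stdlib Require Import IndefiniteDescription.
Require Import Defs.
Set Implicit Arguments.
Unset Strict Implicit.
Unset Printing Implicit Defensive.

(** The derived functors exist because each of the three functors preserves weak
    equivalences between objects that are cofibrant in every variable of the
    tensor and in the contravariant variables of the other two, and fibrant in
    their covariant variables.  By the adjunctions between tensors, cotensors
    and mapping objects, lifting problems for one of these functors are lifting
    problems for another, and all of them are solved by the enrichment axiom
    ([corner_lift], [tens_cof], [hom_fib], [hom_cof]); Ken Brown's lemma does the
    rest.  A functor with this property is derived by evaluating it on chosen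
    replacements ([left_derived_bi_exists], [right_derived_bi_exists]).

    The enrichment of the homotopy category does not require a coherent
    derived action of [Ho M].  The functor [gamma : M -> Ho M] is lax symmetric
    monoidal through [deps] and [dunit], so it takes the category of bifibrant
    modules, enriched over [M], to a category enriched over [Ho M].  Every module
    is isomorphic in the homotopy category to a bifibrant one, and between
    bifibrant modules the derived mapping object is the image of the original
    one, so this structure transports to all modules ([rho],
    [homotopy_enriched_exists]).  As [gamma] is full on bifibrant objects
    ([gamma_full]), naturality of composition in the homotopy category follows
    from naturality for maps of modules.

    It remains to see that maps [x -> y] in the homotopy category are the maps
    from the unit to the derived mapping object ([hname_bij]).  By the derived
    adjunction ([derived_adjunction]) the latter are maps [x ⊗ I -> y], where the
    tensor is derived.  The derived tensor of [x] with the unit is [x ⊗ Ic] for a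
    cofibrant replacement [Ic] of the unit and cofibrant [x], and it is isomorphic
    to [x] because, under another derived adjunction, mapping it to a fibrant [n]
    amounts to mapping [x] to [[Ic, n]], which the unit axiom identifies with [n].

    The transformation [R (c ⊗ X, -) -> [X, R (c, -)]] is composition with the
    unit [X -> R (c, c ⊗ X)]; its enriched naturality is associativity of
    composition ([ihom_post_ecomp]).  For bifibrant arguments it is, up to
    isomorphism, the image under [gamma] of the isomorphism
    [[c ⊗ X, d] ≅ [X, [c, d]]] of [M] followed by [deta], and [deta] is
    invertible at a cofibrant source and a fibrant target ([dhom_curry],
    [dhom_iso]).  Cotensors are treated in the same way.

    The part of the argument that takes place in the homotopy category applies
    to any model category that is suitably enriched, tensored and cotensored over
    [M] ([homotopy_tensored]); modules are an instance ([modules_tensored]). *)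

(** * Isomorphisms and localizations *)
Lemma iso_id (C : Category) (x : C) : is_iso (idm x).
Proof. by exists (idm x); rewrite comp_idl. Qed.

Lemma iso_comp (C : Category) (x y z : C) (g : Hom y z) (f : Hom x y) :
  is_iso g -> is_iso f -> is_iso (g ∘ f).
Proof.
move=> [g' [g1 g2]] [f' [f1 f2]]; exists (f' ∘ g'); split.
- by rewrite comp_assoc -(comp_assoc f') g1 comp_idr.
- by rewrite comp_assoc -(comp_assoc g) f2 comp_idr.
Qed.

Lemma iso_fmap (C D : Category) (F : Functor C D) (x y : C) (f : Hom x y) :
  is_iso f -> is_iso (fmap F f).
Proof.
by move=> [g [h1 h2]]; exists (fmap F g); rewrite -!fmap_comp h1 h2 !fmap_id.
Qed.

Lemma iso_bmap (C D E : Category) (T : Functor (prodC C D) E) (x x' : C)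
    (y y' : D) (f : Hom x x') (g : Hom y y') :
  is_iso f -> is_iso g -> is_iso (bmap T f g).
Proof.
move=> [f' [f1 f2]] [g' [g1 g2]]; exists (bmap T f' g').
by rewrite -!bmap_comp f1 f2 g1 g2 !bmap_id.
Qed.

Lemma iso_epi (C : Category) (x y z : C) (f : Hom x y) (g h : Hom y z) :
  is_iso f -> g ∘ f = h ∘ f -> g = h.
Proof.
by move=> [f' [_ e]] k; rewrite -(comp_idr g) -(comp_idr h) -e !comp_assoc k.
Qed.

Lemma iso_mono (C : Category) (x y z : C) (f : Hom y z) (g h : Hom x y) :
  is_iso f -> f ∘ g = f ∘ h -> g = h.
Proof.
by move=> [f' [e _]] k; rewrite -(comp_idl g) -(comp_idl h) -e -!comp_assoc k.
Qed.

Lemma iso_cancel_r (C : Category) (x y z : C) (g : Hom y z) (f : Hom x y) :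
  is_iso f -> is_iso (g ∘ f) -> is_iso g.
Proof.
move=> hf [k [k1 k2]]; exists (f ∘ k); split; last by rewrite comp_assoc.
apply: (iso_epi hf); by rewrite -!comp_assoc k1 comp_idl comp_idr.
Qed.

Lemma iso_cancel_l (C : Category) (x y z : C) (g : Hom y z) (f : Hom x y) :
  is_iso g -> is_iso (g ∘ f) -> is_iso f.
Proof.
move=> hg [k [k1 k2]]; exists (k ∘ g); split; first by rewrite -comp_assoc.
apply: (iso_mono hg); by rewrite !comp_assoc k2 comp_idl comp_idr.
Qed.

Lemma iso_of_section (C : Category) (x y : C) (f : Hom x y) (s : Hom y x) :
  is_iso s -> f ∘ s = idm y -> is_iso f.
Proof. by move=> hs e; apply: (iso_cancel_r hs); rewrite e; apply: iso_id. Qed.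

Lemma iso_op (C : Category) (x y : C) (f : Hom x y) :
  is_iso f <-> @is_iso (op C) y x f.
Proof. by split; move=> [g [h1 h2]]; exists g; split. Qed.

Definition inv (C : Category) (x y : C) (f : Hom x y) (h : is_iso f) : Hom y x :=
  proj1_sig (constructive_indefinite_description _ h).

Lemma inv_l (C : Category) (x y : C) (f : Hom x y) (h : is_iso f) :
  inv h ∘ f = idm x.
Proof. by rewrite /inv; case: constructive_indefinite_description => g []. Qed.

Lemma inv_r (C : Category) (x y : C) (f : Hom x y) (h : is_iso f) :
  f ∘ inv h = idm y.
Proof. by rewrite /inv; case: constructive_indefinite_description => g []. Qed.

Lemma iso_inv (C : Category) (x y : C) (f : Hom x y) (h : is_iso f) :
  is_iso (inv h).
Proof. by exists f; rewrite inv_l inv_r. Qed.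

Lemma inv_square (C : Category) (x y x' y' : C) (a : Hom x y) (b : Hom x' y')
    (u : Hom x x') (v : Hom y y') (ha : is_iso a) (hb : is_iso b) :
  v ∘ a = b ∘ u -> u ∘ inv ha = inv hb ∘ v.
Proof.
move=> e; apply: (iso_epi ha); apply: (iso_mono hb).
rewrite -!comp_assoc inv_l comp_idr e [RHS]comp_assoc inv_r.
by rewrite comp_idl.
Qed.

Section LocGenerators.
Context {C : Category} {W : MorphismClass C}.

(** Maps of the localization are classes of zigzags, so this is induction on
    the length of a zigzag. *)
Lemma loc_ind (P : forall x y : Loc W, Hom x y -> Prop) :
  (forall (x y : C) (f : Hom x y), P _ _ (fmap (loc W) f)) ->
  (forall (x y z : Loc W) (g : Hom y z) (f : Hom x y),
     P _ _ g -> P _ _ f -> P _ _ (g ∘ f)) ->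
  (forall (x y : C) (w : Hom x y) (v : @Hom (Loc W) y x), W w ->
     v ∘ fmap (loc W) w = idm (x : Loc W) ->
     fmap (loc W) w ∘ v = idm (y : Loc W) -> P _ _ v) ->
  forall (x y : Loc W) (p : Hom x y), P _ _ p.
Proof.
move=> h1 h2 h3 x y p; rewrite -(wclass_rep p); elim: (wrep p) => {x y p}.
- exact: h1.
- move=> x y w hw; apply: (h3 _ _ w) => //.
  + exact: eq_trans (eq_sym (wclass_comp _ _)) (wclass_eq (weq_invl hw)).
  + exact: eq_trans (eq_sym (wclass_comp _ _)) (wclass_eq (weq_invr hw)).
- by move=> x y z a ha b hb; rewrite wclass_comp; apply: h2.
Qed.

(** A naturality square for [w] inverts to one for the inverse of [w]; hence
    naturality need only be checked on maps of [C]. *)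
Lemma loc_nat (H : Category) (F G : Functor (Loc W) H)
    (t : forall x : C, Hom (F x) (G x)) :
  (forall (x y : C) (f : Hom x y),
     t y ∘ fmap F (fmap (loc W) f) = fmap G (fmap (loc W) f) ∘ t x) ->
  forall (x y : Loc W) (p : Hom x y), t y ∘ fmap F p = fmap G p ∘ t x.
Proof.
move=> h; apply: loc_ind => [//|x y z g f hg hf|x y w v hw e1 e2].
- by rewrite !fmap_comp comp_assoc hg -comp_assoc hf comp_assoc.
- have hF : is_iso (fmap F (fmap (loc W) w)) by apply/iso_fmap/loc_inverts.
  have hG : is_iso (fmap G (fmap (loc W) w)) by apply/iso_fmap/loc_inverts.
  apply: (iso_epi hF); apply: (iso_mono hG).
  rewrite -!comp_assoc -fmap_comp e1 fmap_id comp_idr !comp_assoc.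
  by rewrite -fmap_comp e2 fmap_id comp_idl -h.
Qed.

Lemma loc_liftE (D : Category) (F : Functor C D)
    (hF : forall x y (w : Hom x y), W w -> is_iso (fmap F w)) (x y : C)
    (f : Hom x y) :
  fmap (loc_lift hF) (fmap (loc W) f) = fmap F f.
Proof. exact: (weval_eq hF (wrep_class (wmor W f))). Qed.
End LocGenerators.

(** [op (Loc W)] and [Loc (opW W)] have the same objects but differ as
    categories; the functor [loc_op] turns a functor on the second, as obtained
    by applying a construction to the opposite category, into a functor on the
    first. *)
Section OppositeLocalization.
Context {C : Category} (W : MorphismClass C).

Definition loc_flip : Functor C (op (Loc (opW W))).
Proof.
refine {| fobj := fun x : C => (x : op (Loc (opW W)));
          fmap := fun x y f => fmap (loc (opW W)) (f : @Hom (op C) y x) |}.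
- by move=> x; apply: (fmap_id (loc (opW W))).
- by move=> x y z g f; apply: (fmap_comp (loc (opW W))).
Defined.

Lemma loc_flip_inverts x y (w : Hom x y) : W w -> is_iso (fmap loc_flip w).
Proof.
move=> h; apply/iso_op; exact: (@loc_inverts (op C) (opW W) y x w h).
Qed.

Definition loc_op : Functor (op (Loc W)) (Loc (opW W)).
Proof.
refine {| fobj := fun x : op (Loc W) => (x : Loc (opW W));
          fmap := fun x y p => fmap (loc_lift loc_flip_inverts) p |}.
- move=> x; exact: (fmap_id (loc_lift loc_flip_inverts)).
- by move=> x y z g f; apply: (fmap_comp (loc_lift loc_flip_inverts)).
Defined.

Lemma loc_opE (x y : C) (f : Hom x y) :
  fmap loc_op (fmap (loc W) f : @Hom (op (Loc W)) y x) =
  fmap (loc (opW W)) (f : @Hom (op C) y x).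
Proof. exact: (loc_liftE loc_flip_inverts). Qed.
End OppositeLocalization.

(** Each variable is localized while the other is held fixed; the two lifts
    commute because a lift in one variable is natural in the other, first for
    maps of the original category and then for zigzags. *)
Section TwoVariableLift.
Context {C D H : Category} (W : MorphismClass C) (W' : MorphismClass D).
Context (F : Functor (prodC C D) H).
Context (Fl : forall (x x' : C) (y : D) (w : Hom x x'),
           W w -> is_iso (bmap F w (idm y))).
Context (Fr : forall (x : C) (y y' : D) (w : Hom y y'),
           W' w -> is_iso (bmap F (idm x) w)).

Definition slice_l (y : D) : Functor C H.
Proof.
refine {| fobj := fun x => bob F x y; fmap := fun x x' f => bmap F f (idm y) |}.
- by move=> x; apply: bmap_id.
- by move=> *; apply: bmap_l.
Defined.

Definition slice_r (x : C) : Functor D H.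
Proof.
refine {| fobj := fun y => bob F x y; fmap := fun y y' g => bmap F (idm x) g |}.
- by move=> y; apply: bmap_id.
- by move=> *; apply: bmap_r.
Defined.

Definition lift_l (y : D) : Functor (Loc W) H :=
  @loc_lift _ W _ (slice_l y) (fun x x' w => @Fl x x' y w).

Definition lift_r (x : C) : Functor (Loc W') H :=
  @loc_lift _ W' _ (slice_r x) (@Fr x).

Lemma lift_l_loc (y : D) (x x' : C) (f : Hom x x') :
  fmap (lift_l y) (fmap (loc W) f) = bmap F f (idm y).
Proof. exact: loc_liftE. Qed.

Lemma lift_r_loc (x : C) (y y' : D) (g : Hom y y') :
  fmap (lift_r x) (fmap (loc W') g) = bmap F (idm x) g.
Proof. exact: loc_liftE. Qed.

Lemma lift_interchange (x x' : Loc W) (p : Hom x x') (y y' : Loc W') (q : Hom y y') :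
  fmap (lift_l y') p ∘ fmap (lift_r x) q = fmap (lift_r x') q ∘ fmap (lift_l y) p.
Proof.
symmetry; move: x x' p.
apply: (@loc_nat _ _ _ (lift_l y) (lift_l y') (fun x => fmap (lift_r x) q)).
move=> x x' f; symmetry; move: y y' q.
rewrite /= -/(Loc W').
apply: (@loc_nat _ _ _ (lift_r x) (lift_r x')
          (fun y => fmap (lift_l y) (fmap (loc W) f))) => y y' g.
by rewrite !lift_l_loc !lift_r_loc -!bmap_comp !comp_idl !comp_idr.
Qed.

Definition bi_lift : Functor (prodC (Loc W) (Loc W')) H.
Proof.
refine {| fobj := fun p : prodC (Loc W) (Loc W') => (bob F (fst p) (snd p) : H);
          fmap := fun (p q : prodC (Loc W) (Loc W')) f =>
            fmap (lift_l (snd q)) (fst f) ∘ fmap (lift_r (fst p)) (snd f) |}.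
- move=> p; apply: eq_trans (comp_idl _).
  exact: (f_equal2 comp (fmap_id (lift_l (snd p)) _) (fmap_id (lift_r (fst p)) _)).
- move=> p q r g f.
  apply: eq_trans (f_equal2 comp (fmap_comp (lift_l (snd r)) (fst g) (fst f))
                    (fmap_comp (lift_r (fst p)) (snd g) (snd f))) _.
  rewrite !comp_assoc; congr (_ ∘ _); rewrite -!comp_assoc; congr (_ ∘ _).
  exact: lift_interchange.
Defined.

Lemma bi_liftE (x x' : C) (y y' : D) (f : Hom x x') (g : Hom y y') :
  bmap bi_lift (fmap (loc W) f) (fmap (loc W') g) = bmap F f g.
Proof.
rewrite [RHS]bmap_lr -lift_l_loc -lift_r_loc.
by [].
Qed.
End TwoVariableLift.

Lemma loc_prodE (C D : Category) (W : MorphismClass C) (W' : MorphismClass D)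
    (p q : prodC C D) (f : Hom p q) :
  fmap (loc_prod W W') (fmap (loc (prodW W W')) f) =
  (fmap (loc W) (fst f), fmap (loc W') (snd f)) :> @Hom (prodC (Loc W) (Loc W')) p q.
Proof.
exact (@loc_liftE _ (prodW W W') _ (prodF (loc W) (loc W')) _ p q f).
Qed.

Lemma loc_op_prodE (C D : Category) (W : MorphismClass C) (W' : MorphismClass D)
    (p q : prodC (op C) D) (f : Hom p q) :
  fmap (loc_op_prod W W') (fmap (loc (prodW (opW W) W')) f) =
  ((fmap (loc W) (fst f : @Hom C (fst q) (fst p)) : @Hom (op (Loc W)) (fst p) (fst q)),
   fmap (loc W') (snd f))
  :> @Hom (prodC (op (Loc W)) (Loc W')) (fst p, snd p) (fst q, snd q).
Proof.
exact (@loc_liftE _ (prodW (opW W) W') _ (prodF (opF (loc W)) (loc W')) _ p q f).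
Qed.

(** * Existence and uniqueness of derived functors *)
Section LeftCriterion.
Context {C H : Category} {W : MorphismClass C} {Phi : Functor C H}.
Context {J : C -> C} {j : forall x, Hom (J x) x}.
Context (jW : forall x, W (j x)).
Context (jlift : forall (x y : C) (f : Hom x y),
           exists f' : Hom (J x) (J y), j y ∘ f' = f ∘ j x).

(** The map [e (J x)] being invertible, a transformation [F gamma -> Phi] can
    only lift to [L] through the replacement [j x : J x -> x], whose image is
    invertible in the localization: this forces the formula for [t] and shows
    that it works. *)
Lemma left_derived_of_iso (L : Functor (Loc W) H)
    (e : NatTrans (compF L (loc W)) Phi) :
  (forall x, is_iso (e (J x))) -> IsLeftDerived L e.
Proof.
move=> he F b.
have hF x : is_iso (fmap F (fmap (loc W) (j x))) by apply/iso_fmap/loc_inverts.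
have eL x y (f : Hom x y) : e y ∘ fmap L (fmap (loc W) f) = fmap Phi f ∘ e x.
  exact: (nt_nat e).
have bF x y (f : Hom x y) : b y ∘ fmap F (fmap (loc W) f) = fmap Phi f ∘ b x.
  exact: (nt_nat b).
pose t x := fmap L (fmap (loc W) (j x)) ∘ inv (he x) ∘ b (J x) ∘ inv (hF x).
have tj x : t x ∘ fmap F (fmap (loc W) (j x)) =
            fmap L (fmap (loc W) (j x)) ∘ inv (he x) ∘ b (J x).
  by rewrite /t -comp_assoc inv_l comp_idr.
have tn (x y : C) (f : Hom x y) :
  t y ∘ fmap F (fmap (loc W) f) = fmap L (fmap (loc W) f) ∘ t x.
  have [f' hf'] := jlift f.
  apply: (iso_epi (hF x)); rewrite -[RHS]comp_assoc tj -comp_assoc -!fmap_comp -hf'.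
  rewrite !fmap_comp comp_assoc tj -!comp_assoc bF !comp_assoc -!fmap_comp -hf'.
  rewrite !fmap_comp -!comp_assoc; congr (_ ∘ _).
  rewrite !comp_assoc; congr (_ ∘ _).
  by rewrite (@inv_square _ _ _ _ _ _ _ _ _ (he x) (he y) (eq_sym (eL _ _ f'))).
exists (@Build_NatTrans _ _ F L t (@loc_nat _ _ _ F L t tn)); split=> [x|t' ht' x] /=.
- by rewrite /t !comp_assoc eL -(comp_assoc (fmap Phi _)) inv_r comp_idr -bF
     -comp_assoc inv_r comp_idr.
- apply: (iso_epi (hF x)); rewrite tj.
  rewrite [LHS](nt_nat t') -[RHS]comp_assoc; congr (_ ∘ _).
  by apply: (iso_mono (he x)); rewrite ht' comp_assoc inv_r comp_idl.
Qed.
End LeftCriterion.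

Section RightCriterion.
Context {C H : Category} {W : MorphismClass C} {Phi : Functor C H}.
Context {J : C -> C} {j : forall x, Hom x (J x)}.
Context (jW : forall x, W (j x)).
Context (jlift : forall (x y : C) (f : Hom x y),
           exists f' : Hom (J x) (J y), f' ∘ j x = j y ∘ f).

Lemma right_derived_of_iso (R : Functor (Loc W) H)
    (e : NatTrans Phi (compF R (loc W))) :
  (forall x, is_iso (e (J x))) -> IsRightDerived R e.
Proof.
move=> he F b.
have hF x : is_iso (fmap F (fmap (loc W) (j x))) by apply/iso_fmap/loc_inverts.
have eL x y (f : Hom x y) : e y ∘ fmap Phi f = fmap R (fmap (loc W) f) ∘ e x.
  exact: (nt_nat e).
have bF x y (f : Hom x y) : b y ∘ fmap Phi f = fmap F (fmap (loc W) f) ∘ b x.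
  exact: (nt_nat b).
pose t x := inv (hF x) ∘ (b (J x) ∘ (inv (he x) ∘ fmap R (fmap (loc W) (j x)))).
have tj x : fmap F (fmap (loc W) (j x)) ∘ t x =
            b (J x) ∘ (inv (he x) ∘ fmap R (fmap (loc W) (j x))).
  by rewrite /t comp_assoc inv_r comp_idl.
have tn (x y : C) (f : Hom x y) :
  t y ∘ fmap R (fmap (loc W) f) = fmap F (fmap (loc W) f) ∘ t x.
  have [f' hf'] := jlift f.
  apply: (iso_mono (hF y)); rewrite comp_assoc tj [RHS]comp_assoc -!fmap_comp -hf'.
  rewrite !fmap_comp -[RHS]comp_assoc tj [RHS]comp_assoc -bF.
  rewrite -!comp_assoc -!fmap_comp -hf' !fmap_comp; congr (_ ∘ _).
  rewrite !comp_assoc; congr (_ ∘ _).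
  by rewrite (@inv_square _ _ _ _ _ _ _ _ _ (he x) (he y) (eq_sym (eL _ _ f'))).
exists (@Build_NatTrans _ _ R F t (@loc_nat _ _ _ R F t tn)); split=> [x|t' ht' x] /=.
- rewrite /t -!comp_assoc -eL [inv (he x) ∘ _]comp_assoc inv_l comp_idl bF.
  by rewrite comp_assoc inv_l comp_idl.
- apply: (iso_mono (hF x)); rewrite tj.
  rewrite -[LHS](nt_nat t') [RHS]comp_assoc; congr (_ ∘ _).
  by apply: (iso_epi (he x)); rewrite ht' -comp_assoc inv_l comp_idr.
Qed.
End RightCriterion.

(** Two derived functors of [Phi] differ by a unique isomorphism, so a property
    of one that has been constructed explicitly passes to any other. *)
Lemma right_derived_iso (C H : Category) (W : MorphismClass C)
    (Phi : Functor C H) (R R' : Functor (Loc W) H)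
    (e : NatTrans Phi (compF R (loc W))) (e' : NatTrans Phi (compF R' (loc W))) :
  IsRightDerived R e -> IsRightDerived R' e' ->
  forall x : C, is_iso (e x) -> is_iso (e' x).
Proof.
move=> h h' x hx.
have [t [te _]] := h _ e'; have [t' [te' _]] := h' _ e.
have idn (F : Functor (Loc W) H) : forall (x y : Loc W) (f : Hom x y),
  idm (F y) ∘ fmap F f = fmap F f ∘ idm (F x).
  by move=> *; rewrite comp_idl comp_idr.
have [s [_ s2]] := h _ e; have [s' [_ s2']] := h' _ e'.
have cn (F G K : Functor (Loc W) H) (a : NatTrans G K) (b : NatTrans F G) :
  forall (x y : Loc W) (f : Hom x y),
    (a y ∘ b y) ∘ fmap F f = fmap K f ∘ (a x ∘ b x).
  by move=> x0 y0 f; rewrite -comp_assoc nt_nat comp_assoc nt_nat comp_assoc.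
have k : t' x ∘ t x = idm (R x).
{ transitivity (s x).
  - apply: (s2 (Build_NatTrans (nt := fun z => t' z ∘ t z) (@cn _ _ _ t' t))) => z.
    by rewrite /= -comp_assoc te te'.
  - symmetry; apply: (s2 (Build_NatTrans (nt := fun z => idm (R z)) (@idn R))) => z.
    exact: comp_idl. }
have k' : t x ∘ t' x = idm (R' x).
{ transitivity (s' x).
  - apply: (s2' (Build_NatTrans (nt := fun z => t z ∘ t' z) (@cn _ _ _ t t'))) => z.
    by rewrite /= -comp_assoc te' te.
  - symmetry; apply: (s2' (Build_NatTrans (nt := fun z => idm (R' z)) (@idn R'))) => z.
    exact: comp_idl. }
by rewrite -te; apply: iso_comp hx; exists (t' x).
Qed.

(** The part of the theory of cofibrant replacement that the construction of
    left derived functors uses.  It is stable under products and, unlike a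
    model structure, can be used for the opposite of a category with its
    fibrant replacement. Lifts of maps to replacements are unique only up to
    the homotopies of [rep_htpy], so [rep] need not be a functor. *)
Record LeftReplacement (C : Category) (W : MorphismClass C) := {
  good : C -> Prop;
  rep : C -> C;
  rep_map : forall x, Hom (rep x) x;
  rep_good : forall x, good (rep x);
  rep_we : forall x, W _ _ (rep_map x);
  rep_id : forall x, W _ _ (idm x);
  rep_comp : forall x y z (g : Hom y z) (f : Hom x y),
    W _ _ f -> W _ _ g -> W _ _ (g ∘ f);
  rep_cancel : forall x y z (g : Hom y z) (f : Hom x y),
    W _ _ g -> W _ _ (g ∘ f) -> W _ _ f;
  rep_lift : forall x y (f : Hom x y),
    exists f' : Hom (rep x) (rep y), rep_map y ∘ f' = f ∘ rep_map x;
  rep_htpy : forall a y (u v : Hom a (rep y)),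
    good a -> rep_map y ∘ u = rep_map y ∘ v ->
    exists (c : C) (i0 i1 : Hom a c) (s : Hom c a) (h : Hom c (rep y)),
      good c /\ W _ _ s /\ s ∘ i0 = idm a /\ s ∘ i1 = idm a /\
      h ∘ i0 = u /\ h ∘ i1 = v }.

Section TwoVariableLeft.
Context {C D H : Category} {W : MorphismClass C} {W' : MorphismClass D}.
Context (V : LeftReplacement W) (V' : LeftReplacement W').

Definition preserves_good_we (Phi : Functor (prodC C D) H) : Prop :=
  forall (x x' : C) (y y' : D) (f : Hom x x') (g : Hom y y'),
    good V x -> good V x' -> good V' y -> good V' y' -> W f -> W' g ->
    is_iso (bmap Phi f g).

Lemma left_derived_bi (Phi : Functor (prodC C D) H)
    (L : Functor (prodC (Loc W) (Loc W')) H)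
    (e : NatTrans (compF (compF L (loc_prod W W')) (loc (prodW W W'))) Phi) :
  (forall x y, good V x -> good V' y -> is_iso (e (x, y))) ->
  IsLeftDerived (compF L (loc_prod W W')) e.
Proof.
move=> he.
apply: (@left_derived_of_iso _ _ _ _
  (fun p : prodC C D => (rep V (fst p), rep V' (snd p)) : prodC C D)
  (fun p => (rep_map V (fst p), rep_map V' (snd p)))).
- by move=> p; split; apply: rep_we.
- move=> p q [f g]; have [f' hf] := rep_lift V f; have [g' hg] := rep_lift V' g.
  by exists (f', g'); rewrite /= hf hg.
- by move=> p; apply: he; apply: rep_good.
Qed.

Context (Phi : Functor (prodC C D) H) (hPhi : preserves_good_we Phi).

(** Both ends [i0], [i1] of a cylinder are sections of the same weak
    equivalence [s], so they have the same image as soon as [s] is inverted. *)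
Lemma good_htpy (a : C) (b : D) (x : C) (y : D) (u u' : Hom a (rep V x))
    (v v' : Hom b (rep V' y)) :
  good V a -> good V' b ->
  rep_map V x ∘ u = rep_map V x ∘ u' -> rep_map V' y ∘ v = rep_map V' y ∘ v' ->
  bmap Phi u v = bmap Phi u' v'.
Proof.
move=> ha hb hu hv.
have [c [i0 [i1 [s [h [hc [hs [s0 [s1 [<- <-]]]]]]]]]] := rep_htpy ha hu.
have [d [j0 [j1 [r [k [hd [hr [r0 [r1 [<- <-]]]]]]]]]] := rep_htpy hb hv.
rewrite !bmap_comp; congr (_ ∘ _).
apply: (iso_mono (hPhi hc ha hd hb hs hr)).
by rewrite -!bmap_comp s0 s1 r0 r1.
Qed.

Let lft (x x' : C) (f : Hom x x') : Hom (rep V x) (rep V x') :=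
  proj1_sig (constructive_indefinite_description _ (rep_lift V f)).
Let lft' (x x' : D) (f : Hom x x') : Hom (rep V' x) (rep V' x') :=
  proj1_sig (constructive_indefinite_description _ (rep_lift V' f)).

Let lftE x x' (f : Hom x x') : rep_map V x' ∘ lft f = f ∘ rep_map V x.
Proof. by rewrite /lft; case: constructive_indefinite_description. Qed.
Let lftE' x x' (f : Hom x x') : rep_map V' x' ∘ lft' f = f ∘ rep_map V' x.
Proof. by rewrite /lft'; case: constructive_indefinite_description. Qed.

Definition deform : Functor (prodC C D) H.
Proof.
refine {| fobj := fun p : prodC C D => bob Phi (rep V (fst p)) (rep V' (snd p));
          fmap := fun (p q : prodC C D) f =>
            bmap Phi (lft (fst f)) (lft' (snd f)) |}.
- move=> p; rewrite -bmap_id; apply: good_htpy; try exact: rep_good.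
  + by rewrite lftE comp_idr /= comp_idl.
  + by rewrite lftE' comp_idr /= comp_idl.
- move=> p q r g f; rewrite -bmap_comp; apply: good_htpy; try exact: rep_good.
  + by rewrite lftE comp_assoc lftE -!comp_assoc lftE.
  + by rewrite lftE' comp_assoc lftE' -!comp_assoc lftE'.
Defined.

Let lft_we x x' (w : Hom x x') : W w -> W (lft w).
Proof.
move=> hw; apply: (rep_cancel V (rep_we V x')); rewrite lftE.
exact: (rep_comp V (rep_we V x) hw).
Qed.
Let lft_we' x x' (w : Hom x x') : W' w -> W' (lft' w).
Proof.
move=> hw; apply: (rep_cancel V' (rep_we V' x')); rewrite lftE'.
exact: (rep_comp V' (rep_we V' x) hw).
Qed.

Lemma deform_inverts (x x' : C) (y y' : D) (f : Hom x x') (g : Hom y y') :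
  W f -> W' g -> is_iso (bmap deform f g).
Proof.
by move=> hf hg; apply: hPhi; try apply: rep_good; [apply: lft_we | apply: lft_we'].
Qed.

(** Evaluate [Phi] on replacements.  This is a functor because homotopic maps
    have the same image, and it inverts weak equivalences, hence descends. *)
Theorem left_derived_bi_exists :
  exists (L : Functor (prodC (Loc W) (Loc W')) H)
    (e : NatTrans (compF (compF L (loc_prod W W')) (loc (prodW W W'))) Phi),
    forall x y, good V x -> good V' y -> is_iso (e (x, y)).
Proof.
have dl x x' y (w : Hom x x') : W w -> is_iso (bmap deform w (idm y)).
  by move=> h; apply: deform_inverts h (rep_id V' y).
have dr x y y' (w : Hom y y') : W' w -> is_iso (bmap deform (idm x) w).
  by move=> h; apply: deform_inverts (rep_id V x) h.
exists (bi_lift dl dr).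
unshelve eexists.
- exists (fun p : prodC C D =>
    let: (x, y) as p0 := p
      return Hom (bob Phi (rep V (fst p0)) (rep V' (snd p0))) (Phi p0) in
    bmap Phi (rep_map V x) (rep_map V' y)).
  move=> [x y] [x' y'] [f g].
  transitivity (bmap Phi (rep_map V x') (rep_map V' y') ∘ bmap deform f g).
    congr (_ ∘ _); rewrite -(bi_liftE dl dr).
    exact: (f_equal (fmap (bi_lift dl dr)) (@loc_prodE _ _ _ _ (x, y) (x', y') (f, g))).
  apply: eq_trans (eq_sym (bmap_comp Phi (rep_map V x') (lft f) (rep_map V' y') (lft' g))) _.
  by rewrite lftE lftE'; apply: bmap_comp.
- move=> x y hx hy; apply: hPhi => //; try exact: rep_good; exact: rep_we.
Qed.
End TwoVariableLeft.

Section TwoVariableRight.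
Context {C D H : Category} {W : MorphismClass C} {W' : MorphismClass D}.
Context (V : LeftReplacement W) (V' : LeftReplacement (opW W')).

Lemma right_derived_bi (Phi : Functor (prodC (op C) D) H)
    (R : Functor (prodC (op (Loc W)) (Loc W')) H)
    (r : NatTrans Phi (compF (compF R (loc_op_prod W W')) (loc (prodW (opW W) W')))) :
  (forall x y, good V x -> good V' y -> is_iso (r (x, y))) ->
  IsRightDerived (compF R (loc_op_prod W W')) r.
Proof.
move=> he.
apply: (@right_derived_of_iso _ _ _ _
  (fun p : prodC (op C) D => (rep V (fst p), rep V' (snd p)) : prodC (op C) D)
  (fun p => (rep_map V (fst p), rep_map V' (snd p)))).
- by move=> p; split; [apply: rep_we | apply: (rep_we V')].
- move=> p q [f g]; have [f' hf] := rep_lift V f; have [g' hg] := rep_lift V' g.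
  by exists (f', g'); rewrite /=; congr pair.
- by move=> p; apply: he; [apply: rep_good | apply: (rep_good V')].
Qed.

Definition flip_op (Phi : Functor (prodC (op C) D) H) :
  Functor (prodC C (op D)) (op H).
Proof.
refine {| fobj := fun p : prodC C (op D) =>
            (bob Phi (fst p : op C) (snd p : D) : op H);
          fmap := fun (p q : prodC C (op D)) f =>
            bmap Phi (fst f : @Hom (op C) (fst q) (fst p))
                     (snd f : @Hom D (snd q) (snd p)) |}.
- by move=> p; apply: (bmap_id Phi).
- by move=> p q r g f; apply: (bmap_comp Phi).
Defined.

Definition unflip_op (L : Functor (prodC (Loc W) (Loc (opW W'))) (op H)) :
  Functor (prodC (op (Loc W)) (Loc W')) H.
Proof.
refine {| fobj := fun p : prodC (op (Loc W)) (Loc W') =>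
            (bob L (fst p : Loc W) (snd p : Loc (opW W')) : H);
          fmap := fun (p q : prodC (op (Loc W)) (Loc W')) f =>
            bmap L (fst f : @Hom (Loc W) (fst q) (fst p))
                   (fmap (loc_op W') (snd f : @Hom (op (Loc W')) (snd q) (snd p))) |}.
- move=> p; apply: eq_trans (bmap_id L (fst p) (snd p)).
  exact: (f_equal (bmap L (idm (fst p : Loc W)))
            (fmap_id (loc_op W') (snd p : op (Loc W')))).
- move=> p q r g f.
  apply: eq_trans (bmap_comp L (fst f : @Hom (Loc W) (fst q) (fst p))
    (fst g : @Hom (Loc W) (fst r) (fst q)) 
    (fmap (loc_op W') (snd f : @Hom (op (Loc W')) (snd q) (snd p)))
    (fmap (loc_op W') (snd g : @Hom (op (Loc W')) (snd r) (snd q)))).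
  exact: (f_equal (bmap L (fst (g ∘ f) : @Hom (Loc W) (fst r) (fst p)))
            (fmap_comp (loc_op W') (snd f : @Hom (op (Loc W')) (snd q) (snd p))
               (snd g : @Hom (op (Loc W')) (snd r) (snd q)))).
Defined.

(** The left derived functor of [Phi] viewed as a functor to the opposite of
    [H], in which the second variable becomes the contravariant one. *)
Theorem right_derived_bi_exists (Phi : Functor (prodC (op C) D) H) :
  (forall (x x' : C) (y y' : D) (f : Hom x' x) (g : Hom y y'),
    good V x -> good V x' -> good V' y -> good V' y' -> W f -> W' g ->
    is_iso (bmap Phi (f : @Hom (op C) x x') g)) ->
  exists (R : Functor (prodC (op (Loc W)) (Loc W')) H)
    (r : NatTrans Phi (compF (compF R (loc_op_prod W W')) (loc (prodW (opW W) W')))),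
    forall x y, good V x -> good V' y -> is_iso (r (x, y)).
Proof.
move=> hPhi.
have [L [e he]] : exists (L : Functor (prodC (Loc W) (Loc (opW W'))) (op H))
    (e : NatTrans (compF (compF L (loc_prod W (opW W'))) (loc (prodW W (opW W'))))
           (flip_op Phi)),
    forall x y, good V x -> good V' y -> is_iso (e (x, y)).
  apply: left_derived_bi_exists => x x' y y' f g hx hx' hy hy' hf hg.
  by apply/iso_op; apply: hPhi hx' hx hy' hy hf hg.
exists (unflip_op L); unshelve eexists.
- exists (fun p : prodC (op C) D =>
    let: (x, y) as p0 := p
      return Hom (Phi p0) (bob (unflip_op L) (fst p0 : op (Loc W)) (snd p0 : Loc W')) in
    e ((x : C), (y : op D))).
  move=> [x y] [x' y'] [f g].
  have := @nt_nat _ _ _ _ e (x', y') (x, y)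
    ((f : @Hom C x' x), (g : @Hom (op D) y' y)).
  move=> /= n; apply: eq_trans (eq_sym n) _.
  refine (f_equal (fun h : @Hom H (bob L x y) (bob L x' y') => h ∘ e (x, y)) _).
  transitivity (bmap L (fmap (loc W) (f : @Hom C x' x))
                       (fmap (loc (opW W')) (g : @Hom (op D) y' y))).
  + exact (f_equal (@fmap _ _ L (x', y') (x, y))
      (@loc_prodE C (op D) W (opW W') (x', y') (x, y) (f, g))).
  + rewrite -(loc_opE W').
    exact (f_equal (@fmap _ _ (unflip_op L) (x, y) (x', y'))
      (eq_sym (@loc_op_prodE _ _ W W' (x, y) (x', y') (f, g)))).
- by move=> x y hx hy; apply/iso_op; apply: he.
Qed.
End TwoVariableRight.

(** * Model categories *)
Definition lims_opop (C : Category) (E : FiniteLimits C) :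
  FiniteLimits (op (op C)) :=
  @Build_FiniteLimits (op (op C)) (term E) (@to_term C E) (@to_term_uniq C E)
    (@prd C E) (@prd_fst C E) (@prd_snd C E) (@prd_pair C E) (@prd_fstE C E)
    (@prd_sndE C E) (@prd_uniq C E) (@eqz C E) (@eqz_inc C E) (@eqz_incE C E)
    (@eqz_lift C E) (@eqz_liftE C E) (@eqz_mono C E).

Lemma retract_op (C : Category) (x y x' y' : C) (f : Hom x y) (f' : Hom x' y') :
  @IsRetract (op C) y x y' x' f f' -> IsRetract f f'.
Proof.
move=> [i [r [j [s [h1 [h2 [h3 h4]]]]]]]; exists s, j, r, i; split; first exact: h2.
by split; [exact: h1 | split; [exact: (eq_sym h4) | exact: (eq_sym h3)]].
Qed.

Lemma lifts_op (C : Category) (a b x y : C) (i : Hom a b) (p : Hom x y) :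
  Lifts i p -> @Lifts (op C) y x b a p i.
Proof.
move=> h u v e; have [k [k1 k2]] := h v u (eq_sym e).
by exists k; split.
Qed.

Definition op_model (C : Category) (Q : ModelStructure C) : ModelStructure (op C).
Proof.
apply: (@Build_ModelStructure (op C) (colims Q) (lims_opop (lims Q))
  (fun x y f => @we C Q y x f) (fun x y f => @cof C Q y x f)
  (fun x y f => @fib C Q y x f)).
- by move=> x y z g f hf hg; apply: (we_comp (m := Q)).
- move=> x y z g f; exact: (@we_cancel_r C Q z y x f g).
- move=> x y z g f; exact: (@we_cancel_l C Q z y x f g).
- by move=> x y x' y' f f' /retract_op; apply: we_retract.
- by move=> x y x' y' f f' /retract_op; apply: cof_retract.
- by move=> x y x' y' f f' /retract_op; apply: fib_retract.
- by move=> a b x y i p hi hp hw; apply: lifts_op; apply: (lift_tcof (m := Q)).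
- by move=> a b x y i p hi hw hp; apply: lifts_op; apply: (lift_cof (m := Q)).
- move=> x y f; have [z [i [p [h1 [h2 [h3 h4]]]]]] := factor_tcof Q f.
  by exists z, p, i.
- move=> x y f; have [z [i [p [h1 [h2 [h3 h4]]]]]] := factor_tfib Q f.
  by exists z, p, i.
Defined.

Section ModelBasics.
Context {C : Category} (Q : ModelStructure C).

Lemma we_id (x : C) : we Q (idm x).
Proof.
have [z [i [p [_ [_ [hp e]]]]]] := factor_tfib Q (idm x).
apply: we_retract hp; exists i, p, (idm x), (idm x).
by rewrite e !comp_idl.
Qed.

Lemma we_iso (x y : C) (f : Hom x y) : is_iso f -> we Q f.
Proof.
move=> [g [h1 h2]]; apply: we_retract (we_id y); exists f, g, (idm y), (idm y).
by rewrite h1 h2 !comp_idl.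
Qed.

Lemma gamma_iso (x y : C) (f : Hom x y) : we Q f -> is_iso (fmap (gamma Q) f).
Proof. exact: loc_inverts. Qed.

(** The retract argument: [f] is a retract of the fibration in a factorization
    of [f] as soon as it lifts against the trivial cofibration. *)
Lemma fib_of_lift (x y : C) (f : Hom x y) :
  (forall (a b : C) (i : Hom a b), cof Q i -> we Q i -> Lifts i f) -> fib Q f.
Proof.
move=> h; have [z [i [p [h1 [h2 [h3 e]]]]]] := factor_tcof Q f.
have [k [k1 k2]] := h _ _ i h1 h2 (idm x) p (eq_trans (comp_idr _) (eq_sym e)).
by apply: fib_retract h3; exists i, k, (idm y), (idm y); rewrite !comp_idl.
Qed.

Lemma tfib_of_lift (x y : C) (f : Hom x y) :
  (forall (a b : C) (i : Hom a b), cof Q i -> Lifts i f) -> fib Q f /\ we Q f.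
Proof.
move=> h; have [z [i [p [h1 [h2 [h3 e]]]]]] := factor_tfib Q f.
have [k [k1 k2]] := h _ _ i h1 (idm x) p (eq_trans (comp_idr _) (eq_sym e)).
have rt : IsRetract f p.
  by exists i, k, (idm y), (idm y); rewrite !comp_idl.
by split; [apply: fib_retract rt h2 | apply: we_retract rt h3].
Qed.
End ModelBasics.

Section ModelDual.
Context {C : Category} (Q : ModelStructure C).

Lemma cof_of_lift (x y : C) (f : Hom x y) :
  (forall (a b : C) (p : Hom a b), fib Q p -> we Q p -> Lifts f p) -> cof Q f.
Proof.
move=> h; apply: (@fib_of_lift _ (op_model Q)) => a b i hi hw.
by apply: lifts_op; apply: h.
Qed.

Lemma tcof_of_lift (x y : C) (f : Hom x y) :
  (forall (a b : C) (p : Hom a b), fib Q p -> Lifts f p) -> cof Q f /\ we Q f.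
Proof.
move=> h; apply: (@tfib_of_lift _ (op_model Q)) => a b i hi.
by apply: lifts_op; apply: h.
Qed.

Lemma cofibrant_lift (x a b : C) (p : Hom a b) (v : Hom x b) :
  cofibrant Q x -> fib Q p -> we Q p -> exists h : Hom x a, p ∘ h = v.
Proof.
move=> hx hp hw.
have [|h [_ h2]] := lift_cof hx hp hw (u := to_term (colims Q) a) (v := v).
  exact: eq_trans (@to_term_uniq _ (colims Q) b _)
    (eq_sym (@to_term_uniq _ (colims Q) b _)).
by exists h.
Qed.

Lemma cofibrant_of_lift (x : C) :
  (forall (a b : C) (p : Hom a b) (v : Hom x b), fib Q p -> we Q p ->
     exists h : Hom x a, p ∘ h = v) -> cofibrant Q x.
Proof.
move=> k; apply: cof_of_lift => a b p hp hw u v _.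
have [h e] := k a b p v hp hw; exists h; split=> //.
exact: eq_trans (@to_term_uniq _ (colims Q) a _)
  (eq_sym (@to_term_uniq _ (colims Q) a _)).
Qed.

Definition cop (x y : C) : C := prd (colims Q) x y.
Definition inl (x y : C) : Hom x (cop x y) := prd_fst (colims Q) x y.
Definition inr (x y : C) : Hom y (cop x y) := prd_snd (colims Q) x y.
Definition cotuple (x y z : C) (f : Hom x z) (g : Hom y z) : Hom (cop x y) z :=
  @prd_pair _ (colims Q) z x y f g.

Lemma cotuple_inl x y z (f : Hom x z) (g : Hom y z) :
  cotuple f g ∘ inl x y = f.
Proof. exact: (@prd_fstE _ (colims Q)). Qed.

Lemma cotuple_inr x y z (f : Hom x z) (g : Hom y z) :
  cotuple f g ∘ inr x y = g.
Proof. exact: (@prd_sndE _ (colims Q)). Qed.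

Lemma cop_ext x y z (f g : Hom (cop x y) z) :
  f ∘ inl x y = g ∘ inl x y -> f ∘ inr x y = g ∘ inr x y -> f = g.
Proof. exact: (@prd_uniq _ (colims Q)). Qed.

Lemma cof_comp (x y z : C) (g : Hom y z) (f : Hom x y) :
  cof Q f -> cof Q g -> cof Q (g ∘ f).
Proof.
move=> hf hg; apply: cof_of_lift => a b p hp hw u v e.
rewrite comp_assoc in e; have [h [h1 h2]] := lift_cof hf hp hw e.
have [k [k1 k2]] := lift_cof hg hp hw h2.
by exists k; rewrite comp_assoc k1.
Qed.

Lemma cofibrant_cof (x y : C) (f : Hom x y) :
  cofibrant Q x -> cof Q f -> cofibrant Q y.
Proof.
move=> hx hf; apply: cofibrant_of_lift => a b p v hp hw.
have [u e] := cofibrant_lift (v ∘ f) hx hp hw.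
by have [h [_ h2]] := lift_cof hf hp hw e; exists h.
Qed.

Lemma cof_inl (x y : C) : cofibrant Q y -> cof Q (inl x y).
Proof.
move=> hy; apply: cof_of_lift => a b p hp hw u v e.
have [k ek] := cofibrant_lift (v ∘ inr x y) hy hp hw.
exists (cotuple u k); rewrite cotuple_inl; split=> //.
by apply: cop_ext; rewrite -comp_assoc ?cotuple_inl ?cotuple_inr.
Qed.

Lemma cof_inr (x y : C) : cofibrant Q x -> cof Q (inr x y).
Proof.
move=> hx; apply: cof_of_lift => a b p hp hw u v e.
have [k ek] := cofibrant_lift (v ∘ inl x y) hx hp hw.
exists (cotuple k u); rewrite cotuple_inr; split=> //.
by apply: cop_ext; rewrite -comp_assoc ?cotuple_inl ?cotuple_inr.
Qed.

Lemma cofibrant_rep_exists (x : C) :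
  exists (z : C) (p : Hom z x), cofibrant Q z /\ fib Q p /\ we Q p.
Proof.
have [z [i [p [h1 [h2 [h3 e]]]]]] :=
  factor_tfib Q (to_term (colims Q) x : @Hom C (term (colims Q)) x).
exists z, p; split=> //; rewrite /cofibrant.
by rewrite -(@to_term_uniq _ (colims Q) _ i).
Qed.

(** Factoring the map [x ⊔ y -> y] given by [f] and the identity writes [f] as
    [p i] with [i] a trivial cofibration and [p] a map having a trivial
    cofibration as a section. *)
Lemma ken_brown (H : Category) (Phi : Functor C H) :
  (forall (x y : C) (f : Hom x y), cofibrant Q x -> cofibrant Q y ->
     cof Q f -> we Q f -> is_iso (fmap Phi f)) ->
  forall (x y : C) (f : Hom x y), cofibrant Q x -> cofibrant Q y ->
     we Q f -> is_iso (fmap Phi f).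
Proof.
move=> hP x y f hx hy hf.
have [z [k [p [hk [_ [hp e]]]]]] := factor_tfib Q (cotuple f (idm y)).
have e1 : p ∘ (k ∘ inl x y) = f by rewrite comp_assoc e cotuple_inl.
have e2 : p ∘ (k ∘ inr x y) = idm y by rewrite comp_assoc e cotuple_inr.
have c1 : cof Q (k ∘ inl x y) by apply: cof_comp hk; apply: cof_inl.
have c2 : cof Q (k ∘ inr x y) by apply: cof_comp hk; apply: cof_inr.
have hz := cofibrant_cof hx c1.
have i1 : is_iso (fmap Phi (k ∘ inl x y)).
  by apply: hP => //; apply: (we_cancel_l hp); rewrite e1.
have i2 : is_iso (fmap Phi (k ∘ inr x y)).
  by apply: hP => //; apply: (we_cancel_l hp); rewrite e2; apply: we_id.
rewrite -e1 fmap_comp; apply: iso_comp i1.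
by apply: (iso_of_section i2); rewrite -fmap_comp e2 fmap_id.
Qed.

(** Homotopies are obtained by lifting along a cylinder object [a ⊔ a -> c]
    against the trivial fibration onto the object that is replaced. *)
Definition model_replacement : LeftReplacement (we Q).
Proof.
pose P x := constructive_indefinite_description _ (cofibrant_rep_exists x).
pose R x := constructive_indefinite_description _ (proj2_sig (P x)).
refine (@Build_LeftReplacement C (we Q) (cofibrant Q) (fun x => proj1_sig (P x))
  (fun x => proj1_sig (R x)) (fun x => proj1 (proj2_sig (R x)))
  (fun x => proj2 (proj2 (proj2_sig (R x)))) (we_id Q) (@we_comp _ Q)
  (@we_cancel_l _ Q) _ _).
- move=> x y f; have [_ [h1 h2]] := proj2_sig (R y).
  exact: (cofibrant_lift (f ∘ proj1_sig (R x)) (proj1 (proj2_sig (R x))) h1 h2).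
- move=> a y u v ha e.
  have [c [k [s [hk [hs [ws es]]]]]] := factor_tfib Q (cotuple (idm a) (idm a)).
  have sq : proj1_sig (R y) ∘ cotuple u v = (proj1_sig (R y) ∘ u ∘ s) ∘ k.
    rewrite -[RHS]comp_assoc es.
    by apply: cop_ext; rewrite -!comp_assoc ?cotuple_inl ?cotuple_inr comp_idr.
  have [_ [t1 t2]] := proj2_sig (R y).
  have [h [h1 h2]] := lift_cof hk t1 t2 sq.
  exists c, (k ∘ inl a a), (k ∘ inr a a), s, h; split.
    by apply: (@cofibrant_cof a) => //; apply: cof_comp hk; apply: cof_inl.
  by rewrite !comp_assoc es h1 !cotuple_inl !cotuple_inr.
Defined.
End ModelDual.

Section Fibrant.
Context {C : Category} (Q : ModelStructure C).

Lemma fibrant_extend (x a b : C) (i : Hom a b) (u : Hom a x) :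
  fibrant Q x -> cof Q i -> we Q i -> exists h : Hom b x, h ∘ i = u.
Proof.
move=> hx hi hw.
by have [h e] := @cofibrant_lift _ (op_model Q) x b a i u hx hi hw; exists h.
Qed.

Lemma fibrant_of_extend (x : C) :
  (forall (a b : C) (i : Hom a b) (u : Hom a x), cof Q i -> we Q i ->
     exists h : Hom b x, h ∘ i = u) -> fibrant Q x.
Proof.
move=> k; apply: (@cofibrant_of_lift _ (op_model Q)) => a b p v hp hw.
by have [h e] := k b a p v hp hw; exists h.
Qed.

Lemma ken_brown_fibrant (H : Category) (Phi : Functor C H) :
  (forall (x y : C) (f : Hom x y), fibrant Q x -> fibrant Q y ->
     fib Q f -> we Q f -> is_iso (fmap Phi f)) ->
  forall (x y : C) (f : Hom x y), fibrant Q x -> fibrant Q y ->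
     we Q f -> is_iso (fmap Phi f).
Proof.
move=> hP x y f hx hy hf; apply/iso_op.
apply: (@ken_brown _ (op_model Q) _ (opF Phi)) hf => // x' y' f' hx' hy' hf' hw'.
by apply/iso_op; apply: hP.
Qed.

Definition fibrant_replacement : LeftReplacement (opW (we Q)) :=
  model_replacement (op_model Q).

Lemma fibrant_rep_exists (x : C) :
  exists (z : C) (i : Hom x z), fibrant Q z /\ cof Q i /\ we Q i.
Proof. exact: (@cofibrant_rep_exists _ (op_model Q) x). Qed.

(** Consider the maps out of [a] of the form [gamma(i)^-1 gamma(f)], with
    [i : y -> z] a fibrant replacement and [f : a -> z].  They contain the
    identity and are stable under composition with [gamma(g)] and with
    [gamma(w)^-1]: the former because [g] extends to fibrant replacements, the
    latter because a map from the cofibrant [a] lifts up to homotopy along a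
    weak equivalence of fibrant objects.  So they are all the maps out of [a]. *)
Lemma gamma_full_rep (a : C) : cofibrant Q a ->
  forall (y : Ho Q) (p : @Hom (Ho Q) a y) (z : C) (i : @Hom C y z),
  fibrant Q z -> cof Q i -> we Q i ->
  exists f : Hom a z, fmap (gamma Q) f = fmap (gamma Q) i ∘ p.
Proof.
move=> ha.
pose P (x y : Ho Q) (g : Hom x y) := forall p : @Hom (Ho Q) a x,
  (forall (z : C) (i : @Hom C x z), fibrant Q z -> cof Q i -> we Q i ->
     exists f : Hom a z, fmap (gamma Q) f = fmap (gamma Q) i ∘ p) ->
  (forall (z : C) (i : @Hom C y z), fibrant Q z -> cof Q i -> we Q i ->
     exists f : Hom a z, fmap (gamma Q) f = fmap (gamma Q) i ∘ (g ∘ p)).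
suff key : forall (x y : Ho Q) (g : Hom x y), P x y g.
  move=> y p z i hz hi hw.
  have := key _ _ p (idm (a : Ho Q)).
  rewrite comp_idr; apply=> // z' i' _ _ _.
  by exists i'; rewrite comp_idr.
apply: loc_ind => [x y g|x y t g f hg hf|x y w v hw e1 e2] p hp z i hz hi wi.
- have [z' [i' [hz' [hi' wi']]]] := fibrant_rep_exists x.
  have [f ef] := hp z' i' hz' hi' wi'.
  have [k ek] := fibrant_extend (i ∘ g) hz hi' wi'.
  exists (k ∘ f); rewrite fmap_comp ef comp_assoc -fmap_comp ek fmap_comp.
  by rewrite comp_assoc.
- have [k ek] := hg (f ∘ p) (hf p hp) z i hz hi wi.
  by exists k; rewrite ek !comp_assoc.
- have [z' [i' [hz' [hi' wi']]]] := fibrant_rep_exists y.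
  have [f ef] := hp z' i' hz' hi' wi'.
  have [k ek] := fibrant_extend (i' ∘ w) hz' hi wi.
  have wk : we Q k.
    by apply: (we_cancel_r wi); rewrite ek; apply: we_comp.
  (* The weak equivalence [k] of fibrant objects is [s l] with [s] a trivial
     fibration and [l] a map that [gamma] inverts and that has a retraction [m]. *)
  have [t [l [s [hl [wl [hs es]]]]]] := factor_tcof Q k.
  have ws : we Q s by apply: (we_cancel_r wl); rewrite es.
  have [m em] := fibrant_extend (idm z) hz hl wl.
  have [f' ef'] := cofibrant_lift f ha hs ws.
  exists (m ∘ f').
  have ik := gamma_iso wk; apply: (iso_mono ik).
  rewrite [RHS]comp_assoc -[X in _ = X ∘ _]fmap_comp ek -[in LHS]es.
  have -> : fmap (gamma Q) (s ∘ l) ∘ fmap (gamma Q) (m ∘ f') = fmap (gamma Q) f.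
    rewrite -ef' !fmap_comp -comp_assoc; congr (_ ∘ _).
    rewrite comp_assoc -[RHS]comp_idl; congr (_ ∘ _).
    apply: (iso_epi (gamma_iso wl)).
    by rewrite -comp_assoc -fmap_comp em fmap_id comp_idl comp_idr.
  rewrite ef fmap_comp -[RHS]comp_assoc; congr (_ ∘ _).
  by rewrite comp_assoc e2 comp_idl.
Qed.

(** In particular [gamma] is full on bifibrant objects, so that naturality in the
    homotopy category can be checked on actual maps. *)
Lemma gamma_full (a b : C) (p : @Hom (Ho Q) a b) :
  cofibrant Q a -> fibrant Q b -> exists f : Hom a b, fmap (gamma Q) f = p.
Proof.
move=> ha hb; have [z [i [hz [hi wi]]]] := fibrant_rep_exists b.
have [f ef] := gamma_full_rep ha p hz hi wi.
have [r er] := fibrant_extend (idm b) hb hi wi.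
by exists (r ∘ f); rewrite fmap_comp ef comp_assoc -fmap_comp er fmap_id comp_idl.
Qed.

Lemma bifibrant_rep_exists (x : C) :
  exists y : C, (cofibrant Q y /\ fibrant Q y) /\
    exists b : @Hom (Ho Q) x y, is_iso b.
Proof.
have [z [p [hz [_ wp]]]] := cofibrant_rep_exists Q x.
have [y [i [hy [hi wi]]]] := fibrant_rep_exists z.
exists y; split; first by split=> //; apply: cofibrant_cof hi.
exists (fmap (gamma Q) i ∘ inv (gamma_iso wp)).
by apply: iso_comp; [apply: gamma_iso | apply: iso_inv].
Qed.
End Fibrant.

(** * The derived adjunction *)
Definition idF (C : Category) : Functor C C.
Proof. by refine {| fobj := fun x : C => x; fmap := fun x y f => f |}. Defined.

(** Let [F] be left adjoint to [G], with counit [eps] and transposition [tr].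
    Suppose given functors [LF] and [RG] between the homotopy categories, with
    comparison maps [e] and [r] invertible on cofibrant and on fibrant objects.
    Then [LF] is left adjoint to [RG], with a counit compatible with [eps]. *)
Section DerivedAdjunction.
Context {C D : Category} (Q : ModelStructure C) (P : ModelStructure D).
Context (F : Functor C D) (G : Functor D C).
Context (eps : forall n : D, Hom (F (G n)) n)
  (eps_nat : forall (n n' : D) (g : Hom n n'),
     eps n' ∘ fmap F (fmap G g) = g ∘ eps n)
  (tr : forall (x : C) (n : D), Hom (F x) n -> Hom x (G n))
  (trE : forall (x : C) (n : D) (f : Hom (F x) n), eps n ∘ fmap F (tr x n f) = f)
  (tr_inj : forall (x : C) (n : D) (g g' : Hom x (G n)),
     eps n ∘ fmap F g = eps n ∘ fmap F g' -> g = g').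
Context (LF : Functor (Ho Q) (Ho P)) (RG : Functor (Ho P) (Ho Q)).
Context (e : forall x : C, @Hom (Ho P) (LF x) (F x))
  (e_nat : forall (x x' : C) (f : Hom x x'),
     e x' ∘ fmap LF (fmap (gamma Q) f) = fmap (gamma P) (fmap F f) ∘ e x)
  (e_iso : forall x : C, cofibrant Q x -> is_iso (e x)).
Context (r : forall n : D, @Hom (Ho Q) (G n) (RG n))
  (r_nat : forall (n n' : D) (g : Hom n n'),
     r n' ∘ fmap (gamma Q) (fmap G g) = fmap RG (fmap (gamma P) g) ∘ r n)
  (r_iso : forall n : D, fibrant P n -> is_iso (r n)).

Let V := model_replacement Q.
Let V' := fibrant_replacement P.

Let eta (x : C) : Hom x (G (F x)) := tr (idm (F x)).

Let etaE x : eps (F x) ∘ fmap F (eta x) = idm (F x).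
Proof. exact: trE. Qed.

Let eta_nat (x x' : C) (f : Hom x x') : eta x' ∘ f = fmap G (fmap F f) ∘ eta x.
Proof.
apply: tr_inj; rewrite !fmap_comp !comp_assoc etaE eps_nat.
by rewrite -comp_assoc etaE comp_idl comp_idr.
Qed.

Let G_eta (n : D) : fmap G (eps n) ∘ eta (G n) = idm (G n).
Proof.
apply: tr_inj; rewrite fmap_comp comp_assoc eps_nat -comp_assoc etaE fmap_id.
by [].
Qed.

(** [LF RG] is a right derived functor of [LF gamma G], since [LF (r n)] is
    invertible for fibrant [n]; its universal property gives the counit. *)
Lemma derived_counit_exists :
  exists w : NatTrans (compF LF RG) (idF (Ho P)),
    forall n : D, w n ∘ fmap LF (r n) = fmap (gamma P) (eps n) ∘ e (G n).
Proof.
pose Phi := compF LF (compF (gamma Q) G).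
have n1 (n n' : D) (g : Hom n n') : fmap LF (r n') ∘ fmap Phi g =
    fmap (compF LF RG) (fmap (gamma P) g) ∘ fmap LF (r n).
  change (fmap LF (r n') ∘ fmap LF (fmap (gamma Q) (fmap G g)) =
    fmap LF (fmap RG (fmap (gamma P) g)) ∘ fmap LF (r n)).
  by rewrite -!fmap_comp r_nat.
have n2 (n n' : D) (g : Hom n n') :
    (fmap (gamma P) (eps n') ∘ e (G n')) ∘ fmap Phi g =
    fmap (compF (idF (Ho P)) (gamma P)) g ∘ (fmap (gamma P) (eps n) ∘ e (G n)).
  change (fmap (gamma P) (eps n') ∘ e (G n') ∘ fmap LF (fmap (gamma Q) (fmap G g)) =
    fmap (gamma P) g ∘ (fmap (gamma P) (eps n) ∘ e (G n))).
  rewrite -comp_assoc e_nat !comp_assoc -!fmap_comp eps_nat.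
  by [].
have [||n|w [hw _]] := @right_derived_of_iso D (Ho P) (we P) Phi (rep V')
  (rep_map V') _ _ (compF LF RG)
  (@Build_NatTrans _ _ Phi (compF (compF LF RG) (gamma P)) _ n1) _ (idF _)
  (@Build_NatTrans _ _ Phi (compF (idF (Ho P)) (gamma P)) _ n2).
- exact: (rep_we V').
- by move=> x y f; have := rep_lift V' f.
- exact: (iso_fmap LF (r_iso (rep_good V' n))).
- by exists w.
Qed.

Lemma derived_unit_exists :
  exists h : NatTrans (idF (Ho Q)) (compF RG LF),
    forall x : C, fmap RG (e x) ∘ h x = r (F x) ∘ fmap (gamma Q) (eta x).
Proof.
pose Phi := compF RG (compF (gamma P) F).
have n1 (x x' : C) (f : Hom x x') : fmap RG (e x') ∘
    fmap (compF RG LF) (fmap (gamma Q) f) = fmap Phi f ∘ fmap RG (e x).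
  change (fmap RG (e x') ∘ fmap RG (fmap LF (fmap (gamma Q) f)) =
    fmap RG (fmap (gamma P) (fmap F f)) ∘ fmap RG (e x)).
  by rewrite -!fmap_comp e_nat.
have n2 (x x' : C) (f : Hom x x') :
    (r (F x') ∘ fmap (gamma Q) (eta x')) ∘ fmap (compF (idF (Ho Q)) (gamma Q)) f =
    fmap Phi f ∘ (r (F x) ∘ fmap (gamma Q) (eta x)).
  change (r (F x') ∘ fmap (gamma Q) (eta x') ∘ fmap (gamma Q) f =
    fmap RG (fmap (gamma P) (fmap F f)) ∘ (r (F x) ∘ fmap (gamma Q) (eta x))).
  rewrite -comp_assoc -fmap_comp eta_nat fmap_comp !comp_assoc r_nat.
  by [].
have [||x|w [hw _]] := @left_derived_of_iso C (Ho Q) (we Q) Phi (rep V)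
  (rep_map V) _ _ (compF RG LF)
  (@Build_NatTrans _ _ (compF (compF RG LF) (gamma Q)) Phi _ n1) _ (idF _)
  (@Build_NatTrans _ _ (compF (idF (Ho Q)) (gamma Q)) Phi _ n2).
- exact: (rep_we V).
- by move=> x y f; have := rep_lift V f.
- exact: (iso_fmap RG (e_iso (rep_good V x))).
- by exists w.
Qed.

(** The triangle identities hold on cofibrant, respectively fibrant, objects,
    where the comparison maps can be cancelled, and hence everywhere. *)
Theorem derived_adjunction :
  exists w : NatTrans (compF LF RG) (idF (Ho P)),
    (forall n : D, w n ∘ fmap LF (r n) = fmap (gamma P) (eps n) ∘ e (G n)) /\
    (forall (x : Ho Q) (n : Ho P) (g : Hom (LF x) n),
       exists! v : Hom x (RG n), w n ∘ fmap LF v = g).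
Proof.
have [w hw] := derived_counit_exists; have [h hh] := derived_unit_exists.
exists w; split=> //.
have wn (n n' : Ho P) (g : Hom n n') : w n' ∘ fmap LF (fmap RG g) = g ∘ w n.
  exact: (nt_nat w).
have hn (x x' : Ho Q) (f : Hom x x') : h x' ∘ f = fmap RG (fmap LF f) ∘ h x.
  exact: (nt_nat h).
have t1 (x : Ho Q) : w (LF x) ∘ fmap LF (h x) = idm (LF x).
  have good x0 (hx : cofibrant Q x0) : w (LF x0) ∘ fmap LF (h x0) = idm (LF x0).
    apply: (iso_mono (e_iso hx)); rewrite comp_assoc -wn -comp_assoc -fmap_comp hh.
    rewrite fmap_comp comp_assoc hw -comp_assoc e_nat comp_assoc -fmap_comp etaE.
    by rewrite fmap_id comp_idl comp_idr.
  have i := iso_fmap LF (gamma_iso (rep_we V x)).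
  apply: (iso_epi i); rewrite -comp_assoc -fmap_comp hn fmap_comp comp_assoc wn.
  by rewrite -comp_assoc good ?comp_idl ?comp_idr //; apply: (rep_good V).
have t2 (n : Ho P) : fmap RG (w n) ∘ h (RG n) = idm (RG n).
  have good n0 (hx : fibrant P n0) : fmap RG (w n0) ∘ h (RG n0) = idm (RG n0).
    apply: (iso_epi (r_iso hx)); rewrite -comp_assoc hn comp_assoc -fmap_comp hw.
    rewrite fmap_comp -comp_assoc hh comp_assoc -r_nat -comp_assoc -(fmap_comp (gamma Q)).
    by rewrite G_eta fmap_id comp_idl comp_idr.
  pose k : @Hom (Ho P) n (rep V' n) :=
    fmap (gamma P) (rep_map V' n : @Hom D n (rep V' n)).
  have i : is_iso (fmap RG k) := iso_fmap RG (gamma_iso (rep_we V' n)).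
  apply: (iso_mono i); rewrite comp_assoc -(fmap_comp RG) -(wn _ _ k) fmap_comp.
  rewrite -comp_assoc -hn comp_assoc good ?comp_idl ?comp_idr //.
  exact: (rep_good V').
move=> x n g; exists (fmap RG g ∘ h x); split.
- by rewrite fmap_comp comp_assoc wn -comp_assoc t1 comp_idr.
- move=> v <-; rewrite fmap_comp -comp_assoc -hn comp_assoc t2.
  by rewrite comp_idl.
Qed.
End DerivedAdjunction.

(** * Symmetric monoidal categories *)
(** Rewriting with an equation between composites, up to associativity. *)
Ltac rw H := rewrite ?comp_assoc;
  first [rewrite H | rewrite (post H) | rewrite (post3 H)]; rewrite ?comp_assoc.

Section Coherence.
Context {C : Category} (S : SymMonoidal C).
Local Notation "x ⊗ y" := (bob (tens S) x y) (at level 38, left associativity).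
Local Notation "f ⊠ g" := (bmap (tens S) f g) (at level 38, left associativity).

Lemma swp_inj x y w (f g : Hom (x ⊗ y) w) :
  f ∘ swp S y x = g ∘ swp S y x -> f = g.
Proof. by apply: iso_epi; exists (swp S x y); rewrite !swpK. Qed.

Lemma swp2 x y z w (f : Hom (x ⊗ y ⊗ z) w) :
  f ∘ (swp S y x ⊠ idm z) ∘ (swp S x y ⊠ idm z) = f.
Proof. by rewrite -comp_assoc -bmap_l swpK bmap_id comp_idr. Qed.

Lemma swp1 x y w (f : Hom (x ⊗ y) w) : f ∘ swp S y x ∘ swp S x y = f.
Proof. by rewrite -comp_assoc swpK comp_idr. Qed.

Lemma swp2r x y z w (f : Hom (z ⊗ (x ⊗ y)) w) :
  f ∘ (idm z ⊠ swp S y x) ∘ (idm z ⊠ swp S x y) = f.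
Proof. by rewrite -comp_assoc -bmap_r swpK bmap_id comp_idr. Qed.

Lemma asc2 x y z w (f : Hom (x ⊗ y ⊗ z) w) : f ∘ ascV S x y z ∘ asc S x y z = f.
Proof. by rewrite -comp_assoc ascK comp_idr. Qed.

Lemma asc2V x y z w (f : Hom (x ⊗ (y ⊗ z)) w) : f ∘ asc S x y z ∘ ascV S x y z = f.
Proof. by rewrite -comp_assoc ascVK comp_idr. Qed.

(** After tensoring with an arbitrary [z] the claim follows from the hexagon
    with the unit in the middle; taking for [z] the unit loses nothing. *)
Lemma lun_swp x : lun S x ∘ swp S x (unit S) = run S x.
Proof.
have k z : run S x ⊠ idm z = (lun S x ∘ swp S x (unit S)) ⊠ idm z.
  have i : is_iso (swp S x z) by exists (swp S z x); rewrite !swpK.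
  apply: (iso_mono i); rewrite bmap_l -triangle !comp_assoc swp_nat.
  rewrite -(lun_asc S z x) -(lun_asc S x z) !comp_assoc.
  by rewrite (post3 (hexagon S x (unit S) z)) !comp_assoc lun_nat.
apply: (iso_epi (f := run S (x ⊗ unit S))).
  by exists (runV S _); rewrite runK runVK.
by rewrite -!run_nat k.
Qed.

Lemma run_swp x : run S x ∘ swp S (unit S) x = lun S x.
Proof. by rewrite -lun_swp -comp_assoc swpK comp_idr. Qed.

(** The hexagon with the roles of the factors exchanged, solved for one side. *)
Lemma hexagonV a b c :
  asc S c b a ∘ (swp S b c ⊠ idm a) ∘ ascV S b c a ∘ (idm b ⊠ swp S a c)
    ∘ asc S b a c = swp S (b ⊗ a) c.
Proof.
apply: swp_inj; rewrite swpK; apply: asc_inj; rewrite comp_idl.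
by rw (hexagon S c b a); rewrite swp2r asc2 swp2.
Qed.

Lemma run_asc x y : (idm x ⊠ run S y) ∘ asc S x y (unit S) = run S (x ⊗ y).
Proof.
rewrite -[RHS]lun_swp -(hexagonV y x (unit S)) !comp_assoc lun_asc -bmap_l lun_swp.
by rewrite -triangle asc2V -bmap_r lun_swp.
Qed.

Lemma reverse3 a b c :
  asc S c b a ∘ swp S a (c ⊗ b) ∘ (idm a ⊠ swp S b c) ∘ asc S a b c =
  swp S (b ⊗ a) c ∘ (swp S a b ⊠ idm c).
Proof.
rewrite -(hexagonV a b c).
rewrite -(comp_assoc _ (swp S a (c ⊗ b))) swp_nat !comp_assoc.
by rw (eq_sym (hexagon S a b c)); rewrite asc2.
Qed.

Lemma reverse3_id m d x :
  swp S x (m ⊗ d) ∘ asc S x m d ∘ (swp S m x ⊠ idm d) ∘ swp S d (m ⊗ x)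
    ∘ asc S d m x ∘ (swp S m d ⊠ idm x) = idm _.
Proof.
have e : swp S d (m ⊗ x) ∘ asc S d m x ∘ (swp S m d ⊠ idm x) =
         ascV S m x d ∘ (idm m ⊠ swp S d x) ∘ asc S m d x.
  rewrite -[LHS]comp_idl -(ascK S m x d).
  by rw (hexagon S d m x); rewrite swp2.
rw e; rewrite -!comp_assoc.
have := hexagonV d m x; rewrite -!comp_assoc => ->.
by rewrite swpK.
Qed.
End Coherence.

(** * The enrichment of modules *)
Section ModuleEnrichment.
Context {C : Category} {S : SymMonoidal C} (K : Closed S) (A : Monoid S)
  (E : FiniteLimits C).
Local Notation "x ⊗ y" := (bob (tens S) x y) (at level 38, left associativity).
Local Notation "f ⊠ g" := (bmap (tens S) f g) (at level 38, left associativity).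
Local Notation mh := (mod_hom K E).

(** Maps into the mapping object of modules are detected by this evaluation.
    With the mapping object on the left, composition and units have the same
    formulas, and the same proofs, as for internal function objects. *)
Definition evl (L M : Module A) : Hom (mh L M ⊗ L) M :=
  locked (ev K L M ∘
    (eqz_inc E (mod_hom_src K L M) (mod_hom_tgt K L M) ⊠ idm (mdl L))).

Lemma evl_inj (Z : C) (L M : Module A) (f g : Hom Z (mh L M)) :
  evl L M ∘ (f ⊠ idm (mdl L)) = evl L M ∘ (g ⊠ idm (mdl L)) -> f = g.
Proof.
rewrite /evl -?lock -!comp_assoc -!bmap_l => h.
by apply: (@eqz_mono _ E); apply: curry_inj h.
Qed.

(** Equivariance of [g : Z ⊗ L -> M], where the action on [L] is moved past
    [Z]; equivalently [g ∘ swp : L ⊗ Z -> M] is a map of modules. *)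
Definition linear (Z : C) (L M : Module A) (g : Hom (Z ⊗ L) M) : Prop :=
  g ∘ (idm Z ⊠ act L) =
  act M ∘ (idm (mon A) ⊠ (g ∘ swp S L Z)) ∘ asc S A L Z ∘ swp S Z (A ⊗ L).

(** The left side is what [mod_hom_tgt], one of the two maps that the mapping
    object equalizes, makes of the transpose of [g]; the right side is the one
    that appears in [linear]. *)
Lemma linear_tgt (Z : C) (L M : Module A) (g : Hom (Z ⊗ L) M) :
  act M ∘ (idm (mon A) ⊠ g) ∘ asc S A Z L ∘ (swp S Z A ⊠ idm (mdl L))
    ∘ ascV S Z A L =
  act M ∘ (idm (mon A) ⊠ (g ∘ swp S L Z)) ∘ asc S A L Z ∘ swp S Z (A ⊗ L).
Proof.
apply: asc_inj; rewrite asc2 bmap_r !comp_assoc.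
by rw (hexagon S Z A L); rewrite swp2r.
Qed.

Lemma evl_linear (L M : Module A) : linear (evl L M).
Proof.
rewrite /linear -linear_tgt.
have := eqz_incE E (mod_hom_src K L M) (mod_hom_tgt K L M).
set i := eqz_inc E _ _ => e.
rewrite /evl -?lock -/i -[LHS]comp_assoc -bmap_lr bmap_rl.
have := f_equal (fun k => ev K (A ⊗ L) M ∘ (k ⊠ idm (A ⊗ L))) e.
rewrite /= (bmap_l _ _ (mod_hom_src K L M)) (bmap_l _ _ (mod_hom_tgt K L M)).
rewrite !comp_assoc ev_mod_hom_tgt ev_ihom_map comp_idl => ->.
rewrite -(bmap_id (tens S) (mon A) (mdl L)); rewrite (post (ascV_nat S _ _ _)) !comp_assoc.
rw (eq_sym (bmap_l (tens S) (mdl L) (swp S (ihom K L M) A) (i ⊠ idm _))).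
rewrite swp_nat bmap_l comp_assoc; rewrite (post (asc_nat S _ _ _)) !comp_assoc.
by rw (eq_sym (bmap_r (tens S) (mon A) (ev K L M) (i ⊠ idm (mdl L)))).
Qed.

Lemma curry_linear (Z : C) (L M : Module A) (g : Hom (Z ⊗ L) M) :
  linear g -> mod_hom_src K L M ∘ curry K g = mod_hom_tgt K L M ∘ curry K g.
Proof.
move=> h; apply: curry_inj.
rewrite (bmap_l _ _ (mod_hom_src K L M)) (bmap_l _ _ (mod_hom_tgt K L M)).
rewrite !comp_assoc ev_mod_hom_tgt ev_ihom_map comp_idl.
rw (eq_sym (bmap_rl (tens S) (curry K g) (act L))).
rewrite bmap_lr comp_assoc ev_curry h -linear_tgt.
rewrite -[in RHS](bmap_id (tens S)); rewrite (post (ascV_nat S _ _ _)) !comp_assoc.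
rw (eq_sym (bmap_l (tens S) (mdl L) (swp S (ihom K L M) A) (curry K g ⊠ idm _))).
rewrite swp_nat bmap_l comp_assoc; rewrite (post (asc_nat S _ _ _)) !comp_assoc.
rw (eq_sym (bmap_r (tens S) (mon A) (ev K L M) (curry K g ⊠ idm (mdl L)))).
by rewrite ev_curry.
Qed.

Definition lcur (Z : C) (L M : Module A) (g : Hom (Z ⊗ L) M) (h : linear g) :
  Hom Z (mh L M) := eqz_lift E (curry_linear h).

Lemma evl_lcur (Z : C) (L M : Module A) (g : Hom (Z ⊗ L) M) (h : linear g) :
  evl L M ∘ (lcur h ⊠ idm (mdl L)) = g.
Proof. by rewrite /evl -?lock -comp_assoc -bmap_l eqz_liftE ev_curry. Qed.

Lemma linear_of_map (Z : C) (L M : Module A) (f : ModuleMap (mod_tens L Z) M) :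
  linear (mmap f ∘ swp S Z L).
Proof.
rewrite /linear -[LHS]comp_assoc swp_nat [LHS]comp_assoc swp1.
by have := mmap_act f; rewrite /= => <-; rewrite !comp_assoc asc2.
Qed.

Lemma map_of_linear (Z : C) (L M : Module A) (g : Hom (Z ⊗ L) M) :
  linear g ->
  g ∘ swp S L Z ∘ act (mod_tens L Z) =
  act M ∘ (idm (mon A) ⊠ (g ∘ swp S L Z)).
Proof.
move=> h; rewrite /= !comp_assoc; rw (swp_nat S (act L) (idm Z)).
by rewrite h swp1 asc2V.
Qed.

(** The counit of the adjunction between [L ⊗ -] and [mh L -]. *)
Definition mev (L M : Module A) : ModuleMap (mod_tens L (mh L M)) M :=
  Build_ModuleMap (map_of_linear (evl_linear L M)).

Definition mcur (Z : C) (L M : Module A) (f : ModuleMap (mod_tens L Z) M) :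
  Hom Z (mh L M) := lcur (linear_of_map f).

Lemma evl_mcur (Z : C) (L M : Module A) (f : ModuleMap (mod_tens L Z) M) :
  evl L M ∘ (mcur f ⊠ idm (mdl L)) = mmap f ∘ swp S Z L.
Proof. exact: evl_lcur. Qed.

Lemma mev_mcur (Z : C) (L M : Module A) (f : ModuleMap (mod_tens L Z) M) :
  mmap (mev L M) ∘ (idm (mdl L) ⊠ mcur f) = mmap f.
Proof.
by rewrite /= -comp_assoc swp_nat comp_assoc evl_mcur -comp_assoc swpK comp_idr.
Qed.

Lemma evl_swp (Z : C) (L M : Module A) (g : Hom Z (mh L M)) :
  evl L M ∘ (g ⊠ idm (mdl L)) = mmap (mev L M) ∘ (idm (mdl L) ⊠ g) ∘ swp S Z L.
Proof. by rewrite /= -!comp_assoc -!swp_nat [swp S _ _ ∘ _]comp_assoc swpK comp_idl. Qed.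

Lemma mev_inj (Z : C) (L M : Module A) (f g : Hom Z (mh L M)) :
  mmap (mev L M) ∘ (idm (mdl L) ⊠ f) = mmap (mev L M) ∘ (idm (mdl L) ⊠ g) ->
  f = g.
Proof. by move=> h; apply: evl_inj; rewrite !evl_swp h. Qed.

Lemma evl_mod_hom_map (L L' M M' : Module A) (f : ModuleMap L' L)
    (g : ModuleMap M M') :
  evl L' M' ∘ (mod_hom_map K E f g ⊠ idm (mdl L')) =
  mmap g ∘ evl L M ∘ (idm _ ⊠ mmap f).
Proof.
rewrite /evl -?lock -!comp_assoc -bmap_l /mod_hom_map eqz_liftE bmap_l comp_assoc.
by rewrite ev_ihom_map -!comp_assoc -bmap_rl -bmap_lr.
Qed.

Definition mod_ascV (M : Module A) (X Y : C) :
  ModuleMap (mod_tens M (X ⊗ Y)) (mod_tens (mod_tens M X) Y).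
Proof.
refine (@Build_ModuleMap _ _ _ (mod_tens M (X ⊗ Y)) (mod_tens (mod_tens M X) Y)
          (ascV S M X Y) _).
rewrite /= comp_assoc -(bmap_id (tens S) X Y) ascV_nat [in RHS]bmap_l.
apply: asc_inj; rewrite asc2; rw (pentagonV S A M X Y).
by rewrite -[_ ∘ _ ∘ (asc S _ _ _ ⊠ _)]comp_assoc -bmap_l ascK bmap_id comp_idr.
Defined.

Definition mod_asc (M : Module A) (X Y : C) :
  ModuleMap (mod_tens (mod_tens M X) Y) (mod_tens M (X ⊗ Y)).
Proof.
refine (@Build_ModuleMap _ _ _ (mod_tens (mod_tens M X) Y) (mod_tens M (X ⊗ Y))
          (asc S M X Y) _).
have e := mmap_act (mod_ascV M X Y).
have i : is_iso (ascV S M X Y) by exists (asc S M X Y); rewrite ascK ascVK.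
have j : is_iso (idm (mon A) ⊠ ascV S M X Y) by apply: iso_bmap; first apply: iso_id.
apply: (iso_mono i); apply: (iso_epi j).
transitivity (act (mod_tens (mod_tens M X) Y) ∘ (idm (mon A) ⊠ ascV S M X Y)).
- by rewrite comp_assoc ascK comp_idl.
- rewrite -e -!comp_assoc -bmap_r ascVK bmap_id comp_idr.
  by [].
Defined.

(** Defining composition by the map of modules
    [L ⊗ (mh M N ⊗ mh L M) -> (L ⊗ mh L M) ⊗ mh M N -> M ⊗ mh M N -> N]
    makes its equivariance automatic; [evl_mcomp] then gives the usual
    description by iterated evaluation. *)
Definition mcomp_map (L M N : Module A) :
  ModuleMap (mod_tens L (mh M N ⊗ mh L M)) N :=
  ((mev M N : @Hom (Mod A) _ _) ∘ mod_tens_map (mev L M) (idm (mh M N))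
   ∘ mod_ascV L (mh L M) (mh M N)
   ∘ mod_tens_map (idm (L : Mod A)) (swp S (mh M N) (mh L M)))%cat.

Definition mcomp (L M N : Module A) : Hom (mh M N ⊗ mh L M) (mh L N) :=
  mcur (mcomp_map L M N).

Lemma evl_mcomp (L M N : Module A) :
  evl L N ∘ (mcomp L M N ⊠ idm (mdl L)) =
  evl M N ∘ (idm _ ⊠ evl L M) ∘ asc S (mh M N) (mh L M) L.
Proof.
rewrite evl_mcur /= bmap_l !comp_assoc.
rw (swp_nat S (evl L M) (idm (mh M N))).
rw (eq_sym (reverse3 S L (mh L M) (mh M N))).
by rewrite asc2V swp2r swp1.
Qed.

Lemma mcomp_assoc (L M N P : Module A) :
  mcomp L M P ∘ (mcomp M N P ⊠ idm (mh L M)) =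
  mcomp L N P ∘ (idm (mh N P) ⊠ mcomp L M N) ∘ asc S (mh N P) (mh M N) (mh L M).
Proof.
apply: evl_inj; rewrite !bmap_l !comp_assoc !evl_mcomp.
rewrite !(post (asc_nat S _ _ _)) !comp_assoc.
rw (eq_sym (bmap_r (tens S) (mh N P) (evl L N) (mcomp L M N ⊠ idm (mdl L)))).
rewrite evl_mcomp bmap_id.
rw (eq_sym (bmap_rl (tens S) (mcomp M N P) (evl L M))).
rewrite bmap_lr comp_assoc evl_mcomp (bmap_r _ _ _ (asc S _ _ L)).
rewrite (bmap_r _ _ (evl M N)) !comp_assoc.
rw (eq_sym (pentagon S (mh N P) (mh M N) (mh L M) L)).
by rewrite -(bmap_id (tens S)) (post (asc_nat S _ _ _)) !comp_assoc.
Qed.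

Definition mid_map (L : Module A) : ModuleMap (mod_tens L (unit S)) L.
Proof.
refine (@Build_ModuleMap _ _ _ (mod_tens L (unit S)) L (run S L) _).
apply: asc_inj; rewrite /= !comp_assoc asc2 run_nat.
by rewrite -[RHS]comp_assoc run_asc.
Defined.

Definition mid (L : Module A) : Hom (unit S) (mh L L) := mcur (mid_map L).

Lemma evl_mid (L : Module A) : evl L L ∘ (mid L ⊠ idm (mdl L)) = lun S L.
Proof. by rewrite evl_mcur /= run_swp. Qed.

Lemma mcomp_idl (L M : Module A) :
  mcomp L M M ∘ (mid M ⊠ idm (mh L M)) = lun S (mh L M).
Proof.
apply: evl_inj; rewrite bmap_l comp_assoc evl_mcomp.
rewrite (post (asc_nat S _ _ _)) !comp_assoc bmap_id.
rw (eq_sym (bmap_rl (tens S) (mid M) (evl L M))).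
by rewrite bmap_lr comp_assoc evl_mid lun_nat -comp_assoc lun_asc.
Qed.

Lemma mcomp_idr (L M : Module A) :
  mcomp L L M ∘ (idm (mh L M) ⊠ mid L) = run S (mh L M).
Proof.
apply: evl_inj; rewrite bmap_l comp_assoc evl_mcomp.
rewrite (post (asc_nat S _ _ _)) !comp_assoc.
rw (eq_sym (bmap_r (tens S) (mh L M) (evl L L) (mid L ⊠ idm (mdl L)))).
by rewrite evl_mid -comp_assoc triangle.
Qed.

Definition mod_enriched : EnrichedCategory S mh :=
  {| ecomp := mcomp; eid := mid; ecomp_assoc := mcomp_assoc;
     ecomp_idl := mcomp_idl; ecomp_idr := mcomp_idr |}.
End ModuleEnrichment.

(** * Tensors and cotensors of modules *)
Section ModuleTensors.
Context {C : Category} {S : SymMonoidal C} (K : Closed S) (A : Monoid S)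
  (E : FiniteLimits C).
Local Notation "x ⊗ y" := (bob (tens S) x y) (at level 38, left associativity).
Local Notation "f ⊠ g" := (bmap (tens S) f g) (at level 38, left associativity).
Local Notation mh := (mod_hom K E).
Local Notation mhm := (mod_hom_map K E).
Local Notation evl := (evl K E).
Local Notation mcomp := (mcomp K E).
Local Notation mid := (mid K E).
Implicit Types (L M N : Module A).
Local Notation idM L := (idm (L : Mod A)).

Lemma evl_post L M M' (g : ModuleMap M M') :
  evl L M' ∘ (mhm (idM L) g ⊠ idm (mdl L)) = mmap g ∘ evl L M.
Proof. by rewrite evl_mod_hom_map bmap_id comp_idr. Qed.

Lemma evl_pre L L' M (f : ModuleMap L' L) :
  evl L' M ∘ (mhm f (idM M) ⊠ idm (mdl L')) = evl L M ∘ (idm _ ⊠ mmap f).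
Proof. by rewrite evl_mod_hom_map comp_idl. Qed.

Lemma mev_post L M M' (g : ModuleMap M M') :
  mmap (mev K E L M') ∘ (idm (mdl L) ⊠ mhm (idM L) g) = mmap g ∘ mmap (mev K E L M).
Proof. by rewrite /= -comp_assoc swp_nat comp_assoc evl_post !comp_assoc. Qed.

Lemma mev_pre L L' M (f : ModuleMap L' L) :
  mmap (mev K E L' M) ∘ (idm (mdl L') ⊠ mhm f (idM M)) =
  mmap (mev K E L M) ∘ (mmap f ⊠ idm _).
Proof.
by rewrite /= -comp_assoc swp_nat comp_assoc evl_pre -!comp_assoc -swp_nat.
Qed.

Lemma mcomp_post L M N N' (g : ModuleMap N N') :
  mcomp L M N' ∘ (mhm (idM M) g ⊠ idm (mh L M)) = mhm (idM L) g ∘ mcomp L M N.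
Proof.
apply: evl_inj; rewrite (bmap_l _ _ (mcomp L M N')) (bmap_l _ _ (mhm (idM L) g)).
rewrite !comp_assoc evl_mcomp evl_post (post (asc_nat S _ _ _)) bmap_id.
rw (eq_sym (bmap_rl (tens S) (mhm (idM M) g) (evl L M))).
by rewrite bmap_lr comp_assoc evl_post -!comp_assoc evl_mcomp !comp_assoc.
Qed.

Lemma mcomp_pre L L' M N (f : ModuleMap L' L) :
  mcomp L' M N ∘ (idm (mh M N) ⊠ mhm f (idM M)) = mhm f (idM N) ∘ mcomp L M N.
Proof.
apply: evl_inj; rewrite (bmap_l _ _ (mcomp L' M N)) (bmap_l _ _ (mhm f (idM N))).
rewrite !comp_assoc evl_mcomp evl_pre (post (asc_nat S _ _ _)) !comp_assoc.
rw (eq_sym (bmap_r (tens S) (mh M N) (evl L' M) (mhm f (idM M) ⊠ idm (mdl L')))).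
rewrite evl_pre (bmap_r _ _ (evl L M)) !comp_assoc.
rw (eq_sym (bmap_rl (tens S) (mcomp L M N) (mmap f))).
rewrite [in RHS]bmap_lr comp_assoc evl_mcomp.
by rewrite -(bmap_id (tens S)) (post (asc_nat S _ _ _)) !comp_assoc.
Qed.

Lemma mcomp_mid L M M' N (k : ModuleMap M M') :
  mcomp L M' N ∘ (idm (mh M' N) ⊠ mhm (idM L) k) =
  mcomp L M N ∘ (mhm k (idM N) ⊠ idm (mh L M)).
Proof.
apply: evl_inj; rewrite (bmap_l _ _ (mcomp L M' N)) (bmap_l _ _ (mcomp L M N)).
rewrite !comp_assoc !evl_mcomp !(post (asc_nat S _ _ _)) !comp_assoc.
rw (eq_sym (bmap_r (tens S) (mh M' N) (evl L M') (mhm (idM L) k ⊠ idm (mdl L)))).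
rewrite evl_post bmap_id.
rw (eq_sym (bmap_rl (tens S) (mhm k (idM N)) (evl L M))).
by rewrite [in RHS]bmap_lr comp_assoc evl_pre [in LHS]bmap_r !comp_assoc.
Qed.

Lemma mid_dinatural L L' (f : ModuleMap L' L) :
  mhm f (idM L) ∘ mid L = mhm (idM L') f ∘ mid L'.
Proof.
apply: evl_inj; rewrite (bmap_l _ _ (mhm f _)) (bmap_l _ _ (mhm (idM L') f)).
rewrite !comp_assoc evl_pre evl_post -!comp_assoc -bmap_rl bmap_lr.
by rewrite comp_assoc !evl_mid lun_nat.
Qed.

Definition tunit L (X : C) : Hom X (mh L (mod_tens L X)) :=
  mcur K E (idM (mod_tens L X)).

Lemma evl_tunit L (X : C) :
  evl L (mod_tens L X) ∘ (tunit L X ⊠ idm (mdl L)) = swp S X L.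
Proof. by rewrite evl_mcur comp_idl. Qed.

Lemma tunit_dinatural L L' (X X' : C) (f : ModuleMap L' L) (g : Hom X' X) :
  mhm f (idM (mod_tens L X)) ∘ tunit L X ∘ g =
  mhm (idM L') (mod_tens_map f g) ∘ tunit L' X'.
Proof.
apply: evl_inj; rewrite (bmap_l _ _ (mhm (idM L') _)) (bmap_l _ _ _ g).
rewrite (bmap_l _ _ (mhm f _)) !comp_assoc evl_pre evl_post.
rewrite -(comp_assoc (evl _ _)) -bmap_rl bmap_lr comp_assoc evl_tunit.
rewrite -!comp_assoc evl_tunit -bmap_rl /= -swp_nat.
by [].
Qed.

(** The enriched form of the adjunction, written as composition with the unit.
    In this form its enriched naturality is associativity of composition, and
    the same formula makes sense in the homotopy category. *)
Definition tensor_iso L (X : C) M : Hom (mh (mod_tens L X) M) (ihom K X (mh L M)) :=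
  curry K (mcomp L (mod_tens L X) M ∘ (idm _ ⊠ tunit L X)).

Lemma evl_tensor_iso L (X : C) M :
  evl L M ∘ ((ev K X (mh L M) ∘ (tensor_iso L X M ⊠ idm X)) ⊠ idm (mdl L)) =
  evl (mod_tens L X) M ∘ (idm _ ⊠ swp S X L) ∘ asc S _ X L.
Proof.
rewrite ev_curry (bmap_l _ _ (mcomp _ _ _)) comp_assoc evl_mcomp.
rewrite (post (asc_nat S _ _ _)) comp_assoc.
rw (eq_sym (bmap_r (tens S) (mh (mod_tens L X) M) (evl L _)
         (tunit L X ⊠ idm (mdl L)))).
by rewrite evl_tunit.
Qed.

Definition tensor_inv_map L (X : C) M :
  ModuleMap (mod_tens (mod_tens L X) (ihom K X (mh L M))) M :=
  ((mev K E L M : @Hom (Mod A) _ _) ∘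
   mod_tens_map (idM L) (ev K X (mh L M) ∘ swp S X (ihom K X (mh L M))) ∘
   mod_asc L X (ihom K X (mh L M)))%cat.

Lemma evl_tensor_inv L (X : C) M :
  evl (mod_tens L X) M ∘ (mcur K E (tensor_inv_map L X M) ⊠ idm (mdl (mod_tens L X))) =
  evl L M ∘ (ev K X (mh L M) ⊠ idm (mdl L)) ∘ ascV S _ X L ∘ (idm _ ⊠ swp S L X).
Proof.
rewrite evl_mcur /= bmap_r !comp_assoc.
rewrite (post (swp_nat S (idm (mdl L)) (ev K X (mh L M)))) !comp_assoc.
apply: swp_inj; rewrite swp1 -[RHS]comp_assoc -swp_nat.
by rewrite -reverse3 !comp_assoc asc2.
Qed.

Lemma tensor_iso_iso L (X : C) M : is_iso (tensor_iso L X M).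
Proof.
exists (mcur K E (tensor_inv_map L X M)); split.
- apply: evl_inj; rewrite (bmap_l _ _ (mcur _ _ _)) comp_assoc evl_tensor_inv.
  rw (eq_sym (bmap_rl (tens S) (tensor_iso L X M) (swp S L X))).
  rewrite (bmap_lr (tens S) (tensor_iso L X M)) !comp_assoc -(bmap_id (tens S) X L).
  rewrite (post (ascV_nat S _ _ _)) !comp_assoc.
  rw (eq_sym (bmap_l (tens S) (mdl L) (ev K X (mh L M)) (tensor_iso L X M ⊠ idm X))).
  by rewrite evl_tensor_iso asc2V swp2r bmap_id comp_idr.
- apply: curry_inj; apply: evl_inj; rewrite (bmap_l _ _ (tensor_iso _ _ _)) comp_assoc.
  rewrite (bmap_l _ _ _ (_ ⊠ idm X)) comp_assoc evl_tensor_iso.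
  rewrite (post (asc_nat S _ _ _)) comp_assoc.
  rewrite !bmap_id comp_idr.
  rw (eq_sym (bmap_rl (tens S) (mcur K E (tensor_inv_map L X M)) (swp S X L))).
  rewrite (bmap_lr (tens S) (mcur K E (tensor_inv_map L X M))) comp_assoc.
  by rewrite evl_tensor_inv swp2r asc2 ?bmap_l.
Qed.

Lemma mod_curry_act L (X : C) M (f : ModuleMap (mod_tens L X) M) :
  curry K (mmap f) ∘ act L =
  act (mod_ihom K X M) ∘ (idm (mon A) ⊠ curry K (mmap f)).
Proof.
apply: curry_inj; rewrite !bmap_l !comp_assoc ev_curry ev_ihom_act.
rewrite (post (asc_nat S _ _ _)) !comp_assoc.
rw (eq_sym (bmap_r (tens S) (mon A) (ev K X M) (curry K (mmap f) ⊠ idm X))).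
rewrite ev_curry -(mmap_act f) /= -!comp_assoc ascK.
by rewrite comp_idr.
Qed.

Definition mod_curry L (X : C) M (f : ModuleMap (mod_tens L X) M) :
  ModuleMap L (mod_ihom K X M) :=
  @Build_ModuleMap _ _ _ L (mod_ihom K X M) (curry K (mmap f)) (mod_curry_act f).

Lemma mod_ev_act (X : C) M :
  ev K X M ∘ act (mod_tens (mod_ihom K X M) X) =
  act M ∘ (idm (mon A) ⊠ ev K X M).
Proof. by rewrite /= comp_assoc ev_ihom_act asc2V. Qed.

Definition mod_ev (X : C) M : ModuleMap (mod_tens (mod_ihom K X M) X) M :=
  @Build_ModuleMap _ _ _ (mod_tens (mod_ihom K X M) X) M (ev K X M) (mod_ev_act X M).

(** The transpose of the evaluation [[X, M] ⊗ X -> M]. *)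
Definition ceval (X : C) M : Hom X (mh (mod_ihom K X M) M) :=
  mcur K E (mod_ev X M).

Lemma evl_ceval (X : C) M :
  evl (mod_ihom K X M) M ∘ (ceval X M ⊠ idm (mdl (mod_ihom K X M))) =
  ev K X M ∘ swp S X (ihom K X M).
Proof. exact: evl_mcur. Qed.

Lemma ceval_dinatural (X X' : C) M M' (g : Hom X' X) (f : ModuleMap M M') :
  mhm (idM (mod_ihom K X M)) f ∘ ceval X M ∘ g =
  mhm (mod_ihom_map K g f) (idM M') ∘ ceval X' M'.
Proof.
apply: evl_inj; rewrite (bmap_l _ _ _ g) (bmap_l _ _ _ (ceval _ _)).
rewrite (bmap_l _ _ _ (ceval X' _)).
rewrite !comp_assoc evl_pre evl_post.
rewrite -(comp_assoc (mmap f)) evl_ceval.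
rw (eq_sym (bmap_rl (tens S) (ceval X' M') (mmap (mod_ihom_map K g f)))).
rewrite [in RHS]bmap_lr comp_assoc evl_ceval.
rw (swp_nat S (idm X') (ihom_map K g (mmap f))).
rewrite ev_ihom_map -!comp_assoc -!swp_nat.
by [].
Qed.

Definition cotensor_iso L (X : C) M :
  Hom (mh L (mod_ihom K X M)) (ihom K X (mh L M)) :=
  curry K (mcomp L (mod_ihom K X M) M ∘ (ceval X M ⊠ idm _) ∘ swp S _ X).

Lemma evl_cotensor_iso L (X : C) M :
  evl L M ∘ ((ev K X (mh L M) ∘ (cotensor_iso L X M ⊠ idm X)) ⊠ idm (mdl L)) =
  ev K X M ∘ (evl L (mod_ihom K X M) ⊠ idm X) ∘ swp S X _ ∘ asc S X _ L
    ∘ (swp S _ X ⊠ idm (mdl L)).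
Proof.
rewrite ev_curry (bmap_l _ _ _ (swp S _ X)) (bmap_l _ _ (mcomp _ _ _)) !comp_assoc.
rewrite evl_mcomp (post (asc_nat S _ _ _)) !comp_assoc bmap_id.
rw (eq_sym (bmap_rl (tens S) (ceval X M) (evl L (mod_ihom K X M)))).
rewrite [in LHS]bmap_lr comp_assoc evl_ceval.
by rw (swp_nat S (idm X) (evl L (mod_ihom K X M))).
Qed.

Definition cotensor_inv_map L (X : C) M :
  ModuleMap (mod_tens L (ihom K X (mh L M))) (mod_ihom K X M) :=
  mod_curry ((mev K E L M : @Hom (Mod A) _ _) ∘
    mod_tens_map (idM L) (ev K X (mh L M)) ∘ mod_asc L (ihom K X (mh L M)) X)%cat.

Lemma ev_cotensor_inv L (X : C) M :
  ev K X M ∘ (mmap (cotensor_inv_map L X M) ⊠ idm X) =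
  evl L M ∘ (ev K X (mh L M) ⊠ idm (mdl L)) ∘ swp S L _ ∘ asc S L _ X.
Proof.
rewrite ev_curry /=.
by rewrite (post (swp_nat S (idm (mdl L)) (ev K X (mh L M)))) !comp_assoc.
Qed.

Lemma cotensor_iso_iso L (X : C) M : is_iso (cotensor_iso L X M).
Proof.
exists (mcur K E (cotensor_inv_map L X M)); split.
- apply: evl_inj; rewrite (bmap_l _ _ (mcur _ _ _)) comp_assoc.
  rewrite evl_mcur bmap_id comp_idr; apply: (curry_inj (K := K)).
  rewrite -comp_assoc swp_nat comp_assoc.
  rewrite 2!bmap_l !comp_assoc ev_cotensor_inv.
  rewrite (post (asc_nat S _ _ _)) !comp_assoc.
  rewrite (post (swp_nat S (idm (mdl L)) (cotensor_iso L X M ⊠ idm X))) !comp_assoc.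
  rw (eq_sym (bmap_l (tens S) (mdl L) (ev K X (mh L M)) (cotensor_iso L X M ⊠ idm X))).
  rewrite evl_cotensor_iso.
  have := reverse3_id S (mh L (mod_ihom K X M)) L X; rewrite -!comp_assoc => ->.
  by rewrite comp_idr.
- apply: curry_inj; apply: evl_inj.
  rewrite (bmap_l _ _ (cotensor_iso _ _ _)) comp_assoc bmap_l comp_assoc.
  rewrite evl_cotensor_iso.
  rw (eq_sym (bmap_l (tens S) (mdl L) (swp S (mh L (mod_ihom K X M)) X)
      (mcur K E (cotensor_inv_map L X M) ⊠ idm X))).
  rewrite swp_nat bmap_l comp_assoc (post (asc_nat S _ _ _)) comp_assoc.
  rewrite (post (swp_nat S (idm X) (mcur K E (cotensor_inv_map L X M) ⊠ idm (mdl L)))).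
  rewrite !comp_assoc.
  rw (eq_sym (bmap_l (tens S) X (evl L (mod_ihom K X M))
      (mcur K E (cotensor_inv_map L X M) ⊠ idm (mdl L)))).
  rewrite evl_mcur bmap_l comp_assoc ev_cotensor_inv.
  have := reverse3_id S (ihom K X (mh L M)) X L; rewrite -!comp_assoc => ->.
  by rewrite !comp_idr bmap_id comp_idr.
Qed.
End ModuleTensors.

(** * Homotopical properties of the module functors *)
Lemma pullback_exists (C : Category) (E : FiniteLimits C) (x y z : C)
    (f : Hom x z) (g : Hom y z) :
  exists (P : C) (p : Hom P x) (q : Hom P y), IsPullback f g p q.
Proof.
pose i := eqz_inc E (f ∘ prd_fst E x y) (g ∘ prd_snd E x y).
exists (eqz E (f ∘ prd_fst E x y) (g ∘ prd_snd E x y)),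
  (prd_fst E x y ∘ i), (prd_snd E x y ∘ i); split.
  by rewrite !comp_assoc /i eqz_incE.
move=> w u v e.
have k : f ∘ prd_fst E x y ∘ prd_pair E u v = g ∘ prd_snd E x y ∘ prd_pair E u v.
  by rewrite -!comp_assoc prd_fstE prd_sndE.
exists (eqz_lift E k); split.
  by rewrite -!comp_assoc /i eqz_liftE prd_fstE prd_sndE.
move=> h [h1 h2]; apply: (@eqz_mono _ E); rewrite eqz_liftE.
by apply: (@prd_uniq _ E); rewrite ?prd_fstE ?prd_sndE comp_assoc.
Qed.

Lemma pullback_ext (C : Category) (x y z P : C) (f : Hom x z) (g : Hom y z)
    (p : Hom P x) (q : Hom P y) (w : C) (h k : Hom w P) :
  IsPullback f g p q -> p ∘ h = p ∘ k -> q ∘ h = q ∘ k -> h = k.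
Proof.
move=> [e u] h1 h2.
have [l [_ hl]] := u w (p ∘ k) (q ∘ k) ltac:(by rewrite !comp_assoc e).
by rewrite -(hl h) // (hl k).
Qed.

Definition contra (C H : Category) (Phi : Functor (op C) H) : Functor C (op H).
Proof.
refine {| fobj := (Phi : C -> op H);
          fmap := fun x y f => fmap Phi (f : @Hom (op C) y x) |}.
- by move=> z; apply: (fmap_id Phi).
- by move=> a b c g k; apply: (fmap_comp Phi).
Defined.

Lemma ken_brown_contra (C H : Category) (Q : ModelStructure C)
    (Phi : Functor (op C) H) :
  (forall (x y : C) (f : Hom x y), cofibrant Q x -> cofibrant Q y ->
     cof Q f -> we Q f -> is_iso (fmap Phi (f : @Hom (op C) y x))) ->
  forall (x y : C) (f : Hom x y), cofibrant Q x -> cofibrant Q y ->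
     we Q f -> is_iso (fmap Phi (f : @Hom (op C) y x)).
Proof.
move=> hP x y f hx hy hf.
apply/iso_op; apply: (@ken_brown _ Q _ (contra Phi)) hf => // a b k ha hb hk wk.
by apply/iso_op; apply: hP.
Qed.

Section Enriched.
Context (M : MonoidalModelCategory).
Local Notation S := (mten M).
Local Notation K := (mclo M).
Local Notation P := (mmod M).
Local Notation "x ⊗ y" := (bob (tens S) x y) (at level 38, left associativity).
Local Notation "f ⊠ g" := (bmap (tens S) f g) (at level 38, left associativity).

Lemma ihom_term (x z : M) (t : M) (f g : Hom z (ihom K x t)) :
  (forall w (f g : Hom w t), f = g) -> f = g.
Proof. by move=> h; apply: curry_inj; apply: h. Qed.

Lemma ihom_init (x z : M) (f g : Hom z (ihom K (term (colims P)) x)) : f = g.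
Proof.
apply: curry_inj; apply: swp_inj.
set f' := _ ∘ swp _ _ _; set g' := _ ∘ swp _ _ _.
rewrite -(@ev_curry _ _ K _ _ _ f') -(@ev_curry _ _ K _ _ _ g'); congr (_ ∘ (_ ⊠ _)).
exact: eq_trans (@to_term_uniq _ (colims P) _ _)
  (eq_sym (@to_term_uniq _ (colims P) _ _)).
Qed.

Lemma term_ext (w : M) (f g : Hom w (term (lims P))) : f = g.
Proof. by rewrite (to_term_uniq f) (to_term_uniq g). Qed.

(** The enrichment axiom for the fibration [x -> 1], the function objects into
    the terminal object being terminal. *)
Lemma ihom_cof (k l x : M) (g : Hom k l) :
  cof P g -> fibrant P x ->
  fib P (ihom_map K g (idm x)) /\ (we P g -> we P (ihom_map K g (idm x))).
Proof.
move=> hg hx.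
pose h := to_term (lims P) x.
have te (z w : M) (f f' : Hom w (ihom K z (term (lims P)))) : f = f'.
  by apply: ihom_term => *; apply: term_ext.
have pb : IsPullback (ihom_map K (idm k) h) (ihom_map K g (idm (term (lims P))))
            (idm (ihom K k x)) (curry K (to_term (lims P) (ihom K k x ⊗ l))).
  split; first exact: te.
  move=> w u v _; exists u; split; first by rewrite comp_idl; split; last exact: te.
  by move=> u' []; rewrite comp_idl.
have [h1 h2] := enr_fib (u := ihom_map K g (idm x)) hg (hx : fib P h) pb
  (comp_idl _) (te _ _ _ _).
by split=> // hw; apply: h2; left.
Qed.

(** The enrichment axiom for the cofibration [∅ -> X], the function objects out
    of the initial object being terminal. *)
Lemma ihom_fib (X x y : M) (h : Hom x y) :
  cofibrant P X -> fib P h ->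
  fib P (ihom_map K (idm X) h) /\ (we P h -> we P (ihom_map K (idm X) h)).
Proof.
move=> hX hh.
pose g : @Hom M _ _ := to_term (colims P) X.
pose i0 := term (colims P).
have pb : IsPullback (ihom_map K (idm i0) h) (ihom_map K g (idm y))
    (curry K (ev K (ihom K X y) x ∘
       ((to_term (colims P) (ihom K (ihom K X y) x) : @Hom M i0 _) ⊠ idm _) ∘
       swp S _ i0))
    (idm (ihom K X y)).
  split; first exact: ihom_init.
  move=> w u v _; exists v; split; first by rewrite comp_idl; split; first exact: ihom_init.
  by move=> v' [_]; rewrite comp_idl.
have [h1 h2] := enr_fib (u := ihom_map K (idm X) h) hX hh pb
  (ihom_init _ _) (comp_idl _).
by split=> // hw; apply: h2; right.
Qed.

Context (A : Monoid S) (Q : ModelStructure (Mod A)).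
Context (fib_created : forall (X Y : Mod A) (f : Hom X Y),
           fib Q f <-> fib P (mmap f)).
Context (we_created : forall (X Y : Mod A) (f : Hom X Y),
           we Q f <-> we P (mmap f)).
Local Notation E := (lims P).
Local Notation idM L := (idm (L : Mod A)).
Local Notation mh := (mod_hom K E).
Local Notation mhm := (mod_hom_map K E).
Local Notation "g ∘m f" := (@comp (Mod A) _ _ _ g f)
  (at level 40, left associativity).

(** The action on the pullback is induced by those on [X] and [Y]; its laws hold
    because the projections are jointly monic. *)
Lemma module_pullback (X Y Z : Module A) (f : ModuleMap X Z) (g : ModuleMap Y Z) :
  exists (R : Module A) (p : ModuleMap R X) (q : ModuleMap R Y),
    IsPullback (mmap f) (mmap g) (mmap p) (mmap q).
Proof.
have [R [p [q pb]]] := pullback_exists E (mmap f) (mmap g).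
have [e u] := pb.
have sq : mmap f ∘ (act X ∘ (idm (mon A) ⊠ p)) = mmap g ∘ (act Y ∘ (idm (mon A) ⊠ q)).
  by rewrite !comp_assoc !mmap_act -!comp_assoc -!bmap_r e.
have [a [[ap aq] _]] := u _ _ _ sq.
have a1 : a ∘ (idm (mon A) ⊠ a) ∘ asc S A A R = a ∘ (mon_mul A ⊠ idm R).
{ apply: (pullback_ext pb); rewrite !comp_assoc ?ap ?aq.
  - rewrite -[_ ∘ (_ ⊠ p) ∘ (_ ⊠ a)]comp_assoc -bmap_r ap bmap_r !comp_assoc.
    rw (eq_sym (asc_nat S (idm (mon A)) (idm (mon A)) p)).
    by rewrite act_assoc bmap_id -!comp_assoc -bmap_rl -bmap_lr.
  - rewrite -[_ ∘ (_ ⊠ q) ∘ (_ ⊠ a)]comp_assoc -bmap_r aq bmap_r !comp_assoc.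
    rw (eq_sym (asc_nat S (idm (mon A)) (idm (mon A)) q)).
    by rewrite act_assoc bmap_id -!comp_assoc -bmap_rl -bmap_lr. }
have a2 : a ∘ (mon_one A ⊠ idm R) = lun S R.
  apply: (pullback_ext pb); rewrite !comp_assoc ?ap ?aq -comp_assoc -bmap_rl bmap_lr;
    by rewrite comp_assoc act_one lun_nat.
pose R' : Module A := Build_Module a1 a2.
by exists R', (@Build_ModuleMap _ _ _ R' X p ap), (@Build_ModuleMap _ _ _ R' Y q aq).
Qed.

Lemma module_pullback_lift (X Y Z R W : Module A) (f : ModuleMap X Z)
    (g : ModuleMap Y Z) (p : ModuleMap R X) (q : ModuleMap R Y)
    (u : ModuleMap W X) (v : ModuleMap W Y) :
  IsPullback (mmap f) (mmap g) (mmap p) (mmap q) -> f ∘m u = g ∘m v ->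
  exists h : ModuleMap W R, p ∘m h = u /\ q ∘m h = v.
Proof.
move=> pb e; have [_ U] := pb.
have [h [[hp hq] _]] := U _ (mmap u) (mmap v) (f_equal (@mmap _ _ _ _ _) e).
have ha : h ∘ act W = act R ∘ (idm (mon A) ⊠ h).
  apply: (pullback_ext pb); rewrite !comp_assoc ?hp ?hq !mmap_act;
    by rewrite -comp_assoc -bmap_r ?hp ?hq.
by exists (Build_ModuleMap ha); split; apply: mmap_eq.
Qed.

(** The terminal object of [M] carries a unique action of [A], and that module is
    isomorphic to any terminal module. *)
Lemma module_term (z : M) :
  exists f : Hom z (mdl (term (lims Q))), forall g, g = f.
Proof.
pose t := term (lims P).
have t1 : to_term (lims P) (mon A ⊗ t) ∘ (idm (mon A) ⊠ to_term (lims P) (mon A ⊗ t))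
    ∘ asc S A A t = to_term (lims P) (mon A ⊗ t) ∘ (mon_mul A ⊠ idm t).
  exact: term_ext.
have t2 : to_term (lims P) (mon A ⊗ t) ∘ (mon_one A ⊠ idm t) = lun S t.
  exact: term_ext.
pose T : Module A := Build_Module t1 t2.
pose s : ModuleMap T (term (lims Q)) := to_term (lims Q) T.
have ra : to_term (lims P) (mdl (term (lims Q))) ∘ act (term (lims Q)) =
          act T ∘ (idm (mon A) ⊠ to_term (lims P) (mdl (term (lims Q)))).
  exact: term_ext.
pose r : ModuleMap (term (lims Q)) T :=
  @Build_ModuleMap _ _ _ (term (lims Q)) T _ ra.
have e : mmap s ∘ mmap r = idm _.
  have e' : s ∘m r = idM _.
    exact: eq_trans (@to_term_uniq _ (lims Q) _ _) (eq_sym (@to_term_uniq _ (lims Q) _ _)).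
  exact: (f_equal (@mmap _ _ _ _ _) e').
exists (mmap s ∘ to_term (lims P) z) => g.
by rewrite -(comp_idl g) -e -comp_assoc (term_ext (mmap r ∘ g) (to_term (lims P) z)).
Qed.

Lemma fibrant_underlying (n : Module A) : fibrant Q n -> fibrant P n.
Proof.
move=> hn; apply: fibrant_of_extend => a b i u hi wi.
have hf : fib P (mmap (to_term (lims Q) n)) by apply/fib_created.
have [v _] := module_term b; have [w ew] := module_term a.
have sq : mmap (to_term (lims Q) n) ∘ u = v ∘ i.
  exact: eq_trans (ew _) (eq_sym (ew _)).
by have [h [h1 _]] := lift_tcof hi wi hf sq; exists h.
Qed.

(** By adjunction this lifts [m] against the map of modules from [[l, X]] to the
    pullback of [[k, X]] and [[l, Y]] over [[k, Y]].  Underneath it is the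
    corner map of the enrichment axiom, so it is a trivial fibration. *)
Lemma corner_lift (k l : M) (g : Hom k l) (m X Y : Module A)
    (h : ModuleMap X Y) (a : ModuleMap (mod_tens m k) X)
    (b : ModuleMap (mod_tens m l) Y) :
  cofibrant Q m -> cof P g -> fib Q (h : @Hom (Mod A) _ _) ->
  we P g \/ we Q (h : @Hom (Mod A) _ _) ->
  h ∘m a = b ∘m mod_tens_map (idM m) g ->
  exists c : ModuleMap (mod_tens m l) X,
    c ∘m mod_tens_map (idM m) g = a /\ h ∘m c = b.
Proof.
move=> hm hg hh hw e.
have [R [p [q pb]]] := module_pullback (mod_ihom_map K (idm k) h)
  (mod_ihom_map K g (idM Y)).
have [u [up uq]] : exists u : ModuleMap (mod_ihom K l X) R,
    p ∘m u = mod_ihom_map K g (idM X) /\ q ∘m u = mod_ihom_map K (idm l) h.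
  apply: module_pullback_lift pb _; apply: mmap_eq; rewrite /= -!ihom_map_comp.
  by rewrite !comp_idl !comp_idr.
have [fu wu] := enr_fib hg (iffLR (fib_created h) hh) pb (f_equal (@mmap _ _ _ _ _) up) (f_equal (@mmap _ _ _ _ _) uq).
have [v [vp vq]] : exists v : ModuleMap m R,
    p ∘m v = mod_curry K a /\ q ∘m v = mod_curry K b.
  apply: module_pullback_lift pb _; apply: mmap_eq; apply: (curry_inj (K := K)).
  rewrite /= !bmap_l !comp_assoc !ev_ihom_map bmap_id comp_idr -comp_assoc ev_curry.
  rewrite comp_idl -[RHS]comp_assoc -bmap_rl bmap_lr comp_assoc ev_curry.
  exact: (f_equal (@mmap _ _ _ _ _) e).
have [|w ew] := @cofibrant_lift (Mod A) Q m _ _ u v hm (iffRL (fib_created u) fu).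
  apply/we_created; apply: wu.
  by case: hw => hw; [left | right; apply/we_created].
exists ((mod_ev K l X : ModuleMap _ _) ∘m mod_tens_map w (idm l)).
have ue : mmap u ∘ mmap w = mmap v := f_equal (@mmap _ _ _ _ _) ew.
have wE : ihom_map K g (idm (mdl X)) ∘ mmap w = curry K (mmap a).
  have <- : mmap p ∘ mmap v = curry K (mmap a) := f_equal (@mmap _ _ _ _ _) vp.
  have <- : mmap p ∘ mmap u = ihom_map K g (idm (mdl X)) :=
    f_equal (@mmap _ _ _ _ _) up.
  by rewrite -ue comp_assoc.
have wE' : ihom_map K (idm l) (mmap h) ∘ mmap w = curry K (mmap b).
  have <- : mmap q ∘ mmap v = curry K (mmap b) := f_equal (@mmap _ _ _ _ _) vq.
  have <- : mmap q ∘ mmap u = ihom_map K (idm l) (mmap h) :=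
    f_equal (@mmap _ _ _ _ _) uq.
  by rewrite -ue comp_assoc.
split; apply: mmap_eq; rewrite /=.
- rewrite -comp_assoc -bmap_lr bmap_rl.
  have := f_equal (fun f => ev K k X ∘ (f ⊠ idm k)) wE.
  rewrite ev_curry bmap_l comp_assoc ev_ihom_map comp_idl -comp_assoc => ->.
  by [].
- have := f_equal (fun f => ev K l Y ∘ (f ⊠ idm l)) wE'.
  by rewrite ev_curry bmap_l comp_assoc ev_ihom_map bmap_id comp_idr -comp_assoc => ->.
Qed.

(** Transposed along the adjunction with [[X, -]], which preserves fibrations and
    trivial fibrations because [X] is cofibrant. *)
Lemma tens_cof (X : M) (L L' : Module A) (i : ModuleMap L L') :
  cofibrant P X -> cof Q (i : @Hom (Mod A) _ _) ->
  let j : @Hom (Mod A) _ _ := mod_tens_map i (idm X) in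
  cof Q j /\ (we Q (i : @Hom (Mod A) _ _) -> we Q j).
Proof.
move=> hX hi j.
have key (a b : Module A) (p : ModuleMap a b) :
  @Lifts (Mod A) _ _ _ _ i (mod_ihom_map K (idm X) p) -> @Lifts (Mod A) _ _ _ _ j p.
{ move=> hl u v e.
  have [|h [h1 h2]] := hl (mod_curry K u) (mod_curry K v).
    apply: mmap_eq; apply: (curry_inj (K := K)).
    change (ev K X b ∘ ((ihom_map K (idm X) (mmap p) ∘ curry K (mmap u)) ⊠ idm X) =
            ev K X b ∘ ((curry K (mmap v) ∘ mmap i) ⊠ idm X)).
    rewrite !bmap_l !comp_assoc ev_ihom_map bmap_id comp_idr -comp_assoc !ev_curry.
    exact: (f_equal (@mmap _ _ _ _ _) e).
  exists (mod_ev K X a ∘m mod_tens_map h (idm X)); split; apply: mmap_eq.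
  - have e1 : mmap h ∘ mmap i = curry K (mmap u) := f_equal (@mmap _ _ _ _ _) h1.
    by rewrite /= -comp_assoc -bmap_l e1 ev_curry.
  - have e2 : ihom_map K (idm X) (mmap p) ∘ mmap h = curry K (mmap v) :=
      f_equal (@mmap _ _ _ _ _) h2.
    rewrite /= -(ev_curry K (mmap v)) -e2 bmap_l [RHS]comp_assoc ev_ihom_map bmap_id.
    by rewrite comp_idr comp_assoc. }
have fibX (a b : Module A) (p : ModuleMap a b) : fib Q (p : @Hom (Mod A) _ _) ->
    fib Q (mod_ihom_map K (idm X) p : @Hom (Mod A) _ _) /\
    (we Q (p : @Hom (Mod A) _ _) -> we Q (mod_ihom_map K (idm X) p : @Hom (Mod A) _ _)).
  move=> /fib_created hp; have [h1 h2] := ihom_fib hX hp.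
  split; first by apply/fib_created.
  by move=> /we_created hw; apply/we_created; apply: h2.
split.
- apply: cof_of_lift => a b p hp hw; apply: key; have [h1 h2] := fibX _ _ _ hp.
  exact: lift_cof hi h1 (h2 hw).
- move=> wi; apply: (proj2 (tcof_of_lift (Q := Q) _)) => a b p hp; apply: key.
  exact: lift_tcof hi wi (proj1 (fibX _ _ _ hp)).
Qed.

Lemma tens_cof_r (m : Module A) (k l : M) (g : Hom k l) :
  cofibrant Q m -> cof P g ->
  let j : @Hom (Mod A) _ _ := mod_tens_map (idM m) g in
  cof Q j /\ (we P g -> we Q j).
Proof.
move=> hm hg j; split.
- apply: cof_of_lift => a b p hp hw u v e.
  by have [c hc] := corner_lift hm hg hp (or_intror hw) e; exists c.
- move=> wg; apply: (proj2 (tcof_of_lift (Q := Q) _)) => a b p hp u v e.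
  by have [c hc] := corner_lift hm hg hp (or_introl wg) e; exists c.
Qed.

Lemma tens_cofibrant (m : Module A) (X : M) :
  cofibrant Q m -> cofibrant P X -> cofibrant Q (mod_tens m X).
Proof.
move=> hm hX; apply: cofibrant_of_lift => a b p v hp hw.
have [h1 h2] := ihom_fib hX (iffLR (fib_created p) hp).
have [h e] : exists h : ModuleMap m (mod_ihom K X a),
    mod_ihom_map K (idm X) p ∘m h = mod_curry K v.
  apply: (@cofibrant_lift (Mod A) Q) => //; first by apply/fib_created.
  by apply/we_created; apply: h2; apply/we_created.
exists (mod_ev K X a ∘m mod_tens_map h (idm X)); apply: mmap_eq.
have e2 : ihom_map K (idm X) (mmap p) ∘ mmap h = curry K (mmap v) :=
  f_equal (@mmap _ _ _ _ _) e.
rewrite /= -(ev_curry K (mmap v)) -e2 bmap_l [RHS]comp_assoc ev_ihom_map bmap_id.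
by rewrite comp_idr comp_assoc.
Qed.

Lemma hom_fib (m a b : Module A) (p : ModuleMap a b) :
  cofibrant Q m -> fib Q (p : @Hom (Mod A) _ _) ->
  fib P (mhm (idM m) p) /\
  (we Q (p : @Hom (Mod A) _ _) -> we P (mhm (idM m) p)).
Proof.
move=> hm hp.
have key (k l : M) (i : Hom k l) : cof P i ->
    we P i \/ we Q (p : @Hom (Mod A) _ _) -> Lifts i (mhm (idM m) p).
{ move=> hi hw u v e.
  have [|c [c1 c2]] := @corner_lift k l i m a b p
    (mev K E m a ∘m mod_tens_map (idM m) u) (mev K E m b ∘m mod_tens_map (idM m) v)
    hm hi hp hw.
    apply: mmap_eq.
    change (mmap p ∘ (mmap (mev K E m a) ∘ (idm (mdl m) ⊠ u)) =
      mmap (mev K E m b) ∘ (idm (mdl m) ⊠ v) ∘ (idm (mdl m) ⊠ i)).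
    by rewrite comp_assoc -mev_post -!comp_assoc -!bmap_r e.
  exists (mcur K E c); split; apply: mev_inj; rewrite bmap_r comp_assoc ?mev_mcur.
  - exact: (f_equal (@mmap _ _ _ _ _) c1).
  - by rewrite mev_post -comp_assoc mev_mcur; exact: (f_equal (@mmap _ _ _ _ _) c2). }
split; first by apply: fib_of_lift => k l i hi wi; apply: key => //; left.
move=> hw; apply: (proj2 (tfib_of_lift (Q := P) _)) => k l i hi.
by apply: key => //; right.
Qed.

(** A lifting problem for [mh L' n -> mh L n] against a cofibration [g : k -> l]
    transposes to one for [L -> L'] against [[l, n] -> [k, n]], which is a
    fibration since [n] is fibrant. *)
Lemma hom_cof (n L L' : Module A) (i : ModuleMap L L') :
  fibrant Q n -> cof Q (i : @Hom (Mod A) _ _) -> we Q (i : @Hom (Mod A) _ _) ->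
  we P (mhm i (idM n)).
Proof.
move=> hn hi wi; apply: (proj2 (tfib_of_lift (Q := P) _)) => k l g hg u v e.
pose u' := mod_curry K (mev K E L' n ∘m mod_tens_map (idM L') u).
pose v' := mod_curry K (mev K E L n ∘m mod_tens_map (idM L) v).
have uE : ev K k n ∘ (mmap u' ⊠ idm k) = mmap (mev K E L' n) ∘ (idm (mdl L') ⊠ u).
  exact: ev_curry.
have vE : ev K l n ∘ (mmap v' ⊠ idm l) = mmap (mev K E L n) ∘ (idm (mdl L) ⊠ v).
  exact: ev_curry.
have sq : mod_ihom_map K g (idM n) ∘m v' = u' ∘m i.
  apply: mmap_eq; apply: (curry_inj (K := K)).
  change (ev K k n ∘ ((ihom_map K g (idm (mdl n)) ∘ mmap v') ⊠ idm k) =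
          ev K k n ∘ ((mmap u' ∘ mmap i) ⊠ idm k)).
  rewrite !bmap_l !comp_assoc ev_ihom_map uE comp_idl -!comp_assoc -bmap_rl bmap_lr.
  rewrite comp_assoc vE -comp_assoc -bmap_r -e bmap_r [LHS]comp_assoc mev_pre -!comp_assoc.
  by rewrite -bmap_lr -bmap_rl.
have hf : fib Q (mod_ihom_map K g (idM n) : @Hom (Mod A) _ _).
  by apply/fib_created; apply: (proj1 (ihom_cof hg (fibrant_underlying hn))).
have [h [h1 h2]] := lift_tcof hi wi hf sq.
have e1 : mmap h ∘ mmap i = mmap v' := f_equal (@mmap _ _ _ _ _) h1.
have e2 : ihom_map K g (idm (mdl n)) ∘ mmap h = mmap u' := f_equal (@mmap _ _ _ _ _) h2.
exists (mcur K E (mod_ev K l n ∘m mod_tens_map h (idm l))).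
split; apply: mev_inj; rewrite bmap_r comp_assoc.
- rewrite mev_mcur -uE -e2 bmap_l [RHS]comp_assoc ev_ihom_map comp_idl /=.
  by rewrite -!comp_assoc -bmap_lr -bmap_rl.
- rewrite mev_pre -comp_assoc -bmap_lr bmap_rl comp_assoc mev_mcur -vE -e1 bmap_l.
  by rewrite /= comp_assoc.
Qed.

Lemma hom_fibrant (m n : Module A) :
  cofibrant Q m -> fibrant Q n -> fibrant P (mh m n).
Proof.
move=> hm hn; apply: fibrant_of_extend => a b i u hi wi.
have [h1 h2] := tens_cof_r hm hi.
have [c e] := @fibrant_extend (Mod A) Q n _ _ (mod_tens_map (idM m) i)
  (mev K E m n ∘m mod_tens_map (idM m) u) hn h1 (h2 wi).
exists (mcur K E c); apply: mev_inj; rewrite bmap_r comp_assoc mev_mcur.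
exact: (f_equal (@mmap _ _ _ _ _) e).
Qed.

Lemma ihom_fibrant (X : M) (n : Module A) :
  cofibrant P X -> fibrant Q n -> fibrant Q (mod_ihom K X n).
Proof.
move=> hX hn; apply: fibrant_of_extend => a b i u hi wi.
have [h1 h2] := tens_cof hX hi.
have [c e] := @fibrant_extend (Mod A) Q n _ _ (mod_tens_map i (idm X))
  (mod_ev K X n ∘m mod_tens_map u (idm X)) hn h1 (h2 wi).
exists (mod_curry K c); apply: mmap_eq; apply: (curry_inj (K := K)).
rewrite /= bmap_l comp_assoc ev_curry.
exact: (f_equal (@mmap _ _ _ _ _) e).
Qed.

Lemma tensor_preserves :
  preserves_good_we (model_replacement Q) (model_replacement P)
    (compF (gamma Q) (mod_tensF A)).
Proof.
move=> x x' y y' f g hx hx' hy hy' hf hg; rewrite bmap_lr; apply: iso_comp.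
- apply: (@ken_brown _ Q _ (slice_l (compF (gamma Q) (mod_tensF A)) y')) hf => //.
  move=> a b i _ _ hi wi; apply: (gamma_iso (Q := Q)).
  exact: (proj2 (tens_cof hy' hi) wi).
- apply: (@ken_brown _ P _ (slice_r (compF (gamma Q) (mod_tensF A)) x)) hg => //.
  move=> a b i _ _ hi wi; apply: (gamma_iso (Q := Q)).
  exact: (proj2 (tens_cof_r hx hi) wi).
Qed.

Lemma hom_preserves (x x' : Mod A) (y y' : Mod A) (f : Hom x' x) (g : Hom y y') :
  cofibrant Q x -> cofibrant Q x' -> fibrant Q y -> fibrant Q y' ->
  we Q f -> we Q g ->
  is_iso (bmap (compF (gamma P) (mod_homF K A E)) (f : @Hom (op (Mod A)) x x') g).
Proof.
move=> hx hx' hy hy' hf hg; rewrite bmap_lr; apply: iso_comp.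
- apply: (@ken_brown_contra _ _ Q (slice_l (compF (gamma P) (mod_homF K A E)) y')) hf => //.
  move=> a b i _ _ hi wi; apply: (gamma_iso (Q := P)).
  exact: hom_cof.
- apply: (@ken_brown_fibrant _ Q _
    (slice_r (compF (gamma P) (mod_homF K A E)) (x : op (Mod A)))) hg => //.
  move=> a b i _ _ hi wi; apply: (gamma_iso (Q := P)).
  exact: (proj2 (hom_fib hx hi) wi).
Qed.

Lemma cotensor_preserves (x x' : M) (y y' : Mod A) (f : Hom x' x) (g : Hom y y') :
  cofibrant P x -> cofibrant P x' -> fibrant Q y -> fibrant Q y' ->
  we P f -> we Q g ->
  is_iso (bmap (compF (gamma Q) (mod_ihomF K A)) (f : @Hom (op M) x x') g).
Proof.
move=> hx hx' hy hy' hf hg; rewrite bmap_lr; apply: iso_comp.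
- apply: (@ken_brown_contra _ _ P (slice_l (compF (gamma Q) (mod_ihomF K A)) y')) hf => //.
  move=> a b i _ _ hi wi; apply: (gamma_iso (Q := Q)); apply/we_created.
  exact: (proj2 (ihom_cof hi (fibrant_underlying hy')) wi).
- apply: (@ken_brown_fibrant _ Q _
    (slice_r (compF (gamma Q) (mod_ihomF K A)) (x : op M))) hg => //.
  move=> a b i _ _ hi wi; apply: (gamma_iso (Q := Q)); apply/we_created.
  by apply: (proj2 (ihom_fib hx _)); [apply/fib_created | apply/we_created].
Qed.

Lemma ihom_preserves (x x' : M) (y y' : M) (f : Hom x' x) (g : Hom y y') :
  cofibrant P x -> cofibrant P x' -> fibrant P y -> fibrant P y' ->
  we P f -> we P g ->
  is_iso (bmap (compF (gamma P) (ihomF K)) (f : @Hom (op M) x x') g).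
Proof.
move=> hx hx' hy hy' hf hg; rewrite bmap_lr; apply: iso_comp.
- apply: (@ken_brown_contra _ _ P (slice_l (compF (gamma P) (ihomF K)) y')) hf => //.
  move=> a b i _ _ hi wi; apply: (gamma_iso (Q := P)).
  exact: (proj2 (ihom_cof hi hy') wi).
- apply: (@ken_brown_fibrant _ P _
    (slice_r (compF (gamma P) (ihomF K)) (x : op M))) hg => //.
  move=> a b i _ _ hi wi; apply: (gamma_iso (Q := P)).
  exact: (proj2 (ihom_fib hx hi) wi).
Qed.
End Enriched.

(** * Enriched categories *)
Section EnrichedGeneral.
Context {V : Category} {S : SymMonoidal V}.
Local Notation "x ⊗ y" := (bob (tens S) x y) (at level 38, left associativity).
Local Notation "f ⊠ g" := (bmap (tens S) f g) (at level 38, left associativity).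
Local Notation bc := (bmap_comp (tens S)).

Lemma enriched_transport (O : Type) (H0 H1 : O -> O -> V)
    (E0 : EnrichedCategory S H0) (rho : forall x y, Hom (H0 x y) (H1 x y)) :
  (forall x y, is_iso (rho x y)) ->
  exists E1 : EnrichedCategory S H1,
    (forall x y z, ecomp E1 x y z ∘ (rho y z ⊠ rho x y) = rho x z ∘ ecomp E0 x y z) /\
    (forall x, eid E1 x = rho x x ∘ eid E0 x).
Proof.
move=> hr.
pose c x y z := rho x z ∘ ecomp E0 x y z ∘ (inv (hr y z) ⊠ inv (hr x y)).
have cE x y z : c x y z ∘ (rho y z ⊠ rho x y) = rho x z ∘ ecomp E0 x y z.
  by rewrite /c -comp_assoc -bc !inv_l bmap_id comp_idr.
move: c cE => c cE.
have c1 w x y z : c w x z ∘ (c x y z ⊠ idm (H1 w x)) =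
    c w y z ∘ (idm (H1 y z) ⊠ c w x y) ∘ asc S (H1 y z) (H1 x y) (H1 w x).
{ have i : is_iso (rho y z ⊠ rho x y ⊠ rho w x) by do 2 apply: iso_bmap => //.
  apply: (iso_epi i); rewrite -!comp_assoc asc_nat !comp_assoc.
  rewrite -[_ ∘ (c x y z ⊠ _) ∘ _]comp_assoc -bc cE comp_idl.
  rewrite -[_ ∘ (_ ⊠ c w x y) ∘ _]comp_assoc -bc cE comp_idl.
  rewrite -(comp_idr (rho w x)) -(comp_idr (rho y z)) !bc !comp_assoc !cE.
  by rewrite -!comp_assoc [X in _ ∘ X = _]ecomp_assoc !comp_assoc. }
have c2 x y : c x y y ∘ ((rho y y ∘ eid E0 y) ⊠ idm (H1 x y)) = lun S (H1 x y).
{ have i : is_iso (idm (unit S) ⊠ rho x y) by apply: iso_bmap => //; apply: iso_id.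
  apply: (iso_epi i); rewrite -comp_assoc -bc comp_idr comp_idl.
  rewrite -[rho x y in LHS]comp_idr bc comp_assoc cE -comp_assoc ecomp_idl.
  by rewrite lun_nat. }
have c3 x y : c x x y ∘ (idm (H1 x y) ⊠ (rho x x ∘ eid E0 x)) = run S (H1 x y).
{ have i : is_iso (rho x y ⊠ idm (unit S)) by apply: iso_bmap => //; apply: iso_id.
  apply: (iso_epi i); rewrite -comp_assoc -bc comp_idr comp_idl.
  rewrite -[rho x y in LHS]comp_idr bc comp_assoc cE -comp_assoc ecomp_idr.
  by rewrite run_nat. }
by exists {| ecomp := c; eid := fun x => rho x x ∘ eid E0 x; ecomp_assoc := c1;
             ecomp_idl := c2; ecomp_idr := c3 |}.
Qed.

Context (K : Closed S) {C : Category} {H : Functor (prodC (op C) C) V}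
  (E : Enrichment S H).
Local Notation "'H[' x , y ]" := (bob H (x : op C) y).

(** Naturality of the transformation [H[y, -] -> [X, H[c, -]]] induced by a map
    [u : X -> H[c, y]], which is associativity of composition. *)
Lemma ihom_post_ecomp (X : V) (c y d d' : C) (u : Hom X H[c, y]) :
  curry K (ecomp E c y d' ∘ (idm _ ⊠ u)) ∘ ecomp E y d d' =
  ihom_post K E X c d d' ∘ (idm _ ⊠ curry K (ecomp E c y d ∘ (idm _ ⊠ u))).
Proof.
apply: curry_inj.
rewrite (bmap_l (tens S) _ (curry K _)) (bmap_l (tens S) _ (ihom_post _ _ _ _ _ _)).
rewrite !comp_assoc !ev_curry -!comp_assoc asc_nat !comp_assoc.
rewrite -[_ ∘ _ ∘ (_ ⊠ (curry _ _ ⊠ _))]comp_assoc -bmap_r ev_curry.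
rewrite bmap_r comp_assoc -[LHS]comp_assoc -bmap_rl bmap_lr comp_assoc.
by rewrite ecomp_assoc -(bmap_id (tens S)) -!comp_assoc asc_nat.
Qed.

(** The same for [H[-, y] -> [X, H[-, c]]], where the hexagon also enters since
    [X] has to be moved past a mapping object. *)
Lemma ihom_pre_ecomp (X : V) (c y d d' : C) (v : Hom X H[y, c]) :
  curry K (ecomp E d' y c ∘ (v ⊠ idm _) ∘ swp S _ X) ∘ ecomp E d' d y =
  ihom_pre K E X c d d' ∘
    (curry K (ecomp E d y c ∘ (v ⊠ idm _) ∘ swp S _ X) ⊠ idm H[d', d]).
Proof.
apply: curry_inj.
rewrite (bmap_l (tens S) _ (curry K _)) (bmap_l (tens S) _ (ihom_pre _ _ _ _ _ _)).
rewrite !comp_assoc !ev_curry.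
rewrite -[LHS]comp_assoc swp_nat.
rewrite -[RHS]comp_assoc asc_nat [RHS]comp_assoc bmap_id.
rw (eq_sym (bmap_rl (tens S)
  (curry K (ecomp E d y c ∘ (v ⊠ idm H[d, y]) ∘ swp S _ X)) (swp S H[d', d] X))).
rewrite (bmap_lr (tens S) (curry K _)) !comp_assoc -(bmap_id (tens S) X H[d', d]).
rewrite (post (ascV_nat S _ _ _)) !comp_assoc.
rewrite -[_ ∘ _ ∘ ((curry K _ ⊠ _) ⊠ _)]comp_assoc -bmap_l ev_curry.
rewrite (bmap_l _ _ _ (swp S _ _)) (bmap_l _ _ (ecomp _ _ _ _)) !comp_assoc.
rewrite ecomp_assoc (post (asc_nat S _ _ _)) !comp_assoc !bmap_id.
rewrite -(hexagonV S H[d', d] H[d, y] X) !comp_assoc.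
have e : (v ⊠ idm H[d', y]) ∘ (idm X ⊠ ecomp E d' d y) =
         (idm H[y, c] ⊠ ecomp E d' d y) ∘ (v ⊠ idm _) by rewrite -bmap_lr -bmap_rl.
by rw e.
Qed.
End EnrichedGeneral.

(** * The lax monoidal functor to the homotopy category *)
Section DerivedMonoidal.
Context {M : MonoidalModelCategory} (D : DerivedStructure M).
Local Notation S := (mten M).
Local Notation K := (mclo M).
Local Notation P := (mmod M).
Local Notation dS := (dten D).
Local Notation dK := (dclo D).
Local Notation V := (Ho P).
Local Notation gM := (fmap (gamma P)).
Local Notation "x ⊗ y" := (bob (tens S) x y) (at level 38, left associativity).
Local Notation "f ⊠ g" := (bmap (tens S) f g) (at level 38, left associativity).
Local Notation "x ⊛ y" := (bob (tens dS) x y) (at level 38, left associativity).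
Local Notation "f ⊡ g" := (bmap (tens dS) f g) (at level 38, left associativity).

Definition dmul (x y : M) : @Hom V (gamma P x ⊛ gamma P y) (gamma P (x ⊗ y)) :=
  deps D (x, y).

Definition dhom (x y : M) :
  @Hom V (gamma P (ihom K x y)) (ihom dK (gamma P x) (gamma P y)) := deta D (x, y).

Lemma dmul_nat (x x' y y' : M) (f : Hom x x') (g : Hom y y') :
  dmul x' y' ∘ (gM f ⊡ gM g) = gM (f ⊠ g) ∘ dmul x y.
Proof.
have := @nt_nat _ _ _ _ (deps D) (x, y) (x', y') (f, g).
rewrite -[fmap (compF _ (loc _)) _]/(fmap (tens dS) (fmap (loc_prod _ _)
  (fmap (loc (prodW (we P) (we P))) ((f, g) : @Hom (prodC M M) (x, y) (x', y'))))).
by rewrite loc_prodE.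
Qed.

Lemma dmul_asc (x y z : M) :
  gM (asc S x y z) ∘ dmul (x ⊗ y) z ∘ (dmul x y ⊡ idm (gamma P z)) =
  dmul x (y ⊗ z) ∘ (idm (gamma P x) ⊡ dmul y z)
    ∘ asc dS (gamma P x) (gamma P y) (gamma P z).
Proof. exact: (deps_asc D). Qed.

Lemma dmul_lun (x : M) :
  gM (lun S x) ∘ dmul (unit S) x ∘ (dunit D ⊡ idm (gamma P x)) =
  lun dS (gamma P x).
Proof. exact: (deps_lun D). Qed.

Lemma dmul_run (x : M) :
  gM (run S x) ∘ dmul x (unit S) ∘ (idm (gamma P x) ⊡ dunit D) =
  run dS (gamma P x).
Proof. exact: (deps_run D). Qed.

Lemma dmul_swp (x y : M) :
  gM (swp S x y) ∘ dmul x y = dmul y x ∘ swp dS (gamma P x) (gamma P y).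
Proof. exact: (deps_swp D). Qed.

Lemma dhom_ev (x y : M) :
  ev dK (gamma P x) (gamma P y) ∘ (dhom x y ⊡ idm (gamma P x)) =
  gM (ev K x y) ∘ dmul (ihom K x y) x.
Proof. exact: (deta_ev D). Qed.

(** A lax monoidal functor takes enriched categories to enriched categories. *)
Definition base_change (O : Type) (H : O -> O -> M) (E : EnrichedCategory S H) :
  EnrichedCategory dS (fun x y => gamma P (H x y)).
Proof.
refine {| ecomp := fun x y z => gM (ecomp E x y z) ∘ dmul (H y z) (H x y);
          eid := fun x => gM (eid E x) ∘ dunit D |}.
- move=> w x y z; rewrite bmap_l bmap_r !comp_assoc.
  rewrite -(fmap_id (gamma P) (H w x)) -(fmap_id (gamma P) (H y z)).
  rewrite !(post (dmul_nat _ _)) !comp_assoc -!(fmap_comp (gamma P)) ecomp_assoc.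
  rewrite (fmap_comp (gamma P)) !(fmap_id (gamma P)) -!comp_assoc; congr (_ ∘ _).
  by rewrite !comp_assoc dmul_asc.
- move=> x y; rewrite bmap_l comp_assoc -(fmap_id (gamma P) (H x y)).
  rewrite (post (dmul_nat _ _)) comp_assoc -(fmap_comp (gamma P)) ecomp_idl.
  by rewrite (fmap_id (gamma P)) dmul_lun.
- move=> x y; rewrite bmap_r comp_assoc -(fmap_id (gamma P) (H x y)).
  rewrite (post (dmul_nat _ _)) comp_assoc -(fmap_comp (gamma P)) ecomp_idr.
  by rewrite (fmap_id (gamma P)) dmul_run.
Defined.

(** Compatibility of [deps] and [deta] with evaluation, read as a comparison
    between transposition before and after localization. *)
Lemma dhom_curry (W X Z : M) (h : Hom W (ihom K X Z)) (X' z : V)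
    (b : Hom X' (gamma P X)) (rho : Hom (gamma P Z) z) :
  curry dK (rho ∘ gM (ev K X Z ∘ (h ⊠ idm X)) ∘ dmul W X ∘ (idm _ ⊡ b)) =
  ihom_map dK b rho ∘ dhom X Z ∘ gM h.
Proof.
apply: curry_inj; rewrite ev_curry (bmap_l _ _ _ (gM h)) (bmap_l _ _ (ihom_map _ _ _)).
rewrite !comp_assoc ev_ihom_map.
rw (eq_sym (bmap_rl (tens dS) (dhom X Z) b)).
rewrite (bmap_lr (tens dS) (dhom X Z) b); rw (dhom_ev X Z).
rw (eq_sym (bmap_rl (tens dS) (gM h) b)); rewrite (bmap_lr (tens dS) (gM h) b).
rewrite !comp_assoc -(fmap_id (gamma P) X) (post (dmul_nat h (idm X))).
by rewrite (fmap_comp (gamma P)) !comp_assoc.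
Qed.

(** [deta] is only known through its universal property; it is invertible here
    because the explicit derived functor has this property. *)
Lemma dhom_iso (X Z : M) : cofibrant P X -> fibrant P Z -> is_iso (dhom X Z).
Proof.
move=> hX hZ.
have [R [r hr]] := right_derived_bi_exists (V := model_replacement P)
  (V' := fibrant_replacement P) (@ihom_preserves M).
have d := right_derived_bi hr.
exact: (right_derived_iso d (@deta_derived _ D) (hr _ _ hX hZ)).
Qed.
End DerivedMonoidal.

(** * The homotopy category of a tensored model category *)
(** Hides the opposite category in the type of the first map. *)
Definition cmap (C D H : Category) (R : Functor (prodC (op C) D) H) (x x' : C)
    (y y' : D) (f : Hom x' x) (g : Hom y y') :
  Hom (bob R (x : op C) y) (bob R (x' : op C) y') :=
  bmap R (f : @Hom (op C) x x') g.

Lemma cmap_id (C D H : Category) (R : Functor (prodC (op C) D) H) (x : C) (y : D) :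
  cmap R (idm x) (idm y) = idm (bob R (x : op C) y).
Proof. exact: (bmap_id R (x : op C) y). Qed.

Lemma cmap_comp (C D H : Category) (R : Functor (prodC (op C) D) H)
    (x x' x'' : C) (y y' y'' : D) (f : Hom x' x) (f' : Hom x'' x')
    (g : Hom y y') (g' : Hom y' y'') :
  cmap R (f ∘ f') (g' ∘ g) = cmap R f' g' ∘ cmap R f g.
Proof.
exact: (@bmap_comp _ _ _ R _ _ _ _ _ _ (f' : @Hom (op C) x' x'')
          (f : @Hom (op C) x x') g' g).
Qed.

Lemma iso_cmap (C D H : Category) (R : Functor (prodC (op C) D) H)
    (x x' : C) (y y' : D) (f : Hom x' x) (g : Hom y y') :
  is_iso f -> is_iso g -> is_iso (cmap R f g).
Proof. by move=> hf hg; apply: iso_bmap => //; apply/iso_op. Qed.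

(** Components are restated with values of the functors of two variables in
    place of composites with localization functors. *)
Definition rcomp (C D H : Category) (W : MorphismClass C)
    (W' : MorphismClass D) (Phi : Functor (prodC (op C) D) H)
    (R : Functor (prodC (op (Loc W)) (Loc W')) H)
    (r : NatTrans Phi (compF (compF R (loc_op_prod W W')) (loc (prodW (opW W) W'))))
    (x : C) (y : D) :
  Hom (bob Phi (x : op C) y) (bob R (x : op (Loc W)) (y : Loc W')) := r (x, y).

Definition lcomp (C D H : Category) (W : MorphismClass C)
    (W' : MorphismClass D) (Phi : Functor (prodC C D) H)
    (L : Functor (prodC (Loc W) (Loc W')) H)
    (e : NatTrans (compF (compF L (loc_prod W W')) (loc (prodW W W'))) Phi)
    (x : C) (y : D) :
  Hom (bob L (x : Loc W) (y : Loc W')) (bob Phi x y) := e (x, y).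

Lemma right_derived_nat (C D H : Category) (W : MorphismClass C)
    (W' : MorphismClass D) (Phi : Functor (prodC (op C) D) H)
    (R : Functor (prodC (op (Loc W)) (Loc W')) H)
    (r : NatTrans Phi (compF (compF R (loc_op_prod W W')) (loc (prodW (opW W) W'))))
    (x x' : C) (y y' : D) (f : Hom x' x) (g : Hom y y') :
  rcomp r x' y' ∘ cmap Phi f g =
  cmap R (fmap (loc W) f) (fmap (loc W') g) ∘ rcomp r x y.
Proof.
apply: eq_trans (@nt_nat _ _ _ _ r (x, y) (x', y') ((f : @Hom (op C) x x'), g)) _.
refine (f_equal (fun k : Hom (bob R (x : op (Loc W)) (y : Loc W'))
  (bob R (x' : op (Loc W)) (y' : Loc W')) => k ∘ r (x, y)) _).
exact (f_equal (@fmap _ _ R (x, y) (x', y'))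
   (@loc_op_prodE _ _ W W' (x, y) (x', y') ((f : @Hom (op C) x x'), g))).
Qed.

Lemma left_derived_nat (C D H : Category) (W : MorphismClass C)
    (W' : MorphismClass D) (Phi : Functor (prodC C D) H)
    (L : Functor (prodC (Loc W) (Loc W')) H)
    (e : NatTrans (compF (compF L (loc_prod W W')) (loc (prodW W W'))) Phi)
    (x x' : C) (y y' : D) (f : Hom x x') (g : Hom y y') :
  lcomp e x' y' ∘ bmap L (fmap (loc W) f) (fmap (loc W') g) =
  bmap Phi f g ∘ lcomp e x y.
Proof.
apply: eq_trans _ (@nt_nat _ _ _ _ e (x, y) (x', y') (f, g)).
refine (f_equal (fun k : Hom (bob L (x : Loc W) (y : Loc W'))
  (bob L (x' : Loc W) (y' : Loc W')) => e (x', y') ∘ k) _).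
exact (f_equal (@fmap _ _ L (x, y) (x', y'))
   (eq_sym (@loc_prodE _ _ W W' (x, y) (x', y') (f, g)))).
Qed.

Lemma bifibrant_choice (C : Category) (Q : ModelStructure C) :
  exists (B : C -> C) (b : forall x : C, @Hom (Ho Q) x (B x))
    (bV : forall x : C, @Hom (Ho Q) (B x) x),
    (forall x, cofibrant Q (B x)) /\ (forall x, fibrant Q (B x)) /\
    (forall x, bV x ∘ b x = idm (x : Ho Q)) /\
    (forall x, b x ∘ bV x = idm (B x : Ho Q)).
Proof.
pose B x := constructive_indefinite_description _ (bifibrant_rep_exists Q x).
pose b x := constructive_indefinite_description _ (proj2 (proj2_sig (B x))).
exists (fun x => proj1_sig (B x)), (fun x => proj1_sig (b x)),
  (fun x => inv (proj2_sig (b x))).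
split; first by move=> x; case: (proj2_sig (B x)) => [[]].
split; first by move=> x; case: (proj2_sig (B x)) => [[]].
by split=> x; [apply: inv_l | apply: inv_r].
Qed.

(** The enriched isomorphisms of tensors and cotensors are recorded through their
    units [ten_unit] and [cot_unit], the ordinary adjunctions through their
    counits [ten_ev] and [cot_ev].  The last field is the unit axiom: [s] is the
    transpose of [y ⊗ Ic -> y ⊗ I -> y]. *)
Record TensoredModelCategory (M : MonoidalModelCategory) (N : Category)
    (Q : ModelStructure N) := {
  hm : Functor (prodC (op N) N) M;
  hcat : EnrichedCategory (mten M) (fun x y : N => bob hm (x : op N) y);
  hcat_post : forall (x y z z' : N) (g : Hom z z'),
    ecomp hcat x y z' ∘ bmap (tens (mten M)) (cmap hm (idm y) g) (idm _) =
    cmap hm (idm x) g ∘ ecomp hcat x y z;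
  hcat_pre : forall (x x' y z : N) (f : Hom x' x),
    ecomp hcat x' y z ∘ bmap (tens (mten M)) (idm _) (cmap hm f (idm y)) =
    cmap hm f (idm z) ∘ ecomp hcat x y z;
  hcat_mid : forall (x y y' z : N) (k : Hom y y'),
    ecomp hcat x y' z ∘ bmap (tens (mten M)) (idm _) (cmap hm (idm x) k) =
    ecomp hcat x y z ∘ bmap (tens (mten M)) (cmap hm k (idm z)) (idm _);
  hid_dinatural : forall (x y : N) (f : Hom x y),
    cmap hm f (idm y) ∘ eid hcat y = cmap hm (idm x) f ∘ eid hcat x;
  ten : Functor (prodC N M) N;
  ten_ev : forall x y : N, Hom (bob ten x (bob hm (x : op N) y)) y;
  ten_ev_nat : forall (x y y' : N) (g : Hom y y'),
    ten_ev x y' ∘ bmap ten (idm x) (cmap hm (idm x) g) = g ∘ ten_ev x y;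
  ten_adj : forall (x : N) (X : M) (y : N) (f : Hom (bob ten x X) y),
    exists! g : Hom X (bob hm (x : op N) y), ten_ev x y ∘ bmap ten (idm x) g = f;
  ten_one : forall x : N, Hom (bob ten x (unit (mten M))) x;
  ten_one_nat : forall (x y : N) (f : Hom x y),
    ten_one y ∘ bmap ten f (idm _) = f ∘ ten_one x;
  ten_one_we : forall x : N, we Q (ten_one x);
  ten_ev_id : forall x : N, ten_ev x x ∘ bmap ten (idm x) (eid hcat x) = ten_one x;
  ten_unit : forall (x : N) (X : M), Hom X (bob hm (x : op N) (bob ten x X));
  ten_unit_dinatural : forall (x x' : N) (X X' : M) (f : Hom x' x) (g : Hom X' X),
    cmap hm f (idm (bob ten x X)) ∘ ten_unit x X ∘ g =
    cmap hm (idm x') (bmap ten f g) ∘ ten_unit x' X';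
  ten_hom_iso : forall (x : N) (X : M) (y : N),
    is_iso (curry (mclo M) (ecomp hcat x (bob ten x X) y ∘
      bmap (tens (mten M)) (idm _) (ten_unit x X)));
  cot : Functor (prodC (op M) N) N;
  cot_ev : forall (X : M) (y : N), Hom (bob ten (bob cot (X : op M) y) X) y;
  cot_ev_nat : forall (X : M) (y y' : N) (g : Hom y y'),
    cot_ev X y' ∘ bmap ten (cmap cot (idm X) g) (idm X) = g ∘ cot_ev X y;
  cot_adj : forall (x : N) (X : M) (y : N) (f : Hom (bob ten x X) y),
    exists! g : Hom x (bob cot (X : op M) y), cot_ev X y ∘ bmap ten g (idm X) = f;
  cot_unit : forall (X : M) (y : N), Hom X (bob hm (bob cot (X : op M) y : op N) y);
  cot_unit_dinatural : forall (X X' : M) (y y' : N) (g : Hom X' X) (f : Hom y y'),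
    cmap hm (idm (bob cot (X : op M) y)) f ∘ cot_unit X y ∘ g =
    cmap hm (cmap cot g f) (idm y') ∘ cot_unit X' y';
  cot_hom_iso : forall (x : N) (X : M) (y : N),
    is_iso (curry (mclo M) (ecomp hcat x (bob cot (X : op M) y) y ∘
      bmap (tens (mten M)) (cot_unit X y) (idm _) ∘ swp (mten M) _ X));
  ten_we : preserves_good_we (model_replacement Q) (model_replacement (mmod M))
    (compF (gamma Q) ten);
  hm_we : forall (x x' : N) (y y' : N) (f : Hom x' x) (g : Hom y y'),
    cofibrant Q x -> cofibrant Q x' -> fibrant Q y -> fibrant Q y' ->
    we Q f -> we Q g -> is_iso (cmap (compF (gamma (mmod M)) hm) f g);
  cot_we : forall (x x' : M) (y y' : N) (f : Hom x' x) (g : Hom y y'),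
    cofibrant (mmod M) x -> cofibrant (mmod M) x' -> fibrant Q y -> fibrant Q y' ->
    we (mmod M) f -> we Q g -> is_iso (cmap (compF (gamma Q) cot) f g);
  ten_cofibrant : forall (x : N) (X : M),
    cofibrant Q x -> cofibrant (mmod M) X -> cofibrant Q (bob ten x X);
  hm_fibrant : forall x y : N,
    cofibrant Q x -> fibrant Q y -> fibrant (mmod M) (bob hm (x : op N) y);
  cot_fibrant : forall (X : M) (y : N),
    cofibrant (mmod M) X -> fibrant Q y -> fibrant Q (bob cot (X : op M) y);
  cot_one_we : exists (Ic : M) (w : Hom Ic (unit (mten M))),
    cofibrant (mmod M) Ic /\ we (mmod M) w /\
    forall (y : N) (s : Hom y (bob cot (Ic : op M) y)), fibrant Q y ->
      cot_ev Ic y ∘ bmap ten s (idm Ic) = ten_one y ∘ bmap ten (idm y) w ->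
      we Q s }.

Section HomotopyEnrichment.
Context {M : MonoidalModelCategory} (D : DerivedStructure M)
  {N : Category} {Q : ModelStructure N} (X : TensoredModelCategory M Q).
Local Notation S := (mten M).
Local Notation K := (mclo M).
Local Notation P := (mmod M).
Local Notation dS := (dten D).
Local Notation dK := (dclo D).
Local Notation V := (Ho P).
Local Notation H := (Ho Q).
Local Notation gM := (fmap (gamma P)).
Local Notation gQ := (fmap (gamma Q)).
Local Notation "x ⊗ y" := (bob (tens S) x y) (at level 38, left associativity).
Local Notation "f ⊠ g" := (bmap (tens S) f g) (at level 38, left associativity).
Local Notation "x ⊛ y" := (bob (tens dS) x y) (at level 38, left associativity).
Local Notation "f ⊡ g" := (bmap (tens dS) f g) (at level 38, left associativity).
Local Notation mh x y := (bob (hm X) (x : op N) y).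
Local Notation mhm f g := (cmap (hm X) f g).
Local Notation mcomp := (ecomp (hcat X)).
Local Notation mid := (eid (hcat X)).

Context (R : Functor (prodC (op H) H) V)
  (r : NatTrans (compF (gamma P) (hm X))
         (compF (compF R (loc_op_prod (we Q) (we Q)))
                (loc (prodW (opW (we Q)) (we Q))))).
Context (r_iso : forall x y : N, cofibrant Q x -> fibrant Q y -> is_iso (rcomp r x y)).
Context (B : N -> N) (b : forall x : N, @Hom H x (B x))
  (bV : forall x : N, @Hom H (B x) x)
  (B_cof : forall x, cofibrant Q (B x)) (B_fib : forall x, fibrant Q (B x))
  (bVb : forall x, bV x ∘ b x = idm (x : H)) (bbV : forall x, b x ∘ bV x = idm (B x : H)).

Lemma b_iso (x : N) : is_iso (b x).
Proof. by exists (bV x). Qed.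

Lemma bV_iso (x : N) : is_iso (bV x).
Proof. by exists (b x). Qed.

Lemma bifibrant_lift (x x' : H) (p : Hom x x') :
  exists f : @Hom N (B x) (B x'), gQ f ∘ b x = b x' ∘ p.
Proof.
have [f ef] := gamma_full (b x' ∘ p ∘ bV x) (B_cof x) (B_fib x').
by exists f; rewrite ef -!comp_assoc bVb comp_idr.
Qed.

Definition rhom (x y : N) :
  @Hom V (gamma P (mh x y)) (bob R (x : op H) (y : H)) := rcomp r x y.

Lemma rhom_nat (x x' y y' : N) (f : @Hom N x' x) (g : @Hom N y y') :
  rhom x' y' ∘ gM (mhm f g) =
  cmap R (gQ f) (gQ g) ∘ rhom x y.
Proof. exact: (right_derived_nat r). Qed.

(** Every [x] is isomorphic to the bifibrant [B x], and on bifibrant objects the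
    derived mapping object is the image of the original one. *)
Definition rho (x y : N) :
  @Hom V (gamma P (mh (B x) (B y))) (bob R (x : op H) (y : H)) :=
  locked (cmap R (b x) (bV y) ∘ rhom (B x) (B y)).

Lemma rhoE (x y : N) : rho x y = cmap R (b x) (bV y) ∘ rhom (B x) (B y).
Proof. by rewrite /rho -lock. Qed.

Lemma rho_iso (x y : N) : is_iso (rho x y).
Proof.
rewrite rhoE; apply: iso_comp; last exact: r_iso.
by apply: iso_cmap; [apply: b_iso | apply: bV_iso].
Qed.

(** Under [rho], a map of the homotopy category acts as any map that represents
    it between bifibrant objects. *)
Lemma rho_nat (x x' y y' : N) (p : @Hom H x' x) (q : @Hom H y y')
    (f : @Hom N (B x') (B x)) (g : @Hom N (B y) (B y')) :
  gQ f ∘ b x' = b x ∘ p ->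
  gQ g ∘ b y = b y' ∘ q ->
  rho x' y' ∘ gM (mhm f g) = cmap R p q ∘ rho x y.
Proof.
move=> ef eg; rewrite !rhoE -comp_assoc rhom_nat !comp_assoc -!cmap_comp ef.
congr (cmap R _ _ ∘ _); rewrite -[RHS]comp_idl -(bVb y').
rewrite -comp_assoc [b y' ∘ _]comp_assoc -eg -!comp_assoc bbV comp_idr.
by [].
Qed.

(** Apply the lax monoidal functor [gamma] to the enriched category of bifibrant
    objects and transport along [rho]. *)
Lemma homotopy_enriched_exists :
  exists Ec : EnrichedCategory dS (fun x y : H => bob R (x : op H) y),
    (forall x y z : N, ecomp Ec x y z ∘ (rho y z ⊡ rho x y) =
       rho x z ∘ gM (mcomp (B x) (B y) (B z)) ∘
         dmul D (mh (B y) (B z)) (mh (B x) (B y))) /\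
    (forall x : N, eid Ec x = rho x x ∘ gM (mid (B x)) ∘ dunit D).
Proof.
pose E1 : EnrichedCategory S (fun x y : H => mh (B x) (B y)) :=
  @Build_EnrichedCategory _ S H (fun x y => mh (B x) (B y))
    (fun x y z => mcomp (B x) (B y) (B z)) (fun x => mid (B x))
    (fun w x y z => ecomp_assoc (hcat X) (B w) (B x) (B y) (B z))
    (fun x y => ecomp_idl (hcat X) (B x) (B y))
    (fun x y => ecomp_idr (hcat X) (B x) (B y)).
have [Ec [h1 h2]] := enriched_transport (base_change D E1) rho_iso.
exists Ec; split=> [x y z|x]; first by rewrite h1 comp_assoc.
by rewrite h2 comp_assoc.
Qed.

Context (Ec : EnrichedCategory dS (fun x y : H => bob R (x : op H) y)).
Context (EcE : forall x y z : N, ecomp Ec x y z ∘ (rho y z ⊡ rho x y) =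
       rho x z ∘ gM (mcomp (B x) (B y) (B z)) ∘
         dmul D (mh (B y) (B z)) (mh (B x) (B y))).
Context (EidE : forall x : N, eid Ec x = rho x x ∘ gM (mid (B x)) ∘ dunit D).

Lemma lift_id (x : N) : gQ (idm (B x)) ∘ b x = b x ∘ idm (x : H).
Proof. by rewrite (fmap_id (gamma Q)) comp_idl comp_idr. Qed.

Lemma ecomp_ext (x y z : N) (w : V)
    (f g : Hom (bob R (y : op H) (z : H) ⊛ bob R (x : op H) (y : H)) w) :
  f ∘ (rho y z ⊡ rho x y) = g ∘ (rho y z ⊡ rho x y) -> f = g.
Proof. by apply: iso_epi; apply: iso_bmap; apply: rho_iso. Qed.

Lemma dmul_natl (x x' y : M) (f : Hom x x') :
  dmul D x' y ∘ (gM f ⊡ idm (gamma P y)) = gM (f ⊠ idm y) ∘ dmul D x y.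
Proof. by rewrite -dmul_nat (fmap_id (gamma P)). Qed.

Lemma dmul_natr (x y y' : M) (f : Hom y y') :
  dmul D x y' ∘ (idm (gamma P x) ⊡ gM f) = gM (idm x ⊠ f) ∘ dmul D x y.
Proof. by rewrite -dmul_nat (fmap_id (gamma P)). Qed.

(** This and the next three lemmas hold because they do between bifibrant
    objects, by fullness of [gamma] there. *)
Lemma ecomp_post (x y z z' : H) (q : Hom z z') :
  ecomp Ec x y z' ∘ (cmap R (idm y) q ⊡ idm _) = cmap R (idm x) q ∘ ecomp Ec x y z.
Proof.
have [g eg] := bifibrant_lift q; apply: ecomp_ext.
rewrite -[RHS]comp_assoc EcE !comp_assoc -(rho_nat (lift_id x) eg).
rewrite -[LHS]comp_assoc -bmap_comp -(rho_nat (lift_id y) eg) comp_idl.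
rewrite -{1}(comp_idr (rho x y)) bmap_comp comp_assoc EcE.
rewrite -[LHS]comp_assoc dmul_natl !comp_assoc.
rewrite -![rho x z' ∘ _ ∘ _]comp_assoc -!(fmap_comp (gamma P)).
by rewrite hcat_post.
Qed.

Lemma ecomp_pre (x x' y z : H) (p : Hom x' x) :
  ecomp Ec x' y z ∘ (idm _ ⊡ cmap R p (idm y)) = cmap R p (idm z) ∘ ecomp Ec x y z.
Proof.
have [f ef] := bifibrant_lift p; apply: ecomp_ext.
rewrite -[RHS]comp_assoc EcE !comp_assoc -(rho_nat ef (lift_id z)).
rewrite -[LHS]comp_assoc -bmap_comp -(rho_nat ef (lift_id y)) comp_idl.
rewrite -{1}(comp_idr (rho y z)) bmap_comp comp_assoc EcE.
rewrite -[LHS]comp_assoc dmul_natr !comp_assoc.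
rewrite -![rho x' z ∘ _ ∘ _]comp_assoc -!(fmap_comp (gamma P)).
by rewrite hcat_pre.
Qed.

Lemma ecomp_mid (x y y' z : H) (q : Hom y y') :
  ecomp Ec x y' z ∘ (idm _ ⊡ cmap R (idm x) q) =
  ecomp Ec x y z ∘ (cmap R q (idm z) ⊡ idm _).
Proof.
have [g eg] := bifibrant_lift q.
apply: (iso_epi (f := rho y' z ⊡ rho x y)); first by apply: iso_bmap; apply: rho_iso.
rewrite -!comp_assoc -!bmap_comp !comp_idl.
rewrite -(rho_nat (lift_id x) eg) -(rho_nat eg (lift_id z)).
rewrite -(comp_idr (rho y' z)) -(comp_idr (rho x y)) !bmap_comp !comp_assoc.
rewrite !EcE -[LHS]comp_assoc dmul_natr -[RHS]comp_assoc dmul_natl !comp_assoc.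
by rewrite -![rho x z ∘ _ ∘ _]comp_assoc -!(fmap_comp (gamma P)) hcat_mid.
Qed.

Lemma eid_dinatural (x y : H) (p : Hom x y) :
  cmap R p (idm y) ∘ eid Ec y = cmap R (idm x) p ∘ eid Ec x.
Proof.
have [f ef] := bifibrant_lift p; rewrite !EidE !comp_assoc.
rewrite -(rho_nat ef (lift_id y)) -(rho_nat (lift_id x) ef).
rewrite -![rho x y ∘ _ ∘ _]comp_assoc -!(fmap_comp (gamma P)).
by rewrite hid_dinatural.
Qed.

(** Composing the axiom [hom_post] with [eid x] shows that the isomorphism with
    the underlying category can only be this one. *)
Definition hname (x y : H) (f : Hom x y) : Hom (unit dS) (bob R (x : op H) y) :=
  cmap R (idm x) f ∘ eid Ec x.

Lemma hname_post (x y z : H) (g : Hom y z) :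
  cmap R (idm x) g = ecomp Ec x y z ∘ (hname g ⊡ idm _) ∘ lunV dS _.
Proof.
rewrite /hname bmap_l comp_assoc ecomp_post -[cmap _ _ _ ∘ _ ∘ _]comp_assoc.
by rewrite ecomp_idl -comp_assoc lunVK comp_idr.
Qed.

Lemma hname_pre (x y z : H) (f : Hom x y) :
  cmap R f (idm z) = ecomp Ec x y z ∘ (idm _ ⊡ hname f) ∘ runV dS _.
Proof.
rewrite /hname -eid_dinatural bmap_r comp_assoc ecomp_pre.
rewrite -[cmap _ _ _ ∘ _ ∘ _]comp_assoc ecomp_idr.
by rewrite -comp_assoc runVK comp_idr.
Qed.

Lemma hname_comp (x y z : H) (g : Hom y z) (f : Hom x y) :
  hname (g ∘ f) = ucomp Ec (hname g) (hname f).
Proof.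
have n : (idm (unit dS) ⊡ hname f) ∘ lunV dS _ = lunV dS _ ∘ hname f.
  have i : is_iso (lun dS (bob R (x : op H) y)).
    by exists (lunV dS (bob R (x : op H) y)); rewrite lunK lunVK.
  apply: (iso_mono i).
  by rewrite !comp_assoc lun_nat lunVK comp_idl -comp_assoc lunVK comp_idr.
rewrite /ucomp bmap_lr comp_assoc -[RHS]comp_assoc n comp_assoc -hname_post.
by rewrite /hname comp_assoc -cmap_comp comp_idl.
Qed.

Lemma homotopy_enrichment :
  (forall (x y : H) (e : Hom (unit dS) (bob R (x : op H) y)),
     exists! f : Hom x y, hname f = e) ->
  exists En : Enrichment dS R, ecat En = Ec.
Proof.
move=> hb.
have h1 (x : H) : hname (idm x) = eid Ec x by rewrite /hname cmap_id comp_idl.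
by exists (@Build_Enrichment _ dS _ R Ec hname hb h1 hname_comp hname_post hname_pre).
Qed.
End HomotopyEnrichment.

(** * Maps in the homotopy category as points of mapping objects *)
Section DerivedAdjunctions.
Context {M : MonoidalModelCategory} {N : Category} {Q : ModelStructure N}
  (X : TensoredModelCategory M Q).
Local Notation S := (mten M).
Local Notation K := (mclo M).
Local Notation P := (mmod M).
Local Notation V := (Ho P).
Local Notation H := (Ho Q).
Local Notation gM := (fmap (gamma P)).
Local Notation gQ := (fmap (gamma Q)).
Local Notation tn := (ten X).
Local Notation "x ⊗ y" := (bob tn x y) (at level 38, left associativity).
Local Notation "f ⊠ g" := (bmap tn f g) (at level 38, left associativity).
Local Notation mh x y := (bob (hm X) (x : op N) y).
Local Notation ct x y := (bob (cot X) (x : op M) y).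

Context (R : Functor (prodC (op H) H) V)
  (r : NatTrans (compF (gamma P) (hm X))
         (compF (compF R (loc_op_prod (we Q) (we Q)))
                (loc (prodW (opW (we Q)) (we Q)))))
  (r_iso : forall x y : N, cofibrant Q x -> fibrant Q y -> is_iso (rcomp r x y)).
Context (T : Functor (prodC H V) H)
  (e : NatTrans (compF (compF T (loc_prod (we Q) (we P))) (loc (prodW (we Q) (we P))))
         (compF (gamma Q) (ten X)))
  (e_iso : forall (x : N) (y : M), cofibrant Q x -> cofibrant P y -> is_iso (lcomp e x y)).
Context (U : Functor (prodC (op V) H) H)
  (t : NatTrans (compF (gamma Q) (cot X))
         (compF (compF U (loc_op_prod (we P) (we Q)))
                (loc (prodW (opW (we P)) (we Q)))))
  (t_iso : forall (x : M) (y : N), cofibrant P x -> fibrant Q y -> is_iso (rcomp t x y)).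

Definition lten (x : N) (y : M) :
  @Hom H (bob T (x : H) (y : V)) (gamma Q (x ⊗ y)) := lcomp e x y.

Definition rcot (x : M) (y : N) :
  @Hom H (gamma Q (ct x y)) (bob U (x : op V) (y : H)) := rcomp t x y.

Lemma lten_nat (x x' : N) (y y' : M) (f : Hom x x') (g : Hom y y') :
  lten x' y' ∘ bmap T (gQ f) (gM g) = gQ (f ⊠ g) ∘ lten x y.
Proof. exact: (left_derived_nat e). Qed.

Lemma rcot_nat (x x' : M) (y y' : N) (f : Hom x' x) (g : Hom y y') :
  rcot x' y' ∘ gQ (cmap (cot X) f g) = cmap U (gM f) (gQ g) ∘ rcot x y.
Proof. exact: (right_derived_nat t). Qed.

Lemma hom_adjunction (m : N) : cofibrant Q m ->
  exists w : forall n : H, Hom (bob T (m : H) (bob R (m : op H) n)) n,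
    (forall (n n' : H) (g : Hom n n'),
       w n' ∘ bmap T (idm (m : H)) (cmap R (idm (m : H)) g) = g ∘ w n) /\
    (forall n : N, w n ∘ bmap T (idm (m : H)) (rhom r m n) =
       gQ (ten_ev X m n) ∘ lten m (mh m n)) /\
    (forall (x : V) (n : H) (g : Hom (bob T (m : H) x) n),
       exists! v : Hom x (bob R (m : op H) n), w n ∘ bmap T (idm (m : H)) v = g).
Proof.
move=> hm'.
pose tr (x : M) (n : N) (f : Hom (m ⊗ x) n) : Hom x (mh m n) :=
  proj1_sig (constructive_indefinite_description _ (ten_adj f)).
have trE (x : M) (n : N) (f : Hom (m ⊗ x) n) :
    ten_ev X m n ∘ (idm m ⊠ tr x n f) = f.
  by rewrite /tr; case: constructive_indefinite_description => k [].
have tr_inj (x : M) (n : N) (g g' : Hom x (mh m n)) :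
    ten_ev X m n ∘ (idm m ⊠ g) = ten_ev X m n ∘ (idm m ⊠ g') -> g = g'.
  move=> h; have [k [_ hk]] := ten_adj (ten_ev X m n ∘ (idm m ⊠ g)).
  by rewrite -(hk g) // (hk g').
have [w [w1 w2]] := @derived_adjunction M N P Q (slice_r tn m)
  (slice_r (hm X) (m : op N)) (ten_ev X m) (@ten_ev_nat _ _ _ X m) tr trE tr_inj
  (slice_r T (m : H)) (slice_r R (m : op H)) (lten m)
  (fun x x' f => eq_trans (f_equal (fun k => lten m x' ∘ bmap T k (gM f))
     (eq_sym (fmap_id (gamma Q) m))) (lten_nat (idm m) f))
  (fun x hx => e_iso hm' hx) (rhom r m)
  (fun n n' g => eq_trans (rhom_nat r (idm m) g)
     (f_equal (fun k => cmap R k (gQ g) ∘ rhom r m n) (fmap_id (gamma Q) m)))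
  (fun n hn => r_iso hm' hn).
exists w; split; first by move=> n n' g; exact: (nt_nat w).
by split.
Qed.

Lemma cot_adjunction (m : M) : cofibrant P m ->
  exists w : forall n : H, Hom (bob T (bob U (m : op V) n) (m : V)) n,
    (forall (n n' : H) (g : Hom n n'),
       w n' ∘ bmap T (cmap U (idm (m : V)) g) (idm (m : V)) = g ∘ w n) /\
    (forall n : N, w n ∘ bmap T (rcot m n) (idm (m : V)) =
       gQ (cot_ev X m n) ∘ lten (ct m n) m) /\
    (forall (x : H) (n : H) (g : Hom (bob T x (m : V)) n),
       exists! v : Hom x (bob U (m : op V) n), w n ∘ bmap T v (idm (m : V)) = g).
Proof.
move=> hm'.
pose tr (x : N) (n : N) (f : Hom (x ⊗ m) n) : Hom x (ct m n) :=
  proj1_sig (constructive_indefinite_description _ (cot_adj f)).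
have trE (x : N) (n : N) (f : Hom (x ⊗ m) n) :
    cot_ev X m n ∘ (tr x n f ⊠ idm m) = f.
  by rewrite /tr; case: constructive_indefinite_description => k [].
have tr_inj (x : N) (n : N) (g g' : Hom x (ct m n)) :
    cot_ev X m n ∘ (g ⊠ idm m) = cot_ev X m n ∘ (g' ⊠ idm m) -> g = g'.
  move=> h; have [k [_ hk]] := cot_adj (cot_ev X m n ∘ (g ⊠ idm m)).
  by rewrite -(hk g) // (hk g').
have [w [w1 w2]] := @derived_adjunction N N Q Q (slice_l tn m)
  (slice_r (cot X) (m : op M)) (cot_ev X m) (@cot_ev_nat _ _ _ X m) tr trE tr_inj
  (slice_l T (m : V)) (slice_r U (m : op V)) (fun x => lten x m)
  (fun x x' f => eq_trans (f_equal (fun k => lten x' m ∘ bmap T (gQ f) k)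
     (eq_sym (fmap_id (gamma P) m))) (lten_nat f (idm m)))
  (fun x hx => e_iso hx hm') (rcot m)
  (fun n n' g => eq_trans (rcot_nat (idm m) g)
     (f_equal (fun k => cmap U k (gQ g) ∘ rcot m n) (fmap_id (gamma P) m)))
  (fun n hn => t_iso hm' hn).
exists w; split; first by move=> n n' g; exact: (nt_nat w).
by split.
Qed.

Context (B : N -> N) (b : forall x : N, @Hom H x (B x))
  (bV : forall x : N, @Hom H (B x) x)
  (B_cof : forall x, cofibrant Q (B x)) (B_fib : forall x, fibrant Q (B x))
  (bVb : forall x, bV x ∘ b x = idm (x : H)) (bbV : forall x, b x ∘ bV x = idm (B x : H)).

(** For fibrant [n], restriction of maps into [n] along [m ⊗ Ic -> m] corresponds
    under the derived adjunction to composition with [n -> [Ic, n]], which is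
    invertible by the unit axiom.  As every object is isomorphic to a fibrant
    one, the Yoneda lemma applies. *)
Lemma ten_one_derived (m : N) (Ic : M) (w : Hom Ic (unit S)) :
  cofibrant Q m -> cofibrant P Ic -> we P w ->
  (forall (y : N) (s : Hom y (ct Ic y)), fibrant Q y ->
      cot_ev X Ic y ∘ (s ⊠ idm Ic) = ten_one X y ∘ (idm y ⊠ w) -> we Q s) ->
  is_iso (gQ (ten_one X m ∘ (idm m ⊠ w)) ∘ lten m Ic).
Proof.
move=> hm' hI hw hs; set z := _ ∘ lten m Ic.
have [w' [wn [wc wu]]] := cot_adjunction hI.
have fibcase (n : N) (g : Hom (bob T (m : H) (Ic : V)) n) : fibrant Q n ->
    exists! f : @Hom H m n, f ∘ z = g.
{ move=> hn.
  have [s [es _]] := cot_adj (ten_one X n ∘ (idm n ⊠ w)).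
  have is_s : is_iso (rcot Ic n ∘ gQ s).
    by apply: iso_comp; [apply: t_iso | apply: gamma_iso; apply: (hs n)].
  have key (f : @Hom H m n) : w' n ∘ bmap T (rcot Ic n ∘ gQ s ∘ f) (idm (Ic : V)) = f ∘ z.
    have [f0 <-] := gamma_full f hm' hn.
    rewrite -comp_assoc -(fmap_comp (gamma Q)) bmap_l comp_assoc wc -comp_assoc.
    rewrite -{1}(fmap_id (gamma P) Ic) lten_nat comp_assoc -(fmap_comp (gamma Q)).
    rewrite bmap_l comp_assoc es -comp_assoc -bmap_rl bmap_lr comp_assoc ten_one_nat.
    by rewrite /z comp_assoc -(fmap_comp (gamma Q)) comp_assoc.
  have [v [ev uv]] := wu _ _ g.
  exists (inv is_s ∘ v); split.
  - by rewrite -key comp_assoc inv_r comp_idl.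
  - move=> f hf; rewrite (uv (rcot Ic n ∘ gQ s ∘ f)); first by rewrite key.
    by rewrite comp_assoc inv_l comp_idl. }
have allcase (n : H) (g : Hom (bob T (m : H) (Ic : V)) n) :
    exists! f : @Hom H m n, f ∘ z = g.
{ have [f [ef uf]] := fibcase (B n) (b n ∘ g) (B_fib n).
  exists (bV n ∘ f); split.
  - by rewrite -comp_assoc ef comp_assoc bVb comp_idl.
  - move=> f' hf'; rewrite (uf (b n ∘ f')); first by rewrite -comp_assoc hf'.
    by rewrite comp_assoc bVb comp_idl. }
have [s [es _]] := allcase _ (idm _).
have [k [_ uk]] := allcase _ z.
exists s; split=> //; rewrite -(uk (idm _)); first exact: comp_idl.
by symmetry; apply: uk; rewrite -comp_assoc es comp_idr.
Qed.

(** The unit object itself may fail to be cofibrant; compare with [Ic]. *)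
Lemma lten_unit_iso (m : N) : cofibrant Q m -> is_iso (lten m (unit S)).
Proof.
move=> hm'; have [Ic [w [hI [hw hs]]]] := cot_one_we X.
have i : is_iso (bmap T (idm (m : H)) (gM w)).
  by apply: iso_bmap; [apply: iso_id | apply: gamma_iso].
apply: (iso_cancel_r i).
rewrite -(fmap_id (gamma Q) m) lten_nat; apply: iso_comp; last exact: e_iso.
apply: (iso_cancel_l (gamma_iso (ten_one_we X m))).
rewrite -(fmap_comp (gamma Q)).
apply: (iso_cancel_r (e_iso hm' hI)).
exact: ten_one_derived.
Qed.

Context (D : DerivedStructure M).
Local Notation dS := (dten D).
Context (Ec : EnrichedCategory dS (fun x y : H => bob R (x : op H) y)).
Context (EidE : forall x : N, eid Ec x =
  rho r b bV x x ∘ gM (eid (hcat X) (B x)) ∘ dunit D).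

(** Under the derived adjunction between [Bx ⊗ -] and mapping out of [Bx],
    taking names becomes composition with [Bx ⊗ I ≅ Bx ≅ x]. *)
Lemma hname_bij (x y : H) (v : Hom (unit dS) (bob R (x : op H) y)) :
  exists! f : Hom x y, hname Ec f = v.
Proof.
have hB := B_cof x; have [w [wn [wc wu]]] := hom_adjunction hB.
pose m : N := B x.
(* The name of the identity of [m], which is that of [x] conjugated by [b x]. *)
pose i0 := rhom r m m ∘ gM (eid (hcat X) m) ∘ dunit D.
pose q := gQ (ten_one X m) ∘ lten m (unit S) ∘ bmap T (idm (m : H)) (dunit D).
have iq : is_iso q.
  apply: iso_comp; last by apply: iso_bmap; [apply: iso_id | apply: dunit_iso].
  by apply: iso_comp; [apply: gamma_iso; apply: ten_one_we | apply: lten_unit_iso].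
have q0 : w m ∘ bmap T (idm (m : H)) i0 = q.
  rewrite /i0 !bmap_r !comp_assoc wc -[_ ∘ _ ∘ bmap T _ (gM _)]comp_assoc.
  rewrite -{1}(fmap_id (gamma Q) m) lten_nat comp_assoc -(fmap_comp (gamma Q)).
  by rewrite ten_ev_id.
have e0 : eid Ec x = cmap R (b x) (bV x) ∘ i0 by rewrite EidE rhoE /i0 !comp_assoc.
clearbody i0 q.
have key (f : Hom x y) : w y ∘ bmap T (idm (m : H))
    (cmap R (bV x) (idm y) ∘ hname Ec f) = f ∘ bV x ∘ q.
  rewrite /hname e0 !comp_assoc -!cmap_comp !comp_idl bbV bmap_r comp_assoc wn -q0.
  by rewrite comp_assoc.
have inj (v1 v2 : Hom (unit dS) (bob R (m : op H) y)) :
    w y ∘ bmap T (idm (m : H)) v1 = w y ∘ bmap T (idm (m : H)) v2 -> v1 = v2.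
  move=> h; have [g [_ ug]] := wu _ _ (w y ∘ bmap T (idm (m : H)) v1).
  by rewrite -(ug v1) // (ug v2).
have hv : hname Ec (w y ∘ bmap T (idm (m : H)) (cmap R (bV x) (idm y) ∘ v) ∘ inv iq ∘ b x) = v.
  have i : is_iso (cmap R (bV x) (idm y)).
    by apply: iso_cmap; [exists (b x) | apply: iso_id].
  apply: (iso_mono i); apply: inj; rewrite key.
  set u := w y ∘ _.
  by rewrite -[u ∘ _ ∘ _ ∘ _]comp_assoc bbV comp_idr -comp_assoc inv_l comp_idr.
exists (w y ∘ bmap T (idm (m : H)) (cmap R (bV x) (idm y) ∘ v) ∘ inv iq ∘ b x).
split=> // f hf; rewrite -hf key.
rewrite -[_ ∘ q ∘ _]comp_assoc inv_r comp_idr -comp_assoc bVb.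
by rewrite comp_idr.
Qed.
End DerivedAdjunctions.

(** * Tensors and cotensors in the homotopy category *)
Section HomotopyTensors.
Context {M : MonoidalModelCategory} (D : DerivedStructure M) {N : Category}
  {Q : ModelStructure N} (X : TensoredModelCategory M Q).
Local Notation S := (mten M).
Local Notation K := (mclo M).
Local Notation P := (mmod M).
Local Notation dS := (dten D).
Local Notation dK := (dclo D).
Local Notation V := (Ho P).
Local Notation H := (Ho Q).
Local Notation gM := (fmap (gamma P)).
Local Notation gQ := (fmap (gamma Q)).
Local Notation tn := (ten X).
Local Notation "f ⊠ g" := (bmap (tens S) f g) (at level 38, left associativity).
Local Notation "x ⊛ y" := (bob (tens dS) x y) (at level 38, left associativity).
Local Notation "f ⊡ g" := (bmap (tens dS) f g) (at level 38, left associativity).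
Local Notation mh x y := (bob (hm X) (x : op N) y).
Local Notation mhm f g := (cmap (hm X) f g).
Local Notation ct x y := (bob (cot X) (x : op M) y).

Context (R : Functor (prodC (op H) H) V)
  (r : NatTrans (compF (gamma P) (hm X))
         (compF (compF R (loc_op_prod (we Q) (we Q)))
                (loc (prodW (opW (we Q)) (we Q)))))
  (r_iso : forall x y : N, cofibrant Q x -> fibrant Q y -> is_iso (rcomp r x y)).
Context (T : Functor (prodC H V) H)
  (e : NatTrans (compF (compF T (loc_prod (we Q) (we P))) (loc (prodW (we Q) (we P))))
         (compF (gamma Q) (ten X)))
  (e_iso : forall (x : N) (y : M), cofibrant Q x -> cofibrant P y -> is_iso (lcomp e x y)).
Context (U : Functor (prodC (op V) H) H)
  (t : NatTrans (compF (gamma Q) (cot X))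
         (compF (compF U (loc_op_prod (we P) (we Q)))
                (loc (prodW (opW (we P)) (we Q)))))
  (t_iso : forall (x : M) (y : N), cofibrant P x -> fibrant Q y -> is_iso (rcomp t x y)).
Context (B : N -> N) (b : forall x : N, @Hom H x (B x))
  (bV : forall x : N, @Hom H (B x) x)
  (B_cof : forall x, cofibrant Q (B x)) (B_fib : forall x, fibrant Q (B x))
  (bVb : forall x, bV x ∘ b x = idm (x : H)) (bbV : forall x, b x ∘ bV x = idm (B x : H)).
Context (B' : M -> M) (b' : forall x : M, @Hom V x (B' x))
  (bV' : forall x : M, @Hom V (B' x) x)
  (B'_cof : forall x, cofibrant P (B' x)) (B'_fib : forall x, fibrant P (B' x))
  (bVb' : forall x, bV' x ∘ b' x = idm (x : V))
  (bbV' : forall x, b' x ∘ bV' x = idm (B' x : V)).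
Context (En : Enrichment dS R).
Local Notation rho := (rho r b bV).
Context (EcE : forall x y z : N, ecomp En x y z ∘ (rho y z ⊡ rho x y) =
       rho x z ∘ gM (ecomp (hcat X) (B x) (B y) (B z)) ∘
         dmul D (mh (B y) (B z)) (mh (B x) (B y))).

Let rhoI x y : is_iso (rho x y).
Proof. exact: rho_iso. Qed.

Let rhoN := rho_nat r bVb bbV.

(** On these objects [rhom] is invertible and natural, so the image of a map of
    mapping objects depends only on the class of the map that induces it. *)
Lemma hm_post_eq (x y z : N) (f g : Hom y (B z)) :
  gQ f = gQ g -> gM (mhm (idm (B x)) f) = gM (mhm (idm (B x)) g).
Proof.
by move=> h; apply: (iso_mono (r_iso (B_cof x) (B_fib z))); rewrite !rhom_nat h.
Qed.

Lemma hm_pre_eq (x y z : N) (f g : Hom (B x) y) :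
  gQ f = gQ g -> gM (mhm f (idm (B z))) = gM (mhm g (idm (B z))).
Proof.
by move=> h; apply: (iso_mono (r_iso (B_cof x) (B_fib z))); rewrite !rhom_nat h.
Qed.

Lemma lift_inv (x x' : H) (p : Hom x x') (f : Hom (B x) (B x')) :
  gQ f ∘ b x = b x' ∘ p -> bV x' ∘ gQ f = p ∘ bV x.
Proof.
move=> h; have i : is_iso (b x) by exists (bV x).
by apply: (iso_epi i); rewrite -!comp_assoc h comp_assoc !bVb comp_idl comp_idr.
Qed.

Lemma lift_inv' (x x' : V) (p : Hom x x') (f : Hom (B' x) (B' x')) :
  gM f ∘ b' x = b' x' ∘ p -> bV' x' ∘ gM f = p ∘ bV' x.
Proof.
move=> h; have i : is_iso (b' x) by exists (bV' x).
by apply: (iso_epi i); rewrite -!comp_assoc h comp_assoc !bVb' comp_idl comp_idr.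
Qed.

Let lft (x x' : H) (p : Hom x x') := bifibrant_lift B_cof B_fib bVb p.
Let lft' (x x' : V) (p : Hom x x') := bifibrant_lift B'_cof B'_fib bVb' p.

(** [Bc ⊗ B'Y] is cofibrant but need not be fibrant, so it is compared with the
    bifibrant replacement of the derived tensor by a map of [N]. *)
Lemma ten_model_exists (c : N) (Y : M) :
  exists k : Hom (bob tn (B c) (B' Y)) (B (bob T (c : H) (Y : V))),
    gQ k ∘ lten e (B c) (B' Y) = b _ ∘ bmap T (bV c) (bV' Y).
Proof.
have i : is_iso (lten e (B c) (B' Y)) by apply: e_iso.
have [k ek] := gamma_full (b _ ∘ bmap T (bV c) (bV' Y) ∘ inv i)
  (ten_cofibrant X (B_cof c) (B'_cof Y)) (B_fib _).
by exists k; rewrite ek -!comp_assoc inv_l comp_idr.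
Qed.

Definition ten_model (c : N) (Y : M) :=
  proj1_sig (constructive_indefinite_description _ (ten_model_exists c Y)).

Lemma ten_modelE (c : N) (Y : M) :
  gQ (ten_model c Y) ∘ lten e (B c) (B' Y) = b _ ∘ bmap T (bV c) (bV' Y).
Proof. by rewrite /ten_model; case: constructive_indefinite_description. Qed.

Lemma ten_model_iso (c : N) (Y : M) : is_iso (gQ (ten_model c Y)).
Proof.
have i : is_iso (lten e (B c) (B' Y)) by apply: e_iso.
apply: (iso_cancel_r i); rewrite ten_modelE; apply: iso_comp; first exact: (b_iso bVb bbV).
by apply: iso_bmap; [exists (b c) | exists (b' Y)].
Qed.

(** The unit of the tensor [Bc ⊗ B'Y], transported to [c] and [Y]. *)
Definition hten_unit (c : N) (Y : M) :
  @Hom V Y (bob R (c : op H) (bob T (c : H) (Y : V))) :=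
  locked (rho c (bob T (c : H) (Y : V)) ∘
    gM (mhm (idm (B c)) (ten_model c Y) ∘ ten_unit X (B c) (B' Y)) ∘ b' Y).

Lemma hten_unit_dinatural (c c' : H) (Y Y' : V) (p : Hom c' c) (q : Hom Y' Y) :
  cmap R p (idm (bob T c Y)) ∘ hten_unit c Y ∘ q =
  cmap R (idm c') (bmap T p q) ∘ hten_unit c' Y'.
Proof.
have [f ef] := lft p; have [g eg] := lft' q; have [s es] := lft (bmap T p q).
rewrite /hten_unit -!lock !comp_assoc.
rewrite -(rhoN ef (lift_id b _)) -(rhoN (lift_id b _) es).
rewrite -(comp_assoc _ (b' Y) q) -eg !comp_assoc; congr (_ ∘ _).
rewrite -!comp_assoc; congr (_ ∘ _); rewrite -!(fmap_comp (gamma P)).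
have -> : mhm f (idm (B (bob T c Y))) ∘
    (mhm (idm (B c)) (ten_model c Y) ∘ ten_unit X (B c) (B' Y) ∘ g) =
    mhm (idm (B c')) (ten_model c Y ∘ bmap tn f g) ∘ ten_unit X (B c') (B' Y').
  rewrite -[in RHS](comp_idl (idm (B c'))) cmap_comp -[RHS]comp_assoc.
  rewrite -ten_unit_dinatural !comp_assoc -!cmap_comp.
  by rewrite !comp_idl !comp_idr.
have -> : mhm (idm (B c')) s ∘ (mhm (idm (B c')) (ten_model c' Y') ∘
    ten_unit X (B c') (B' Y')) =
    mhm (idm (B c')) (s ∘ ten_model c' Y') ∘ ten_unit X (B c') (B' Y').
  by rewrite comp_assoc -cmap_comp comp_idl.
rewrite !(fmap_comp (gamma P)); congr (_ ∘ _); apply: hm_post_eq.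
have i : is_iso (lten e (B c') (B' Y')) by apply: e_iso.
apply: (iso_epi i); rewrite !(fmap_comp (gamma Q)) -!comp_assoc ten_modelE.
rewrite -lten_nat !comp_assoc ten_modelE es -!comp_assoc -!bmap_comp.
by rewrite (lift_inv ef) (lift_inv' eg).
Qed.

Lemma ihom_map_iso (x x' y y' : V) (f : Hom x' x) (g : Hom y y') :
  is_iso f -> is_iso g -> is_iso (ihom_map dK f g).
Proof. exact: (@iso_cmap _ _ _ (ihomF dK)). Qed.

(** The transformation is composition with the unit, so that its enriched
    naturality is automatic.  Between good objects it is the image of the
    isomorphism of [N] followed by [dhom], by [dhom_curry]. *)
Theorem homotopy_tensors : ProvidesTensors dK En T.
Proof.
exists (fun c Y d => curry dK (ecomp En c (bob T c Y) d ∘ (idm _ ⊡ hten_unit c Y))).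
split; [|split].
- move=> c Y d; pose k := ten_model c Y.
  pose h := curry K (ecomp (hcat X) (B c) (bob tn (B c) (B' Y)) (B d) ∘
      (idm _ ⊠ ten_unit X (B c) (B' Y))).
  have hE : curry dK (ecomp En c (bob T c Y) d ∘ (idm _ ⊡ hten_unit c Y)) ∘
      rho (bob T c Y) d =
      ihom_map dK (b' Y) (rho c d) ∘ dhom D (B' Y) (mh (B c) (B d)) ∘
        gM (h ∘ mhm k (idm (B d))).
  { rewrite -dhom_curry; apply: curry_inj; rewrite [RHS]ev_curry.
    rewrite bmap_l comp_assoc ev_curry -[LHS]comp_assoc -bmap_rl.
    rewrite -{1}(comp_idr (rho (bob T c Y) d)) /hten_unit -lock -!comp_assoc.
    rewrite bmap_comp comp_assoc EcE (bmap_r _ _ (gM _)) !comp_assoc.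
    rewrite (post (dmul_natr D _ _)) !comp_assoc; congr (_ ∘ _ ∘ _).
    rewrite -comp_assoc -(fmap_comp (gamma P)); congr (_ ∘ fmap (gamma P) _).
    rewrite [in RHS]bmap_l [RHS]comp_assoc ev_curry [in LHS]bmap_r [LHS]comp_assoc.
    rewrite hcat_mid.
    by rewrite -[LHS]comp_assoc -bmap_lr bmap_rl [LHS]comp_assoc. }
  apply: (iso_cancel_r (rhoI (bob T c Y) d)); rewrite hE.
  apply: iso_comp; first apply: iso_comp.
  + by apply: ihom_map_iso; [apply: (b_iso bVb' bbV') | apply: rhoI].
  + by apply: dhom_iso; [apply: B'_cof | apply: hm_fibrant].
  + rewrite (fmap_comp (gamma P)); apply: iso_comp.
      by apply: iso_fmap; apply: (ten_hom_iso X).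
    have i1 : is_iso (rhom r (bob tn (B c) (B' Y)) (B d)).
      by apply: r_iso => //; apply: ten_cofibrant.
    apply: (iso_cancel_l i1); rewrite rhom_nat; apply: iso_comp; last exact: r_iso.
    apply: iso_cmap; first exact: ten_model_iso.
    by rewrite (fmap_id (gamma Q)); apply: iso_id.
- by move=> c Y d d'; apply: ihom_post_ecomp.
- move=> c c' d Y Y' p q; apply: curry_inj.
  set th := curry dK (ecomp En c _ _ ∘ _); set th' := curry dK (ecomp En c' _ _ ∘ _).
  have thE : ev dK Y _ ∘ (th ⊡ idm Y) = ecomp En c (bob T c Y) d ∘
      (idm _ ⊡ hten_unit c Y) by exact: ev_curry.
  have thE' : ev dK Y' _ ∘ (th' ⊡ idm Y') = ecomp En c' (bob T c' Y') d ∘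
      (idm _ ⊡ hten_unit c' Y') by exact: ev_curry.
  rewrite (bmap_l _ _ th') (bmap_l _ _ (ihom_map dK _ _)) !comp_assoc ev_ihom_map thE'.
  rw (eq_sym (bmap_rl (tens dS) th q)); rewrite (bmap_lr (tens dS) th q); rw thE.
  rewrite -[LHS]comp_assoc -bmap_rl bmap_lr comp_assoc.
  rewrite -[bmap R (bmap T p q : @Hom (op H) _ _) _]/(cmap R (bmap T p q) (idm d)).
  rewrite -(ecomp_mid r_iso B_cof B_fib bVb bbV EcE).
  rewrite -[LHS]comp_assoc -bmap_r -hten_unit_dinatural.
  rewrite -[bmap R (p : @Hom (op H) _ _) _]/(cmap R p (idm d)).
  rewrite -(ecomp_pre r_iso B_cof B_fib bVb bbV EcE) -!comp_assoc -!bmap_r.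
  by [].
Qed.

(** [[B'Y, Bc]] is fibrant but need not be cofibrant; compare [ten_model]. *)
Lemma cot_model_exists (Y : M) (c : N) :
  exists k : Hom (B (bob U (Y : op V) (c : H))) (ct (B' Y) (B c)),
    rcot t (B' Y) (B c) ∘ gQ k ∘ b _ = cmap U (bV' Y) (b c).
Proof.
have i : is_iso (rcot t (B' Y) (B c)) by apply: t_iso.
have [k ek] := gamma_full (inv i ∘ cmap U (bV' Y) (b c) ∘ bV _) (B_cof _)
  (cot_fibrant X (B'_cof Y) (B_fib c)).
exists k; rewrite ek !comp_assoc inv_r comp_idl -comp_assoc bVb comp_idr.
by [].
Qed.

Definition cot_model (Y : M) (c : N) :=
  proj1_sig (constructive_indefinite_description _ (cot_model_exists Y c)).

Lemma cot_modelE (Y : M) (c : N) :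
  rcot t (B' Y) (B c) ∘ gQ (cot_model Y c) ∘ b _ = cmap U (bV' Y) (b c).
Proof. by rewrite /cot_model; case: constructive_indefinite_description. Qed.

Lemma cot_model_iso (Y : M) (c : N) : is_iso (gQ (cot_model Y c)).
Proof.
have i : is_iso (rcot t (B' Y) (B c)) by apply: t_iso.
apply: (iso_cancel_l i); apply: (iso_cancel_r (b_iso bVb bbV _)).
rewrite cot_modelE; apply: iso_cmap; last exact: (b_iso bVb bbV).
exact: (bV_iso bVb' bbV').
Qed.

Definition hcot_unit (Y : M) (c : N) :
  @Hom V Y (bob R (bob U (Y : op V) (c : H) : op H) (c : H)) :=
  locked (rho (bob U (Y : op V) (c : H)) c ∘
    gM (mhm (cot_model Y c) (idm (B c)) ∘ cot_unit X (B' Y) (B c)) ∘ b' Y).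

Lemma hcot_unit_dinatural (Y Y' : V) (c c' : H) (q : Hom Y' Y) (p : Hom c c') :
  cmap R (idm (bob U (Y : op V) c)) p ∘ hcot_unit Y c ∘ q =
  cmap R (cmap U q p) (idm c') ∘ hcot_unit Y' c'.
Proof.
have [f ef] := lft p; have [g eg] := lft' q; have [s es] := lft (cmap U q p).
rewrite /hcot_unit -!lock !comp_assoc.
rewrite -(rhoN (lift_id b _) ef) -(rhoN es (lift_id b _)).
rewrite -(comp_assoc _ (b' Y) q) -eg !comp_assoc; congr (_ ∘ _).
rewrite -!comp_assoc; congr (_ ∘ _); rewrite -!(fmap_comp (gamma P)).
have -> : mhm (idm (B (bob U (Y : op V) c))) f ∘
    (mhm (cot_model Y c) (idm (B c)) ∘ cot_unit X (B' Y) (B c) ∘ g) =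
    mhm (cmap (cot X) g f ∘ cot_model Y c) (idm (B c')) ∘
      cot_unit X (B' Y') (B c').
  rewrite -[in RHS](comp_idl (idm (B c'))) cmap_comp -[RHS]comp_assoc.
  rewrite -cot_unit_dinatural !comp_assoc -!cmap_comp.
  by rewrite !comp_idl !comp_idr.
have -> : mhm s (idm (B c')) ∘ (mhm (cot_model Y' c') (idm (B c')) ∘
    cot_unit X (B' Y') (B c')) =
    mhm (cot_model Y' c' ∘ s) (idm (B c')) ∘ cot_unit X (B' Y') (B c').
  by rewrite comp_assoc -cmap_comp comp_idl.
rewrite !(fmap_comp (gamma P)); congr (_ ∘ _); apply: hm_pre_eq.
have i : is_iso (rcot t (B' Y') (B c')) by apply: t_iso.
apply: (iso_mono i); apply: (iso_epi (b_iso bVb bbV (bob U (Y : op V) c))).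
rewrite !(fmap_comp (gamma Q)) !comp_assoc rcot_nat.
rewrite -[LHS]comp_assoc -[LHS]comp_assoc [X in _ ∘ X = _]comp_assoc cot_modelE.
rewrite -[RHS]comp_assoc es [RHS]comp_assoc cot_modelE -!cmap_comp.
by rewrite (lift_inv' eg) ef.
Qed.

Theorem homotopy_cotensors : ProvidesCotensors dK En U.
Proof.
exists (fun Y c d => curry dK (ecomp En d (bob U (Y : op V) c) c ∘
  (hcot_unit Y c ⊡ idm _) ∘ swp dS _ Y)).
split; [|split].
- move=> Y c d; pose k := cot_model Y c.
  pose h := curry K (ecomp (hcat X) (B d) (ct (B' Y) (B c)) (B c) ∘
      (cot_unit X (B' Y) (B c) ⊠ idm _) ∘ swp S _ (B' Y)).
  have hE : curry dK (ecomp En d (bob U (Y : op V) c) c ∘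
      (hcot_unit Y c ⊡ idm _) ∘ swp dS _ Y) ∘ rho d (bob U (Y : op V) c) =
      ihom_map dK (b' Y) (rho d c) ∘ dhom D (B' Y) (mh (B d) (B c)) ∘
        gM (h ∘ mhm (idm (B d)) k).
  { rewrite -dhom_curry; apply: curry_inj; rewrite [RHS]ev_curry.
    rewrite bmap_l comp_assoc ev_curry -[LHS]comp_assoc swp_nat comp_assoc.
    pose W := mhm k (idm (B c)) ∘ cot_unit X (B' Y) (B c).
    have e1 : (hcot_unit Y c ⊡ idm _) ∘ (idm Y ⊡ rho d (bob U (Y : op V) c)) =
        (rho (bob U (Y : op V) c) c ⊡ rho d (bob U (Y : op V) c)) ∘
          (gM W ⊡ idm _) ∘ (b' Y ⊡ idm _).
      by rewrite /hcot_unit -lock -!bmap_comp !comp_idl !comp_idr.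
    rw e1; rewrite EcE -[LHS]comp_assoc -swp_nat comp_assoc.
    rewrite (post (dmul_natl D _ _)) !comp_assoc (post (eq_sym (dmul_swp D _ _))).
    rewrite !comp_assoc; congr (_ ∘ _ ∘ _).
    rewrite -!comp_assoc -!(fmap_comp (gamma P)); congr (_ ∘ fmap (gamma P) _).
    rewrite [in RHS]bmap_l [RHS]comp_assoc ev_curry -[RHS]comp_assoc swp_nat.
    rewrite /W [in LHS]bmap_l !comp_assoc -hcat_mid; congr (_ ∘ _).
    by rewrite -[LHS]comp_assoc -[RHS]comp_assoc -bmap_rl -bmap_lr. }
  apply: (iso_cancel_r (rhoI d (bob U (Y : op V) c))); rewrite hE.
  apply: iso_comp; first apply: iso_comp.
  + by apply: ihom_map_iso; [apply: (b_iso bVb' bbV') | apply: rhoI].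
  + by apply: dhom_iso; [apply: B'_cof | apply: hm_fibrant].
  + rewrite (fmap_comp (gamma P)); apply: iso_comp.
      by apply: iso_fmap; apply: (cot_hom_iso X).
    have i1 : is_iso (rhom r (B d) (ct (B' Y) (B c))).
      by apply: r_iso => //; apply: cot_fibrant.
    apply: (iso_cancel_l i1); rewrite rhom_nat; apply: iso_comp; last exact: r_iso.
    apply: iso_cmap; last exact: cot_model_iso.
    by rewrite (fmap_id (gamma Q)); apply: iso_id.
- by move=> Y c d d'; apply: ihom_pre_ecomp.
- move=> Y Y' c c' d q p; apply: curry_inj.
  set th := curry dK (ecomp En d (bob U (Y : op V) c) c ∘ _ ∘ _).
  set th' := curry dK (ecomp En d (bob U (Y' : op V) c') c' ∘ _ ∘ _).
  have thE : ev dK Y _ ∘ (th ⊡ idm Y) = ecomp En d (bob U (Y : op V) c) c ∘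
      (hcot_unit Y c ⊡ idm _) ∘ swp dS _ Y by exact: ev_curry.
  have thE' : ev dK Y' _ ∘ (th' ⊡ idm Y') = ecomp En d (bob U (Y' : op V) c') c' ∘
      (hcot_unit Y' c' ⊡ idm _) ∘ swp dS _ Y' by exact: ev_curry.
  rewrite (bmap_l _ _ th') (bmap_l _ _ (ihom_map dK _ _)) !comp_assoc ev_ihom_map thE'.
  rw (eq_sym (bmap_rl (tens dS) th q)); rewrite (bmap_lr (tens dS) th q); rw thE.
  rewrite -[LHS]comp_assoc -[RHS]comp_assoc !swp_nat !comp_assoc; congr (_ ∘ _).
  rewrite -[LHS]comp_assoc -bmap_lr bmap_rl comp_assoc.
  rewrite -[bmap R _ (bmap U (q : @Hom (op V) _ _) p)]/(cmap R (idm d) (cmap U q p)).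
  rewrite (ecomp_mid r_iso B_cof B_fib bVb bbV EcE).
  rewrite -[LHS]comp_assoc -bmap_l -hcot_unit_dinatural.
  rewrite -[bmap R _ p]/(cmap R (idm d) p).
  rewrite -(ecomp_post r_iso B_cof B_fib bVb bbV EcE) -!comp_assoc -!bmap_l.
  by rewrite ?comp_assoc.
Qed.
End HomotopyTensors.

(** * Derived mapping objects, tensors and cotensors *)
Theorem homotopy_tensored (M : MonoidalModelCategory) (D : DerivedStructure M)
    (N : Category) (Q : ModelStructure N) (X : TensoredModelCategory M Q) :
  exists (R : Functor (prodC (op (Ho Q)) (Ho Q)) (Ho (mmod M)))
         (r : NatTrans (compF (gamma (mmod M)) (hm X))
            (compF (compF R (loc_op_prod (we Q) (we Q)))
                   (loc (prodW (opW (we Q)) (we Q))))),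
    IsRightDerived (compF R (loc_op_prod (we Q) (we Q))) r /\
    exists E : Enrichment (dten D) R,
      (exists (T : Functor (prodC (op (Ho (mmod M))) (Ho Q)) (Ho Q))
              (t : NatTrans (compF (gamma Q) (cot X))
                 (compF (compF T (loc_op_prod (we (mmod M)) (we Q)))
                        (loc (prodW (opW (we (mmod M))) (we Q))))),
         IsRightDerived (compF T (loc_op_prod (we (mmod M)) (we Q))) t /\
         ProvidesCotensors (dclo D) E T) /\
      (exists (T : Functor (prodC (Ho Q) (Ho (mmod M))) (Ho Q))
              (t : NatTrans
                 (compF (compF T (loc_prod (we Q) (we (mmod M))))
                        (loc (prodW (we Q) (we (mmod M)))))
                 (compF (gamma Q) (ten X))),
         IsLeftDerived (compF T (loc_prod (we Q) (we (mmod M)))) t /\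
         ProvidesTensors (dclo D) E T).
Proof.
have [R [r hr]] := right_derived_bi_exists (V := model_replacement Q)
  (V' := fibrant_replacement Q) (@hm_we _ _ _ X).
have [T [e he]] := left_derived_bi_exists (@ten_we _ _ _ X).
have [U [t ht]] := right_derived_bi_exists (V := model_replacement (mmod M))
  (V' := fibrant_replacement Q) (@cot_we _ _ _ X).
have [B [b [bV [Bc [Bf [bVb bbV]]]]]] := bifibrant_choice Q.
have [B' [b' [bV' [Bc' [Bf' [bVb' bbV']]]]]] := bifibrant_choice (mmod M).
have [Ec [EcE EidE]] := homotopy_enriched_exists D hr Bc Bf bVb bbV.
have hb := hname_bij hr he ht Bc Bf bVb bbV EidE.
have [En enE] := homotopy_enrichment hr Bc Bf bVb bbV EcE EidE hb.
subst Ec.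
exists R, r; split; first exact: right_derived_bi hr.
exists En; split.
- exists U, t; split; first exact: right_derived_bi ht.
  exact: (homotopy_cotensors hr ht Bc Bf bVb bbV Bc' Bf' bVb' bbV' EcE).
- exists T, e; split; first exact: left_derived_bi he.
  exact: (homotopy_tensors hr he Bc Bf bVb bbV Bc' Bf' bVb' bbV' EcE).
Qed.

(** * Modules over a monoid *)

Section Modules.
Context (M : MonoidalModelCategory) (A : Monoid (mten M)) (Q : ModelStructure (Mod A)).
Context (fib_created : forall (X Y : Mod A) (f : Hom X Y),
           fib Q f <-> fib (mmod M) (mmap f)).
Context (we_created : forall (X Y : Mod A) (f : Hom X Y),
           we Q f <-> we (mmod M) (mmap f)).
Local Notation S := (mten M).
Local Notation K := (mclo M).
Local Notation P := (mmod M).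
Local Notation E := (lims P).
Local Notation "x ⊗ y" := (bob (tens S) x y) (at level 38, left associativity).
Local Notation "f ⊠ g" := (bmap (tens S) f g) (at level 38, left associativity).

Lemma module_ten_adj (x : Module A) (Y : M) (y : Module A)
    (f : ModuleMap (mod_tens x Y) y) :
  exists! g : Hom Y (mod_hom K E x y),
    @comp (Mod A) _ _ _ (mev K E x y) (mod_tens_map (idm (x : Mod A)) g) = f.
Proof.
exists (mcur K E f); split; first by apply: mmap_eq; apply: mev_mcur.
move=> g h; apply: mev_inj; rewrite mev_mcur -h.
by [].
Qed.

Lemma module_cot_adj (x : Module A) (Y : M) (y : Module A)
    (f : ModuleMap (mod_tens x Y) y) :
  exists! g : ModuleMap x (mod_ihom K Y y),
    @comp (Mod A) _ _ _ (mod_ev K Y y) (mod_tens_map g (idm Y)) = f.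
Proof.
exists (mod_curry K f); split; first by apply: mmap_eq; apply: ev_curry.
move=> g h; apply: mmap_eq; rewrite -h /= curry_ev.
by [].
Qed.

(** The underlying map of [s] is the one that the unit axiom of [M] speaks of, the
    underlying object of a fibrant module being fibrant. *)
Lemma module_unit_axiom :
  exists (Ic : M) (w : Hom Ic (unit S)),
    cofibrant P Ic /\ we P w /\
    forall (y : Module A) (s : ModuleMap y (mod_ihom K Ic y)), fibrant Q y ->
      @comp (Mod A) _ _ _ (mod_ev K Ic y) (mod_tens_map s (idm Ic)) =
      @comp (Mod A) _ _ _ (mid_map y) (mod_tens_map (idm (y : Mod A)) w) ->
      we Q (s : @Hom (Mod A) _ _).
Proof.
have [Ic [w [hI [hw h]]]] := unit_we M.
exists Ic, w; split=> //; split=> // y s hy es; apply/we_created.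
have := h _ (fibrant_underlying fib_created hy).
congr (we P _); apply: (curry_inj (K := K)).
have e : ev K Ic y ∘ (mmap s ⊠ idm Ic) = run S y ∘ (idm (mdl y) ⊠ w) :=
  f_equal (@mmap _ _ _ _ _) es.
rewrite e bmap_l comp_assoc ev_ihom_map comp_idl -comp_assoc -bmap_rl bmap_lr.
by rewrite comp_assoc ev_curry.
Qed.

Lemma mid_map_we (x : Module A) : we Q (mid_map x : @Hom (Mod A) _ _).
Proof.
by apply/we_created; apply: we_iso; exists (runV S x); rewrite runK runVK.
Qed.

Definition modules_tensored : TensoredModelCategory M Q.
Proof.
refine (@Build_TensoredModelCategory M (Mod A) Q (mod_homF K A E)
  (mod_enriched K A E)
  _ _ _ _ (mod_tensF A) (mev K E) _ module_ten_adj (@mid_map _ _ A) _ mid_map_we _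
  (tunit K E) _ _ (mod_ihomF K A) (@mod_ev _ _ K A) _ module_cot_adj (ceval K E) _ _
  _ _ _ _ _ _ module_unit_axiom).
- move=> x y z z' g; exact: (mcomp_post K E x y g).
- move=> x x' y z f; exact: (mcomp_pre K E y z f).
- move=> x y y' z k; exact: (mcomp_mid K E x z k).
- move=> x y f; exact: (mid_dinatural K E f).
- move=> x y y' g; apply: mmap_eq; exact: (mev_post K E x g).
- move=> x y f; apply: mmap_eq; exact: (run_nat S).
- move=> x; apply: mmap_eq; exact: (mev_mcur K E).
- move=> x x' Y Y' f g; exact: (tunit_dinatural K E f g).
- move=> x Y y; exact: (tensor_iso_iso K E x Y y).
- move=> Y y y' g; apply: mmap_eq.
  have := ev_ihom_map K (idm Y) (mmap g); rewrite bmap_id comp_idr => h; exact: h.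
- move=> Y Y' y y' g f; exact: (ceval_dinatural K E g f).
- move=> x Y y; exact: (cotensor_iso_iso K E x Y y).
- exact: tensor_preserves fib_created we_created.
- exact: hom_preserves fib_created we_created.
- exact: cotensor_preserves fib_created we_created.
- exact: tens_cofibrant fib_created we_created.
- exact: hom_fibrant fib_created we_created.
- exact: ihom_fibrant fib_created we_created.
Defined.
End Modules.

Theorem theorem1p1 (M : MonoidalModelCategory) (D : DerivedStructure M)
    (A : Monoid (mten M)) (Q : ModelStructure (Mod A))
    (fib_created : forall (X Y : Mod A) (f : Hom X Y),
       fib Q f <-> fib (mmod M) (mmap f))
    (we_created : forall (X Y : Mod A) (f : Hom X Y),
       we Q f <-> we (mmod M) (mmap f)) :
  exists (R : Functor (prodC (op (Ho Q)) (Ho Q)) (Ho (mmod M)))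
         (r : NatTrans
            (compF (gamma (mmod M)) (mod_homF (mclo M) A (lims (mmod M))))
            (compF (compF R (loc_op_prod (we Q) (we Q)))
                   (loc (prodW (opW (we Q)) (we Q))))),
    IsRightDerived (compF R (loc_op_prod (we Q) (we Q))) r /\
    exists E : Enrichment (dten D) R,
      (exists (T : Functor (prodC (op (Ho (mmod M))) (Ho Q)) (Ho Q))
              (t : NatTrans
                 (compF (gamma Q) (mod_ihomF (mclo M) A))
                 (compF (compF T (loc_op_prod (we (mmod M)) (we Q)))
                        (loc (prodW (opW (we (mmod M))) (we Q))))),
         IsRightDerived (compF T (loc_op_prod (we (mmod M)) (we Q))) t /\
         ProvidesCotensors (dclo D) E T) /\
      (exists (T : Functor (prodC (Ho Q) (Ho (mmod M))) (Ho Q))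
              (t : NatTrans
                 (compF (compF T (loc_prod (we Q) (we (mmod M))))
                        (loc (prodW (we Q) (we (mmod M)))))
                 (compF (gamma Q) (mod_tensF A))),
         IsLeftDerived (compF T (loc_prod (we Q) (we (mmod M)))) t /\
         ProvidesTensors (dclo D) E T).
Proof. exact: (homotopy_tensored D (modules_tensored fib_created we_created)). Qed.
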